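(* There are no geometrical Lorenz sets in the conservative setting: if $M$ is a compact 3-dimensional manifold and $X\in\mathfrak{X}^1_m(M)$ is a conservative vector field, then $X$ has no geometrical Lorenz set.
   Context: $M$ is a compact connected smooth 3-manifold (without boundary) with a smooth volume $m$. $\mathfrak{X}^1_m(M)$ is the set of $C^1$ vector fields on $M$ that are conservative, i.e. divergence free with respect to $m$. A geometrical Lorenz set (geometric Lorenz attractor) of a vector field $X$ with flow $X_t$ is a compact $X_t$-invariant set $\Lambda$ such that: (i) there is an open neighborhood $U$ of $\Lambda$ with $X_t(\overline{U})\subset U$ for all $t>0$ and $\Lambda=\bigcap_{t>0}X_t(U)$; (ii) $\Lambda$ contains exactly one singularity $\sigma$, which is hyperbolic with real eigenvalues $\lambda_2<\lambda_3<0<\lambda_1$ satisfying $-\lambda_3<\lambda_1$; (iii) there is a cross section $\Sigma\subset U$ to the flow, identified with $[-1,1]^2$ with coordinates $(x,y)$, such that $\Gamma=\{x=0\}$ is contained in the stable manifold of $\sigma$, every point of $\Sigma\setminus\Gamma$ has a first return to $\Sigma$, and the first return map has the form $F(x,y)=(f(x),g(x,y))$ on $\Sigma\setminus\Gamma$, where $f:[-1,1]\setminus\{0\}\to[-1,1]$ is $C^1$ with $f'\ge c$ for some constant $c>\sqrt2$, has one-sided limits at $0$ satisfying $f(0^-)>0>f(0^+)$, and $|\partial_y g|\le\mu$ for some constant $\mu<1$; (iv) $\Lambda$ is the closure of the union of the $X_t$-orbits of the points of $\bigcap_{n\ge1}\overline{F^n(\Sigma_n)}$, where $\Sigma_n$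 is the set of points of $\Sigma$ at which $F^n$ is defined. *)

(* Defs.v *)
From mathcomp Require Import all_boot all_order all_algebra.
From mathcomp Require Import complex.
From mathcomp Require Import all_classical all_reals all_analysis.
Set Implicit Arguments.
Unset Strict Implicit.
Unset Printing Implicit Defensive.
Import Order.TTheory GRing.Theory Num.Theory.
Import numFieldNormedType.Exports.
Local Open Scope classical_set_scope.
Local Open Scope ring_scope.

(* Iterating directional derivatives along every fixed vector gives the usual
   C^k when V is finite-dimensional and U is open, the only case used here. *)
Fixpoint Ck (R : realType) (V W : normedModType R) (k : nat) (U : set V)
    (f : V -> W) : Prop :=
  (forall x, U x -> {for x, continuous f}) /\
  match k with
  | 0 => True
  | k'.+1 => forall v : V,
      (forall x, U x -> derivable f x v) /\ Ck k' U ('D_v f)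
  end.

Definition smooth_on (R : realType) (V W : normedModType R) (U : set V)
    (f : V -> W) : Prop :=
  forall k, Ck k U f.

(* Derivative relative to D: one-sided at the endpoints of an interval. *)
Definition has_derivative_within (R : realType) (D : set R) (f : R -> R)
    (x l : R) : Prop :=
  (fun z => (z - x)^-1 * (f z - f x)) @ within D x^' --> l.

Definition C1_within_with (R : realType) (D : set R) (f f' : R -> R) : Prop :=
  (forall x, D x -> has_derivative_within D f x (f' x)) /\
  {within D, continuous f'}.

Record chart (R : realType) (M : topologicalType) := Chart {
  cdom : set M;
  cmap : M -> 'rV[R]_3;
  cinv : 'rV[R]_3 -> M;
  cdom_open : open cdom;
  cimg_open : open (cmap @` cdom);
  cmapK : forall p, cdom p -> cinv (cmap p) = p;
  cmap_continuous : {within cdom, continuous cmap};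
  cinv_continuous : {within cmap @` cdom, continuous cinv}
}.

Definition cimg (R : realType) (M : topologicalType) (c : chart R M) :
  set 'rV[R]_3 := cmap c @` cdom c.

(* [transition c c'] is meaningful on [overlap c c'] only. *)
Definition overlap (R : realType) (M : topologicalType) (c c' : chart R M) :
  set 'rV[R]_3 := cmap c @` (cdom c `&` cdom c').

Definition transition (R : realType) (M : topologicalType) (c c' : chart R M) :
  'rV[R]_3 -> 'rV[R]_3 := cmap c' \o cinv c.

(* Second countability is not required: it follows from compactness. *)
Record manifold3 (R : realType) := Manifold3 {
  mcarrier :> topologicalType;
  mhausdorff : hausdorff_space mcarrier;
  mindex : Type;
  mchart : mindex -> chart R mcarrier;
  mcover : forall p : mcarrier, exists i, cdom (mchart i) p;
  msmooth : forall i j, smooth_on (overlap (mchart i) (mchart j))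
                                  (transition (mchart i) (mchart j))
}.

(* A smooth volume as a positive smooth density: in chart i the measure is
   [vdens i x] dx, and the compatibility is the change of variables formula. *)
Record volume (R : realType) (M : manifold3 R) := Volume {
  vdens : mindex M -> 'rV[R]_3 -> R;
  vdens_gt0 : forall i x, cimg (mchart i) x -> 0 < vdens i x;
  vdens_smooth : forall i, smooth_on (cimg (mchart i)) (vdens i : _ -> R^o);
  vdens_compat : forall i j x, overlap (mchart i) (mchart j) x ->
    vdens i x = vdens j (transition (mchart i) (mchart j) x) *
                `|\det (jacobian (transition (mchart i) (mchart j)) x)|
}.

(* A section of the tangent bundle, given by its coordinate expressions. *)
Record vfield (R : realType) (M : manifold3 R) := VField {
  vrep : mindex M -> 'rV[R]_3 -> 'rV[R]_3;
  vrep_compat : forall i j x, overlap (mchart i) (mchart j) x ->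
    vrep j (transition (mchart i) (mchart j) x) =
    'D_(vrep i x) (transition (mchart i) (mchart j)) x
}.

Definition C1_vfield (R : realType) (M : manifold3 R) (X : vfield M) : Prop :=
  forall i, Ck 1 (cimg (mchart i)) (vrep X i).

(* div_m X = rho^-1 * sum_k d_k (rho * X^k), where m = rho dx. *)
Definition divergence (R : realType) (M : manifold3 R) (m : volume M)
    (X : vfield M) (i : mindex M) (x : 'rV[R]_3) : R :=
  (vdens m i x)^-1 *
  \sum_(k < 3) 'D_(delta_mx 0 k : 'rV[R]_3)
                 (fun y => vdens m i y * vrep X i y 0 k : R^o) x.

Definition conservative_C1 (R : realType) (M : manifold3 R) (m : volume M) :
  set (vfield M) :=
  [set X | C1_vfield X /\
           forall i x, cimg (mchart i) x -> divergence m X i x = 0].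

Definition is_flow (R : realType) (M : manifold3 R) (X : vfield M)
    (Phi : R -> M -> M) : Prop :=
  [/\ forall p, Phi 0 p = p,
      forall s t p, Phi (s + t) p = Phi s (Phi t p),
      continuous (fun tp : R * M => Phi tp.1 tp.2) &
      forall i t p, cdom (mchart i) (Phi t p) ->
        is_derive (t : R^o) 1 (fun s : R^o => cmap (mchart i) (Phi s p))
          (vrep X i (cmap (mchart i) (Phi t p)))].

Definition singularity (R : realType) (M : manifold3 R) (X : vfield M)
    (p : M) : Prop :=
  forall i, cdom (mchart i) p -> vrep X i (cmap (mchart i) p) = 0.

(* [jacobian] acts on row vectors, hence is the transpose of the usual matrix;
   at a singularity its spectrum is chart independent. *)
Definition vfield_eigenvalue (R : realType) (M : manifold3 R) (X : vfield M)
    (p : M) (l : R) : Prop :=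
  forall i, cdom (mchart i) p ->
    eigenvalue (jacobian (vrep X i) (cmap (mchart i) p)) l.

Definition hyperbolic_singularity (R : realType) (M : manifold3 R)
    (X : vfield M) (p : M) : Prop :=
  singularity X p /\
  forall i, cdom (mchart i) p -> forall z : complex R,
    eigenvalue (map_mx (real_complex R)
                  (jacobian (vrep X i) (cmap (mchart i) p))) z ->
    complex.Re z != 0.

Definition stable_set (R : realType) (M : manifold3 R) (Phi : R -> M -> M)
    (q : M) : set M :=
  [set p | Phi t p @[t --> +oo] --> q].

Definition invariant_set (R : realType) (M : manifold3 R) (Phi : R -> M -> M)
    (L : set M) : Prop :=
  forall t, Phi t @` L = L.

Definition attracting (R : realType) (M : manifold3 R) (Phi : R -> M -> M)
    (L U : set M) : Prop :=
  [/\ open U, L `<=` U,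
      forall t, 0 < t -> Phi t @` closure U `<=` U &
      L = \bigcap_(t in [set t : R | 0 < t]) (Phi t @` U)].

(* l1, l2, l3 are distinct, so they are all the eigenvalues. *)
Definition lorenz_singularity (R : realType) (M : manifold3 R) (X : vfield M)
    (q : M) : Prop :=
  hyperbolic_singularity X q /\
  exists l1 l2 l3 : R,
    [/\ vfield_eigenvalue X q l1, vfield_eigenvalue X q l2,
        vfield_eigenvalue X q l3,
        [/\ l2 < l3, l3 < 0 & 0 < l1] & - l3 < l1].

Definition square (R : realType) : set (R^o * R^o) :=
  [set z | (-1 <= z.1 <= 1) /\ (-1 <= z.2 <= 1)].

(* [s] parametrizes the cross section [s @` square]: a C^1 embedding of the
   closed square, C^1 up to the boundary, transverse to X. *)
Definition cross_section (R : realType) (M : manifold3 R) (X : vfield M)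
    (s : R^o * R^o -> M) : Prop :=
  [/\ {in @square R &, injective s},
      exists V : set (R^o * R^o),
        [/\ open V, @square R `<=` V,
            forall z, V z -> {for z, continuous s} &
            forall i, Ck 1 (V `&` s @^-1` cdom (mchart i))
                         (cmap (mchart i) \o s)] &
      forall i z, square z -> cdom (mchart i) (s z) ->
        row_free (col_mx (col_mx
          ('D_((1, 0) : R^o * R^o) (cmap (mchart i) \o s) z)
          ('D_((0, 1) : R^o * R^o) (cmap (mchart i) \o s) z))
          (vrep X i (cmap (mchart i) (s z))))].

Definition first_return (R : realType) (M : manifold3 R) (Phi : R -> M -> M)
    (S : set M) (p q : M) : Prop :=
  exists2 t : R, 0 < t &
    [/\ Phi t p = q, S q & forall r, 0 < r < t -> ~ S (Phi r p)].

Definition punctured (R : realType) : set R :=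
  [set x | -1 <= x <= 1 /\ x != 0].

Definition lorenz_map (R : realType) (f : R -> R) (g : R -> R -> R)
    (z : R^o * R^o) : R^o * R^o := (f z.1, g z.1 z.2).

(* The points of the square at which the n-th iterate of the partial map
   [lorenz_map f g], defined off x = 0, is defined. *)
Definition iter_dom (R : realType) (f : R -> R) (g : R -> R -> R) (n : nat) :
  set (R^o * R^o) :=
  [set z | square z /\
           forall k, (k < n)%N -> (iter k (lorenz_map f g) z).1 != 0].

Definition lorenz_one_dim (R : realType) (f : R -> R) : Prop :=
  [/\ forall x, @punctured R x -> -1 <= f x <= 1,
      exists f' : R -> R, C1_within_with (@punctured R) f f' /\
        exists2 c : R, Num.sqrt 2 < c & forall x, @punctured R x -> c <= f' x &
      exists fm fp : R,
        [/\ f x @[x --> 0^'-] --> fm, f x @[x --> 0^'+] --> fp,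
            0 < fm & fp < 0]].

Definition fiber_contracting (R : realType) (g : R -> R -> R) : Prop :=
  exists2 mu : R, mu < 1 &
    forall x y : R, @punctured R x -> -1 <= y <= 1 ->
      exists2 l : R, has_derivative_within `[-1, 1]%classic (g x) y l &
                     `|l| <= mu.

Definition lorenz_return (R : realType) (M : manifold3 R) (X : vfield M)
    (Phi : R -> M -> M) (U : set M) (q : M) (s : R^o * R^o -> M)
    (f : R -> R) (g : R -> R -> R) : Prop :=
  [/\ cross_section X s /\ s @` @square R `<=` U,
      forall z, square z -> z.1 = 0 -> stable_set Phi q (s z),
      forall z, square z -> z.1 != 0 ->
        square (lorenz_map f g z) /\
        first_return Phi (s @` @square R) (s z) (s (lorenz_map f g z)),
      lorenz_one_dim f &
      fiber_contracting g].

Definition section_attractor (R : realType) (M : manifold3 R)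
    (s : R^o * R^o -> M) (f : R -> R) (g : R -> R -> R) : set M :=
  \bigcap_(n in [set n | (0 < n)%N])
     closure (s @` (iter n (lorenz_map f g) @` iter_dom f g n)).

Definition geometrical_lorenz_set (R : realType) (M : manifold3 R)
    (X : vfield M) (Phi : R -> M -> M) (L : set M) : Prop :=
  [/\ compact L, invariant_set Phi L &
   exists U : set M,
   [/\ attracting Phi L U &
    exists q : M,
    [/\ L q, lorenz_singularity X q,
        forall p, L p -> singularity X p -> p = q &
     exists s f g,
       lorenz_return X Phi U q s f g /\
       L = closure (\bigcup_(p in @section_attractor R M s f g)
                      range (fun t => Phi t p))]]].

(* Main.v *)
Require Import Defs.
From mathcomp Require Import all_boot all_order all_algebra.
From mathcomp Require Import all_classical all_reals all_analysis.
From mathcomp Require Import ring lra.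
Set Implicit Arguments.
Unset Strict Implicit.
Unset Printing Implicit Defensive.
Import Order.TTheory GRing.Theory Num.Theory.
Import numFieldNormedType.Exports.
Local Open Scope classical_set_scope.
Local Open Scope ring_scope.

(** The flux of a divergence free field through a cross section is invariant under
    the first return map, and no map of Lorenz type preserves a finite measure with
    positive continuous density on the square.

    Let [rho] be the flux density on the square, that is the density of the volume
    times the determinant of the two tangent vectors of the section and the field.
    The return map [F (x, y) = (f x, g x y)] has a triangular differential, so
    invariance reads [f' x * |dg/dy| * rho (F (x, y)) = rho (x, y)]
    ([flux_invariant]). Integrated along the fibre over [x], it says that [f' x]
    times the mass of the image of this fibre, inside the fibre over [f x], is the
    mass of the fibre over [x]. Since [f] is increasing on each side of [0], at most
    two fibres are mapped into the fibre over a given [u]. Their images are closed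
    intervals, disjoint because a first return map is injective
    ([return_injective]), and each is shorter than the fibre by the contraction
    hypothesis; hence they miss an open interval, and their masses add up to less
    than the mass of the fibre over [u]. Integrating over [u] and changing variable
    along the two branches of [f] gives the total mass on both sides of a strict
    inequality ([no_area_preserving_lorenz_map]).

    To prove invariance, follow two curves of initial points through [s z] along the
    flow, and consider the separations of the moved points in a chart. The volume of
    the parallelepiped spanned by the two separations and the field, weighted by the
    density, is constant to second order in the parameter of the curves: this is
    Liouville's formula [area_is_derive] as long as the orbit stays in one chart,
    and the compatibility of densities and vector fields when the chart changes
    ([transported_orbit]). The flow is only known to be continuous in the initial
    point, so separations are controlled by Gronwall's inequality instead of a
    derivative. At the return time they are compared with the increments of [F] in
    the flow box coordinates [(w, t) |-> Phi t (s w)], which are strictly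
    differentiable with invertible differential by transversality. The inverse
    function theorem shows that [F] and the return time are continuous at [z], and
    the time coordinate does not contribute to the determinant. *)

(** * Neighbourhoods, norms and mean value inequalities *)

Lemma near_dist_lt (R : realType) (V : normedModType R) (x : V) (d : R) :
  0 < d -> \forall y \near x, `|y - x| < d.
Proof.
by move=> d0; apply/nbhs_ballP; exists d => //= y; rewrite -ball_normE /= distrC.
Qed.

Lemma near0_lt (R : realType) (d : R) : 0 < d -> \forall u \near (0 : R), `|u| < d.
Proof.
move=> d0; apply/nbhs_ballP; exists d => //= u.
by rewrite -ball_normE /= sub0r normrN.
Qed.

Lemma near_prod_dist (R : realType) (V W : normedModType R) (P : V -> W -> Prop) x y :
  (\forall x' \near x & y' \near y, P x' y') ->
  exists2 d : R, 0 < d & forall x' y', `|x' - x| < d -> `|y' - y| < d -> P x' y'.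
Proof.
move=> [[A B] /= [/nbhs_ballP[a /= a0 aA] /nbhs_ballP[b /= b0 bB]] AB].
exists (Num.min a b); first by rewrite lt_min a0.
move=> x' y'; rewrite !lt_min => /andP[xa _] /andP[_ yb].
apply: (AB (x', y')); split=> /=.
  by apply: aA; rewrite -ball_normE /= distrC.
by apply: bB; rewrite -ball_normE /= distrC.
Qed.

Section RowVectors.
Variables (R : realType) (n : nat).
Implicit Types v w : 'rV[R]_n.

Lemma rV_norm_coord v k : `|v 0 k| <= `|v|.
Proof.
rewrite [leRHS]/Num.Def.normr/= mx_normrE.
exact: (le_bigmax _ (fun i : 'I_1 * 'I_n => `|v i.1 i.2|) (0, k)).
Qed.

Lemma rV_norm_le v c : 0 <= c -> (forall k, `|v 0 k| <= c) -> `|v| <= c.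
Proof.
move=> c0 vc; rewrite [leLHS]/Num.Def.normr/= mx_normrE.
by apply: bigmax_le => // -[i k] _ /=; rewrite ord1.
Qed.

End RowVectors.

Lemma mulmx_bounded (R : realType) n m (N : 'M[R]_(n, m)) :
  exists2 C, 0 < C & forall v : 'rV_n, `|v *m N| <= C * `|v|.
Proof.
exists (1 + \sum_i \sum_j `|N i j|).
  by rewrite ltr_wpDr// sumr_ge0// => i _; rewrite sumr_ge0.
move=> v; apply: rV_norm_le => [|k].
  by rewrite mulr_ge0// addr_ge0// sumr_ge0// => i _; rewrite sumr_ge0.
rewrite mxE (le_trans (ler_norm_sum _ _ _))// mulrC mulrDr mulr1.
rewrite ler_wpDl// mulr_sumr ler_sum// => i _.
rewrite normrM ler_pM ?rV_norm_coord//.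
by rewrite (bigD1 k)//= lerDl sumr_ge0.
Qed.

(** Stated of the space of values, so that one argument serves real valued and
    vector valued maps. *)
Definition mean_value_inequality (R : realType) (W : normedModType R) :=
  forall (h h' : R -> W) (a b c : R), 0 <= c ->
  (forall s, Num.min a b <= s <= Num.max a b -> is_derive s 1 h (h' s)) ->
  (forall s, Num.min a b <= s <= Num.max a b -> `|h' s| <= c) ->
  `|h b - h a| <= c * `|b - a|.

Section MeanValue.
Variable R : realType.

Lemma between_dist (a b s : R) :
  Num.min a b <= s <= Num.max a b -> `|s - a| <= `|b - a|.
Proof.
case: (leP a b) => ab /andP[? ?].
  by rewrite !ger0_norm ?subr_ge0//; lra.
rewrite !ler0_norm ?subr_le0//; first lra.
exact: ltW.
Qed.

Lemma between_sub (a b s r : R) : Num.min a b <= s <= Num.max a b ->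
  Num.min a s <= r <= Num.max a s -> Num.min a b <= r <= Num.max a b.
Proof.
by case: (leP a b) => ab /andP[? ?]; case: (leP a s) => ? /andP[? ?];
  apply/andP; split; lra.
Qed.

Lemma between_near (t t' q t0 d : R) : `|t - t0| < d -> `|t' - t0| < d ->
  Num.min t t' <= q <= Num.max t t' -> `|q - t0| < d.
Proof.
case: (leP t t') => _; rewrite !ltr_norml => /andP[? ?] /andP[? ?] /andP[? ?];
  by apply/andP; split; lra.
Qed.

Lemma mean_value_inequality_real : mean_value_inequality (R^o).
Proof.
move=> h h' a b c c0 dh hc.
wlog ab : a b dh hc / a <= b => [H|].
  case: (leP a b) => [|/ltW] ab; first exact: H.
  by rewrite distrC (distrC b); apply: H => // s; rewrite minC maxC; auto.
move: dh hc; rewrite (min_idPl ab) (max_idPr ab) => dh hc.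
have sE s : s \in `]a, b[ -> a <= s <= b.
  by rewrite in_itv/= => /andP[??]; rewrite !ltW.
have [//|||] := @MVT_segment R h h' a b.
- by move=> x /sE; exact: dh.
- by apply: derivable_within_continuous => x; rewrite in_itv/= => /dh[].
- by move=> s; rewrite in_itv/= => sab ->; rewrite normrM ler_wpM2r// hc.
Qed.

Lemma is_derive_coord (V : normedModType R) m n (h : V -> 'M[R]_(m, n)) h' t v i j :
  is_derive t v h h' -> is_derive t v (fun x => h x i j : R^o) (h' i j).
Proof.
move=> [dh <-]; apply: DeriveDef; first exact: ((derivable_mxP _ _ _).1 dh).
by rewrite derive_mx// mxE.
Qed.

Lemma mean_value_inequality_rV n : mean_value_inequality 'rV[R]_n.
Proof.
move=> h h' a b c c0 dh hc; apply: rV_norm_le => [|k]; first by rewrite mulr_ge0.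
rewrite !mxE.
apply: (@mean_value_inequality_real (fun s => h s 0 k) (fun s => h' s 0 k)) => //.
- by move=> s /dh; exact: is_derive_coord.
- by move=> s /hc; exact/le_trans/rV_norm_coord.
Qed.

End MeanValue.

(** * Strict differentiability *)

Section StrictDifferentiability.
Variable R : realType.

(** Controlling pairs of points near [x], and not only the pairs containing [x],
    is what makes a Lipschitz constant and an inverse function available. *)
Definition strict_diff (V W : normedModType R) (f : V -> W) (x : V)
    (L : V -> W) :=
  forall e : R, 0 < e -> exists2 d : R, 0 < d &
    forall y y', `|y - x| < d -> `|y' - x| < d ->
      `|f y' - f y - L (y' - y)| <= e * `|y' - y|.

Lemma is_derive_line (V W : normedModType R) (f : V -> W) y v (s : R) :
  derivable f (y + s *: v) v ->
  is_derive s 1 (fun t : R => f (y + t *: v)) ('D_v f (y + s *: v)).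
Proof.
rewrite /derivable /derive => df.
have E : (fun h : R => h^-1 *: (((fun t : R => f (y + t *: v)) \o shift s) (h *: 1) -
     f (y + s *: v))) = (fun h => h^-1 *: ((f \o shift (y + s *: v)) (h *: v)
     - f (y + s *: v))).
  apply/funext => h /=; congr (_ *: (f _ - _)).
  by rewrite scalerDl addrCA [_ *: 1]mulr1.
by apply: DeriveDef; rewrite /derivable /derive E.
Qed.

Lemma strict_partial (V W : normedModType R) (f : V -> W) x v :
  mean_value_inequality W ->
  (\forall y \near x, derivable f y v) -> {for x, continuous ('D_v f)} ->
  forall e : R, 0 < e -> exists2 d : R, 0 < d & forall y (t : R),
    `|y - x| < d -> `|t| < d ->
    `|f (y + t *: v) - f y - t *: 'D_v f x| <= e * `|t|.
Proof.
move=> mvi df cf e e0.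
have : \forall y \near x, derivable f y v /\ `|'D_v f x - 'D_v f y| <= e.
  near=> y; split; near: y; first exact: df.
  by move/cvgrPdist_le : cf; exact.
move=> /nbhs_ballP[d /= d0 dP].
have v0 : 0 < 1 + `|v| by rewrite ltr_pwDl.
exists (d / 2 / (1 + `|v|)); first by rewrite !divr_gt0.
move=> y t yx td.
have H s : Num.min 0 t <= s <= Num.max 0 t -> derivable f (y + s *: v) v /\
   `|'D_v f x - 'D_v f (y + s *: v)| <= e.
  move=> /between_dist; rewrite !subr0 => st; apply: dP; rewrite -ball_normE /ball_/=.
  rewrite opprD addrA (le_lt_trans (ler_normB _ _))// distrC normrZ.
  have : d / 2 / (1 + `|v|) <= d / 2.
    by rewrite ler_pdivrMr// ler_peMr ?lerDl// divr_ge0// ltW.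
  have : `|s| * `|v| <= `|t| * (1 + `|v|) by rewrite ler_pM// lerDr.
  move: td; rewrite ltr_pdivlMr//; lra.
have := mvi (fun s => f (y + s *: v) - s *: 'D_v f x)
  (fun s => 'D_v f (y + s *: v) - 'D_v f x) 0 t e (ltW e0).
rewrite scale0r addr0 !subr0 scale0r subr0 addrAC; apply.
- move=> s st; have [ds _] := H s st.
  apply: is_deriveB; first exact: is_derive_line.
  apply: DeriveDef; last first.
    rewrite deriveE; last exact: differentiableZl.
    by rewrite diffZl// diff_val scale1r.
  exact/derivable1_diffP/differentiableZl.
- by move=> s st; have [_] := H s st; rewrite distrC.
Unshelve. all: by end_near. Qed.

(** Moving along the directions [v k] one after the other; each step is a mean
    value estimate in a single direction. *)
Lemma strict_partials (V W : normedModType R) (f : V -> W) x (v : nat -> V) n :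
  mean_value_inequality W ->
  (forall k, (k < n)%N -> \forall y \near x, derivable f y (v k)) ->
  (forall k, (k < n)%N -> {for x, continuous ('D_(v k) f)}) ->
  forall e : R, 0 < e -> exists2 d : R, 0 < d & forall y (t : nat -> R),
    `|y - x| < d -> (forall k, (k < n)%N -> `|t k| < d) ->
    `|f (y + \sum_(k < n) t k *: v k) - f y - \sum_(k < n) t k *: 'D_(v k) f x|
    <= e * \sum_(k < n) `|t k|.
Proof.
move=> mvi; elim: n => [|n IH] df cf e e0.
  by exists 1 => // y t _ _; rewrite !big_ord0 addr0 subr0 subrr normr0 mulr0.
have [||d1 d10 d1P] := IH _ _ e e0.
- by move=> k kn; apply/df/ltnW.
- by move=> k kn; apply/cf/ltnW.
have [d2 d20 d2P] := strict_partial mvi (df n (ltnSn n)) (cf n (ltnSn n)) e0.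
pose N := 1 + \sum_(k < n) `|v k|.
have N0 : 0 < N by rewrite ltr_pwDl// sumr_ge0.
exists (Num.min d1 (d2 / 2 / N)).
  by rewrite lt_min d10/= !divr_gt0.
move=> y t; rewrite lt_min => /andP[yd1 yd2] td.
have tS k : (k < n.+1)%N -> `|t k| < d1 /\ `|t k| < d2 / 2 / N.
  by move=> /td; rewrite lt_min => /andP[].
have N1 : d2 / 2 / N <= d2 / 2.
  rewrite ler_pdivrMr// ler_peMr ?lerDl ?sumr_ge0//.
  by rewrite divr_ge0// ltW.
rewrite !big_ord_recr/=.
set S := \sum_(k < n) t k *: v k; set T := \sum_(k < n) t k *: 'D_(v k) f x.
have Sd : `|S| <= d2 / 2 / N * \sum_(k < n) `|v k|.
  rewrite (le_trans (ler_norm_sum _ _ _))// mulr_sumr ler_sum// => k _.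
  by rewrite normrZ ler_wpM2r// ltW// (tS _ (ltnW (ltn_ord k))).2.
have h1 := d1P y t yd1 (fun k kn => (tS k (ltnW kn)).1).
have h2 : `|f (y + S + t n *: v n) - f (y + S) - t n *: 'D_(v n) f x|
    <= e * `|t n|.
  apply: d2P; last first.
    by have [_ /lt_le_trans] := tS n (ltnSn n); apply; lra.
  rewrite addrAC (le_lt_trans (ler_normD _ _))//.
  have : d2 / 2 / N * N = d2 / 2 by rewrite divfK// gt_eqF.
  rewrite {2}/N mulrDr mulr1.
  move: Sd yd2; set A := d2 / 2 / N * _; lra.
rewrite mulrDr; apply: le_trans (lerD h1 h2).
rewrite (_ : _ - _ - (_ + _) = (f (y + S) - f y - T) +
  (f (y + S + t n *: v n) - f (y + S) - t n *: 'D_(v n) f x)).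
  exact: ler_normD.
by rewrite addrA [RHS]addrACA -opprD [f (y + S) - _ + _]addrC subrKA.
Qed.

Lemma strict_diff_of_partials (V W : normedModType R) (f : V -> W) x
    (v : nat -> V) (c : nat -> V -> R) n :
  mean_value_inequality W ->
  (forall w, w = \sum_(k < n) c k w *: v k) ->
  (forall k w, `|c k w| <= `|w|) ->
  (forall k, (k < n)%N -> \forall y \near x, derivable f y (v k)) ->
  (forall k, (k < n)%N -> {for x, continuous ('D_(v k) f)}) ->
  strict_diff f x (fun w => \sum_(k < n) c k w *: 'D_(v k) f x).
Proof.
move=> mvi cE cle df cf e e0.
have [|d d0 dP] := strict_partials mvi df cf (_ : 0 < e / n.+1%:R).
  by rewrite divr_gt0.
exists (d / 2); first by rewrite divr_gt0.
move=> y y' yd y'd.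
have yy' : `|y' - y| < d.
  rewrite -(subrKA x); apply: le_lt_trans (ler_normD _ _) _.
  by move: yd y'd; rewrite (distrC x); lra.
have := dP y (fun k => c k (y' - y)).
rewrite -(cE (y' - y)) subrKC => /(_ _ _)/le_trans; apply.
- by apply: lt_trans yd _; lra.
- by move=> k _; exact: le_lt_trans (cle _ _) yy'.
- rewrite -mulrA ler_wpM2l ?(ltW e0)// ler_pdivrMl//.
  apply: (@le_trans _ _ (\sum_(k < n) `|y' - y|)); first exact: ler_sum.
  by rewrite sumr_const card_ord -[leLHS]mulr_natl ler_wpM2r// ler_nat.
Qed.

Lemma strict_diff_lipschitz (V W : normedModType R) (f : V -> W) x L C :
  (forall v, `|L v| <= C * `|v|) -> strict_diff f x L ->
  exists2 d : R, 0 < d & forall y y', `|y - x| < d -> `|y' - x| < d ->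
    `|f y' - f y| <= (C + 1) * `|y' - y|.
Proof.
move=> LC fL; have [d d0 dP] := fL 1 ltr01.
exists d => // y y' yd y'd; have := dP y y' yd y'd; rewrite mul1r => h.
rewrite -[f y' - f y](subrK (L (y' - y))) (le_trans (ler_normD _ _))//.
by rewrite mulrDl mul1r addrC lerD.
Qed.

End StrictDifferentiability.

Section ContinuouslyDifferentiable.
Variable R : realType.

Lemma Ck1_near (V W : normedModType R) (U : set V) (f : V -> W) x v :
  open U -> Ck 1 U f -> U x ->
  (\forall y \near x, derivable f y v) /\ {for x, continuous ('D_v f)}.
Proof.
move=> Uo [_ /(_ v)[df [cf _]]] Ux; split; last exact: cf.
by have := open_nbhs_nbhs (conj Uo Ux); apply: filterS => y /df.
Qed.

Lemma Ck1_strict_diff_rV (W : normedModType R) n (U : set 'rV[R]_n.+1)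
    (f : 'rV[R]_n.+1 -> W) x :
  mean_value_inequality W -> open U -> Ck 1 U f -> U x ->
  strict_diff f x (fun w => \sum_(k < n.+1) w 0 k *: 'D_(delta_mx 0 k) f x).
Proof.
move=> mvi Uo fU Ux.
have := @strict_diff_of_partials R _ W f x
  (fun k => delta_mx 0 (inord k)) (fun k w => w 0 (inord k)) n.+1 mvi.
have E (W' : zmodType) (F : 'I_n.+1 -> W') :
    \sum_(k < n.+1) F (inord k) = \sum_(k < n.+1) F k.
  by apply: eq_bigr => k _; rewrite inord_val.
have -> : (fun w : 'rV[R]_n.+1 => \sum_(k < n.+1) w 0 k *: 'D_(delta_mx 0 k) f x) =
  fun w : 'rV[R]_n.+1 =>
    \sum_(k < n.+1) w 0 (inord k) *: 'D_(delta_mx 0 (inord k)) f x.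
  by apply/funext => w; rewrite (E _ (fun k => w 0 k *: 'D_(delta_mx 0 k) f x)).
apply.
- by move=> w; rewrite (E _ (fun k => w 0 k *: delta_mx 0 k)) -row_sum_delta.
- by move=> k w; exact: rV_norm_coord.
- by move=> k _; exact: (Ck1_near _ Uo fU Ux).1.
- by move=> k _; exact: (Ck1_near _ Uo fU Ux).2.
Qed.

Lemma mulmxr_continuous m n (N : 'M[R]_(m, n)) :
  continuous (mulmxr N : 'rV[R]_m -> 'rV[R]_n).
Proof.
have [C C0 CP] := mulmx_bounded N.
move=> x; apply/(@cvgrPdist_le _ _ _ (nbhs x) _ _ _) => e e0.
have : \forall y \near x, `|y - x| < C^-1 * e.
  by apply: near_dist_lt; rewrite mulr_gt0// invr_gt0.
apply: filterS => y yx.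
by rewrite /= -mulmxBl (le_trans (CP _))// -ler_pdivlMl// distrC ltW.
Qed.

Lemma strict_diff_differential m n (f : 'rV[R]_m -> 'rV[R]_n) x (N : 'M[R]_(m, n)) :
  strict_diff f x (mulmxr N) -> differentiable f x /\ jacobian f x = N.
Proof.
move=> fN.
have fo : f \o shift x = cst (f x) + mulmxr N +o_ 0 id.
  apply/eqaddoP => e e0; have [d d0 dP] := fN e e0.
  apply: filterS (near_dist_lt 0 d0) => h hd.
  have := dP x (h + x); rewrite addrK subrr normr0 /=.
  rewrite !fctE/= opprD addrA; apply => //.
  by rewrite -[h]subr0.
have dfE := diff_unique (@mulmxr_continuous _ _ N) fo.
split.
  by apply/diff_locallyP; rewrite dfE; split => //; exact: mulmxr_continuous.
apply/row_matrixP => k; rewrite !rowE /jacobian mul_rV_lin1.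
by rewrite -[RHS]/(mulmxr N (delta_mx 0 k)) -dfE.
Qed.

Lemma Ck1_jacobian m n (U : set 'rV[R]_m.+1) (f : 'rV[R]_m.+1 -> 'rV[R]_n) x :
  open U -> Ck 1 U f -> U x ->
  strict_diff f x (mulmxr (jacobian f x)) /\
  forall v, 'D_v f x = v *m jacobian f x.
Proof.
move=> Uo fU Ux.
have := Ck1_strict_diff_rV (@mean_value_inequality_rV R n) Uo fU Ux.
set L := fun w => _ => fL.
pose N := \matrix_(k < m.+1) 'D_(delta_mx 0 k) f x.
have LN : L = mulmxr N.
  apply/funext => w; rewrite /L /= mulmx_sum_row; apply: eq_bigr => k _.
  by rewrite rowK.
rewrite LN in fL; have [df JN] := strict_diff_differential fL.
by rewrite JN; split => // v; rewrite deriveEjacobian// JN.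
Qed.

End ContinuouslyDifferentiable.

Section Increments.
Variables (R : realType) (W : normedModType R).

Lemma is_derive_incrementP (h : R -> W) (t : R) l :
  is_derive t 1 h l <-> forall e : R, 0 < e -> exists2 d : R, 0 < d &
    forall u, `|u| < d -> `|h (u + t) - h t - u *: l| <= e * `|u|.
Proof.
pose q u := u^-1 *: ((h \o shift t) (u *: 1) - h t).
have qE u : u != 0 -> `|l - q u| * `|u| = `|h (u + t) - h t - u *: l|.
  move=> u0; rewrite distrC mulrC -normrZ scalerBr scalerA mulfV// scale1r.
  by rewrite /= [u *: 1]mulr1.
have -> : is_derive t 1 h l <-> q u @[u --> 0^'] --> l.
  split=> [[dh <-]//|ql]; apply: DeriveDef; last exact: cvg_lim ql.
  by apply/cvg_ex; exists l.
rewrite cvgrPdist_le; split=> hl e e0.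
  have /nbhs_ballP[d /= d0 dP] := hl e e0.
  exists d => // u ud; have [->|u0] := eqVneq u 0.
    by rewrite add0r subrr scale0r subr0 !normr0 mulr0.
  rewrite -qE// ler_wpM2r//; apply: dP => //.
  by rewrite -ball_normE /= sub0r normrN.
have [d d0 dP] := hl e e0; apply/nbhs_ballP; exists d => //= u.
rewrite -ball_normE /= sub0r normrN => ud u0.
by rewrite -(@ler_pM2r _ `|u|) ?normr_gt0// qE// dP.
Qed.

End Increments.

Lemma is_derive_strict_comp (R : realType) (V W : normedModType R) (f : V -> W) (h : R -> V)
    t h' (L : V -> W) C :
  (forall v w, L (v - w) = L v - L w) -> (forall k v, L (k *: v) = k *: L v) ->
  0 < C -> (forall v, `|L v| <= C * `|v|) ->
  strict_diff f (h t) L -> is_derive t 1 h h' -> is_derive t 1 (f \o h) (L h').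
Proof.
move=> LB LZ C0 LC fL /is_derive_incrementP dh; apply/is_derive_incrementP => e e0.
pose K := 1 + `|h'|; have K0 : 0 < K by rewrite ltr_pwDl.
have [|d d0 dP] := fL (e / 2 / K); first by rewrite !divr_gt0.
have [|r1 r10 r1P] := dh 1; first by [].
have [|r2 r20 r2P] := dh (e / 2 / C); first by rewrite !divr_gt0.
exists (Num.min (d / K) (Num.min r1 r2)); first by rewrite !lt_min divr_gt0// r10.
move=> u; rewrite !lt_min => /and3P[ud ur1 ur2] /=.
have hK : `|h (u + t) - h t| <= K * `|u|.
  rewrite -[h (u + t) - _](subrK (u *: h')) (le_trans (ler_normD _ _))//.
  by rewrite mulrDl lerD ?r1P// normrZ mulrC.
have := dP (h t) (h (u + t)); rewrite subrr normr0 => /(_ d0 _) dPt.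
rewrite -[f _ - f _](subrK (L (h (u + t) - h t))) -addrA -LZ -LB.
rewrite (le_trans (ler_normD _ _))// [e]splitr mulrDl lerD//.
  apply: (le_trans (dPt _)).
    by rewrite (le_lt_trans hK)// mulrC -ltr_pdivlMr.
  by rewrite -mulrA ler_wpM2l ?divr_ge0 ?(ltW e0)// ler_pdivrMl.
rewrite (le_trans (LC _))// mulrC -ler_pdivlMr// mulrAC r2P//.
Qed.

Lemma is_derive_scale (R : realType) (W : normedModType R) (v : W) (q : R) :
  is_derive q 1 (fun t : R => t *: v) v.
Proof.
apply/is_derive_incrementP => e e0; exists 1 => // u _.
by rewrite -scalerBl addrK subrr normr0 mulr_ge0// ltW.
Qed.

(** * Short time estimates *)

Section ShortTime.
Variables (R : realType) (n : nat).

(** Gronwall's inequality over a time short enough for the exponential to be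
    at most 2: the norm at its maximum is at most its initial value plus half
    of itself. *)
Lemma short_gronwall (y y' : R -> 'rV[R]_n) (t t' L : R) :
  0 <= L -> L * `|t' - t| <= 1 / 2 ->
  (forall s, Num.min t t' <= s <= Num.max t t' -> is_derive s 1 y (y' s)) ->
  (forall s, Num.min t t' <= s <= Num.max t t' -> `|y' s| <= L * `|y s|) ->
  forall s, Num.min t t' <= s <= Num.max t t' -> `|y s| <= 2 * `|y t|.
Proof.
move=> L0 Lt dy yL.
have mM : Num.min t t' <= Num.max t t' by rewrite ge_min !le_max lexx.
have cy : {within `[Num.min t t', Num.max t t'], continuous (fun s => `|y s|)}.
  have := @derivable_within_continuous R 'rV[R]_n y `[Num.min t t', Num.max t t'].
  move=> cy s; apply: cvg_norm; apply: cy => r.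
  by rewrite in_itv/= => /dy[].
have [c + cmax] := EVT_max mM cy; rewrite in_itv/= => cM s sM.
apply: le_trans (cmax s _) _; first by rewrite in_itv.
have := @mean_value_inequality_rV R n y y' t c (L * `|y c|).
move=> /(_ _ _ _)H.
have : `|y c - y t| <= L * `|y c| * `|c - t|.
  apply: H; first by rewrite mulr_ge0.
  - by move=> r /(between_sub cM); exact: dy.
  - move=> r /(between_sub cM) rM; rewrite (le_trans (yL _ rM))// ler_wpM2l//.
    by apply: cmax; rewrite in_itv.
rewrite mulrAC => h.
have : L * `|c - t| * `|y c| <= 1 / 2 * `|y c|.
  rewrite ler_wpM2r// (le_trans _ Lt)// ler_wpM2l//; exact: between_dist.
have := ler_normD (y c - y t) (y t); rewrite subrK; lra.
Qed.

Lemma short_gronwall_drift (y y' : R -> 'rV[R]_n) (t t' L : R) :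
  0 <= L -> L * `|t' - t| <= 1 / 2 ->
  (forall s, Num.min t t' <= s <= Num.max t t' -> is_derive s 1 y (y' s)) ->
  (forall s, Num.min t t' <= s <= Num.max t t' -> `|y' s| <= L * `|y s|) ->
  `|y t' - y t| <= 2 * L * `|t' - t| * `|y t|.
Proof.
move=> L0 Lt dy yL; have h := short_gronwall L0 Lt dy yL.
rewrite mulrAC -[2 * L]mulrC -[L * 2 * _]mulrA.
apply: (mean_value_inequality_rV (h' := y')) => //; first by rewrite !mulr_ge0.
by move=> s sM; rewrite (le_trans (yL s sM))// ler_wpM2l// h.
Qed.

End ShortTime.

(** On a compact set the linear approximation of a continuously differentiable
    map is uniform. *)
Lemma Ck1_uniform (R : realType) m n (U K : set 'rV[R]_m.+1)
    (f : 'rV[R]_m.+1 -> 'rV[R]_n) : open U -> Ck 1 U f -> compact K -> K `<=` U ->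
  forall e : R, 0 < e -> exists2 d : R, 0 < d & forall x y, K x -> `|y - x| < d ->
    `|f y - f x - (y - x) *m jacobian f x| <= e * `|y - x|.
Proof.
move=> Uo fU /compact_near_coveringP cK KU e e0.
have fJ x (Ux : U x) := Ck1_jacobian Uo fU Ux.
have JE x (Ux : U x) v : v *m jacobian f x =
    \sum_k v 0 k *: 'D_(delta_mx 0 k) f x.
  rewrite mulmx_sum_row; apply: eq_bigr => k _.
  by rewrite rowE (fJ x Ux).2.
pose P (d : R) x := forall y, `|y - x| < d ->
    `|f y - f x - (y - x) *m jacobian f x| <= e * `|y - x|.
have : \forall d \near 0^'+, K `<=` P d.
  apply: cK => x Kx; have Ux := KU _ Kx.
  have [|d d0 dP] := (fJ x Ux).1 (e / 2); first by rewrite divr_gt0.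
  have e3 : 0 < e / 2 / m.+1%:R by rewrite !divr_gt0.
  have : \forall x' \near x, forall k : 'I_m.+1,
      `|'D_(delta_mx 0 k) f x - 'D_(delta_mx 0 k) f x'| < e / 2 / m.+1%:R.
    apply: (@filter_forall _ 'I_m.+1 (fun k x' => `|'D_(delta_mx 0 k) f x -
      'D_(delta_mx 0 k) f x'| < e / 2 / m.+1%:R) (nbhs x) _) => k; have /= := (Ck1_near (delta_mx 0 k) Uo fU Ux).2.
    by move/cvgrPdist_lt => /(_ _ e3).
  have Un : \forall x' \near x, U x' by exact: open_nbhs_nbhs.
  move=> Jn.
  have xn : \forall x' \near x, `|x' - x| < d / 2.
    by apply: near_dist_lt; rewrite divr_gt0.
  have dn : \forall r \near 0^'+, r < d / 2.
    by apply: nbhs_right_lt; rewrite divr_gt0.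
  exists ([set x' | U x' /\ (`|x' - x| < d / 2 /\ forall k : 'I_m.+1,
      `|'D_(delta_mx 0 k) f x - 'D_(delta_mx 0 k) f x'| < e / 2 / m.+1%:R)],
      [set r | r < d / 2]).
    by split => //=; apply: filterI => //; exact: filterI.
  move=> [x' r] /= [[Ux' [x'x Jx']] rd] y yx'.
  have yx : `|y - x| < d.
    rewrite -(subrKA x') (le_lt_trans (ler_normD _ _))//; lra.
  have := dP x' y (_ : _) yx => /(_ _)/= h1.
  have {}h1 : `|f y - f x' - (y - x') *m jacobian f x| <= e / 2 * `|y - x'|.
    by apply: h1; lra.
  have h2 : `|(y - x') *m jacobian f x - (y - x') *m jacobian f x'|
      <= e / 2 * `|y - x'|.
    move: (JE x Ux (y - x')) (JE x' Ux' (y - x')).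
    move: (jacobian f x) (jacobian f x') => J J' -> ->.
    rewrite -sumrB.
    apply: (le_trans (ler_norm_sum _ _ _)).
    apply: (@le_trans _ _ (\sum_(k < m.+1) (`|y - x'| * (e / 2 / m.+1%:R)))).
      apply: ler_sum => k _; rewrite -scalerBr normrZ ler_pM ?rV_norm_coord//.
      exact: ltW.
    rewrite sumr_const card_ord -mulrnAr mulrC ler_wpM2r//.
    by rewrite -[leLHS]mulr_natr divfK.
  have -> : f y - f x' - (y - x') *m jacobian f x' =
      f y - f x' - (y - x') *m jacobian f x +
      ((y - x') *m jacobian f x - (y - x') *m jacobian f x') by rewrite subrKA.
  apply: le_trans (ler_normD _ _) _; apply: le_trans (lerD h1 h2) _.
  by rewrite -mulrDl -splitr.
move=> near0.
have /nbhs_ballP[r /= r0 rP] := near0.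
exists (r / 2) => [|x y Kx]; first by rewrite divr_gt0.
apply: (rP (r / 2)) => //; last by rewrite divr_gt0.
by rewrite -ball_normE /= sub0r normrN gtr0_norm ?divr_gt0//; lra.
Qed.

(** * The triple product *)

Section TripleProduct.
Variable R : realType.
Implicit Types a b c : 'rV[R]_3.

Local Notation x0 := (ord0 : 'I_3).
Local Notation x1 := (lift ord0 ord0 : 'I_3).
Local Notation x2 := (lift ord0 (lift ord0 ord0) : 'I_3).

(** The determinant with rows [a], [b], [c], expanded so that derivatives and
    estimates can be read off its entries. *)
Definition triple a b c : R :=
  a 0 x0 * (b 0 x1 * c 0 x2 - b 0 x2 * c 0 x1)
  - a 0 x1 * (b 0 x0 * c 0 x2 - b 0 x2 * c 0 x0)
  + a 0 x2 * (b 0 x0 * c 0 x1 - b 0 x1 * c 0 x0).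

Lemma sum3E (W : zmodType) (F : 'I_3 -> W) : \sum_k F k = F x0 + F x1 + F x2.
Proof. by rewrite !big_ord_recl big_ord0 addr0 addrA. Qed.

Lemma ord3_ind (P : 'I_3 -> Prop) : P x0 -> P x1 -> P x2 -> forall k, P k.
Proof.
move=> p0 p1 p2 [[|[|[|//]]] lt3].
- by rewrite (_ : Ordinal _ = x0)//; exact: val_inj.
- by rewrite (_ : Ordinal _ = x1)//; exact: val_inj.
- by rewrite (_ : Ordinal _ = x2)//; exact: val_inj.
Qed.

Lemma det_triple (N : 'M[R]_3) : \det N = triple (row x0 N) (row x1 N) (row x2 N).
Proof.
rewrite (expand_det_row _ x0) sum3E /cofactor.
do 3 rewrite (expand_det_row _ ord0) !big_ord_recl big_ord0 /cofactor !det_mx11.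
rewrite !mxE /triple !mxE /=.
have e01 : lift (lift ord0 ord0 : 'I_3) (ord0 : 'I_2) = x0 by exact: val_inj.
have e11 : lift (lift ord0 ord0 : 'I_3) (lift ord0 ord0 : 'I_2) = x2 by exact: val_inj.
have e02 : lift (lift ord0 (lift ord0 ord0) : 'I_3) (ord0 : 'I_2) = x0 by exact: val_inj.
have e12 : lift (lift ord0 (lift ord0 ord0) : 'I_3) (lift ord0 ord0 : 'I_2) = x1.
  exact: val_inj.
have e : lift (lift ord0 ord0 : 'I_2) (0 : 'I_1) = ord0 by exact: val_inj.
have e' : (0 : 'I_1) = ord0 by [].
rewrite ?e' ?e ?e01 ?e11 ?e02 ?e12.
rewrite /bump /= !(expr0, expr1, exprS, addn0, add0n).
ring.
Qed.

Lemma triple_mulmx (N : 'M[R]_3) a b c :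
  triple (a *m N) (b *m N) (c *m N) = \det N * triple a b c.
Proof.
rewrite det_triple /triple !mxE !sum3E; ring.
Qed.

Lemma triple_col_mx a b c :
  triple a b c = \det (col_mx (col_mx a b) c : 'M[R]_3).
Proof.
rewrite det_triple.
pose N : 'M[R]_3 := col_mx (col_mx a b) c; rewrite -/N.
have row_eq (i j : 'I_3) : val i = val j -> row i N = row j N.
  by move=> /val_inj ->.
have -> : row x0 N = a.
  rewrite (row_eq _ (lshift 1 (lshift 1 (ord0 : 'I_1))))// /N.
  by rewrite (@rowKu _ 2 1 3 _ (col_mx a b) c) (@rowKu _ 1 1 3 _ a b) row_id.
have -> : row x1 N = b.
  rewrite (row_eq _ (lshift 1 (rshift 1 (ord0 : 'I_1))))// /N.
  by rewrite (@rowKu _ 2 1 3 _ (col_mx a b) c) (@rowKd _ 1 1 3 _ a b) row_id.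
have -> : row x2 N = c.
  rewrite (row_eq _ (rshift 2 (ord0 : 'I_1)))// /N.
  by rewrite (@rowKd _ 2 1 3 _ (col_mx a b) c) row_id.
by [].
Qed.

Lemma triple_row_free a b c :
  row_free (col_mx (col_mx a b) c) = (triple a b c != 0).
Proof.
rewrite triple_col_mx -unitfE -unitmxE; exact: (@row_free_unit _ 3).
Qed.

Lemma tripleBl a a' b c : triple (a - a') b c = triple a b c - triple a' b c.
Proof. by rewrite /triple !mxE; ring. Qed.

Lemma tripleBm a b b' c : triple a (b - b') c = triple a b c - triple a b' c.
Proof. by rewrite /triple !mxE; ring. Qed.

Lemma triple_le a b c : `|triple a b c| <= 6 * (`|a| * `|b| * `|c|).
Proof.
have h i j k : `|a 0 i * (b 0 j * c 0 k)| <= `|a| * `|b| * `|c|.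
  rewrite !normrM mulrA.
  by rewrite ler_pM ?mulr_ge0 ?rV_norm_coord// ler_pM ?rV_norm_coord.
have sum6 (p q r s t u K : R) : `|p| <= K -> `|q| <= K -> `|r| <= K ->
    `|s| <= K -> `|t| <= K -> `|u| <= K ->
    `|p - q - (r - s) + (t - u)| <= 6 * K.
  by rewrite !ler_norml => /andP[??] /andP[??] /andP[??] /andP[??] /andP[??]
    /andP[??]; apply/andP; split; lra.
by rewrite /triple !mulrBr; apply: sum6.
Qed.

(** The trace is the infinitesimal determinant. *)
Lemma triple_trace (N : 'M[R]_3) a b c :
  triple (a *m N) b c + triple a (b *m N) c + triple a b (c *m N)
  = \tr N * triple a b c.
Proof. by rewrite /mxtrace /triple !mxE !sum3E; ring. Qed.

Lemma is_derive_triple (V : normedModType R) (a b c : V -> 'rV[R]_3) a' b' c' x v :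
  is_derive x v a a' -> is_derive x v b b' -> is_derive x v c c' ->
  is_derive x v (fun y => triple (a y) (b y) (c y) : R^o)
    (triple a' (b x) (c x) + triple (a x) b' (c x) + triple (a x) (b x) c').
Proof.
move=> da db dc.
pose f (u : V -> 'rV[R]_3) k : V -> R := fun y => u y 0 k.
have da_ k : is_derive x v (f a k) (a' 0 k) := is_derive_coord 0 k da.
have db_ k : is_derive x v (f b k) (b' 0 k) := is_derive_coord 0 k db.
have dc_ k : is_derive x v (f c k) (c' 0 k) := is_derive_coord 0 k dc.
have -> : (fun y => triple (a y) (b y) (c y)) =
  f a x0 * (f b x1 * f c x2 - f b x2 * f c x1)
  - f a x1 * (f b x0 * f c x2 - f b x2 * f c x0)
  + f a x2 * (f b x0 * f c x1 - f b x1 * f c x0) by exact/funext.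
apply: is_derive_eq; rewrite !fctE /f /triple /GRing.scale/=.
ring.
Qed.

Lemma tripleZZ (u : R) a b c :
  triple (u *: a) (u *: b) c = u ^+ 2 * triple a b c.
Proof. by rewrite /triple !mxE; ring. Qed.

End TripleProduct.

(** * Asymptotics of parallelograms *)

Section Asymptotics.
Variable R : realType.
Implicit Types (V : normedModType R).

Definition linearly_bounded V (a : R -> V) :=
  exists K, \forall u \near (0 : R), `|a u| <= K * `|u|.

Definition sublinear V (a : R -> V) :=
  forall e : R, 0 < e -> \forall u \near (0 : R), `|a u| <= e * `|u|.

(** Both sides of the parallelograms below are proportional to the parameter,
    whence the square. *)
Definition area_rate (w : R -> R) (k : R) :=
  forall e : R, 0 < e -> \forall u \near (0 : R), `| `|w u| - k * u ^+ 2 | <= e * u ^+ 2.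

Lemma area_rate_unique w k k' : area_rate w k -> area_rate w k' -> k = k'.
Proof.
move=> wk wk'; apply/eqP; rewrite -subr_eq0 -normr_le0.
apply/ler_addgt0Pl => e e0.
have e20 : 0 < e / 2 by rewrite divr_gt0.
have : \forall u \near (0 : R), `| `|w u| - k * u ^+ 2 | <= e / 2 * u ^+ 2
    /\ `| `|w u| - k' * u ^+ 2 | <= e / 2 * u ^+ 2.
  by near=> u; split; near: u; [exact: wk|exact: wk'].
move=> /nbhs_ballP[d /= d0 dP].
have [|h h'] := dP (d / 2).
  by rewrite -ball_normE /= sub0r normrN gtr0_norm ?divr_gt0//; lra.
have d2 : 0 < (d / 2) ^+ 2 by rewrite exprn_gt0// divr_gt0.
rewrite addr0 -(ler_pM2r d2) -[X in _ * X <= _](gtr0_norm d2) -normrM mulrBl.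
move: h h'; rewrite !ler_norml => /andP[? ?] /andP[? ?].
by apply/andP; split; lra.
Unshelve. all: by end_near. Qed.

Lemma norm_close (a b c e e' : R) :
  `| `|b| - c| <= e -> `|a - b| <= e' -> `| `|a| - c| <= e + e'.
Proof.
move=> bc ab; rewrite -(subrKA `|b|) addrC (le_trans (ler_normD _ _))//.
by rewrite lerD// (le_trans (ler_dist_dist _ _)).
Qed.

Lemma sublinear_bounded V (a b : R -> V) :
  linearly_bounded b -> sublinear (fun u => a u - b u) -> linearly_bounded a.
Proof.
move=> [K bK] ab; exists (1 + K).
have := ab 1 ltr01; move: bK; apply: filterS2 => u bu abu.
by rewrite -[a u](subrK (b u)) mulrDl (le_trans (ler_normD _ _))// lerD.
Qed.

(** The triple product is linear in each row, so the rows may be replaced one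
    after the other. *)
Lemma area_rate_perturb (a b a' b' : R -> 'rV[R]_3) c r k :
  linearly_bounded a' -> linearly_bounded b' ->
  sublinear (fun u => a u - a' u) -> sublinear (fun u => b u - b' u) ->
  area_rate (fun u => r * triple (a' u) (b' u) c) k ->
  area_rate (fun u => r * triple (a u) (b u) c) k.
Proof.
move=> a'b b'b aa' bb' rate e e0.
have [K bK] := sublinear_bounded b'b bb'; have [K' a'K] := a'b.
pose N := 1 + `|r| * (6 * ((`|K| + `|K'|) * `|c|)).
have N0 : 0 < N by rewrite ltr_pwDl// !mulr_ge0// addr_ge0.
have e2 : 0 < e / 2 by rewrite divr_gt0.
have eN : 0 < e / 2 / N by rewrite divr_gt0.
near=> u.
have h1 : `| `|r * triple (a' u) (b' u) c| - k * u ^+ 2 | <= e / 2 * u ^+ 2.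
  by near: u; exact: rate.
have h2 : `|a u - a' u| <= e / 2 / N * `|u| by near: u; exact: aa'.
have h3 : `|b u - b' u| <= e / 2 / N * `|u| by near: u; exact: bb'.
have h4 : `|b u| <= `|K| * `|u|.
  have : `|b u| <= K * `|u| by near: u.
  by move=> /le_trans; apply; rewrite ler_wpM2r// ler_norm.
have h5 : `|a' u| <= `|K'| * `|u|.
  have : `|a' u| <= K' * `|u| by near: u.
  by move=> /le_trans; apply; rewrite ler_wpM2r// ler_norm.
have h6 : `|r * triple (a u) (b u) c - r * triple (a' u) (b' u) c| <= e / 2 * u ^+ 2.
  have -> : r * triple (a u) (b u) c - r * triple (a' u) (b' u) c =
      r * (triple (a u - a' u) (b u) c + triple (a' u) (b u - b' u) c).
    by rewrite tripleBl tripleBm; ring.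
  rewrite normrM.
  have t1 := triple_le (a u - a' u) (b u) c.
  have t2 := triple_le (a' u) (b u - b' u) c.
  have s1 : `|a u - a' u| * `|b u| <= e / 2 / N * `|u| * (`|K| * `|u|).
    by rewrite ler_pM.
  have s2 : `|a' u| * `|b u - b' u| <= `|K'| * `|u| * (e / 2 / N * `|u|).
    by rewrite ler_pM.
  have s : `|triple (a u - a' u) (b u) c + triple (a' u) (b u - b' u) c| <=
      6 * ((e / 2 / N * u ^+ 2) * (`|K| + `|K'|) * `|c|).
    rewrite (le_trans (ler_normD _ _))// (le_trans (lerD t1 t2))//.
    rewrite -mulrDr ler_wpM2l// -mulrDl ler_wpM2r//.
    rewrite (le_trans (lerD s1 s2))// -(real_normK (num_real u)); lra.
  rewrite (le_trans (ler_wpM2l _ s))//.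
  have -> : e / 2 * u ^+ 2 = (e / 2 / N * u ^+ 2) * N.
    by field; rewrite gt_eqF.
  set z := e / 2 / N * u ^+ 2.
  have : 0 <= z by rewrite mulr_ge0 ?sqr_ge0// ltW.
  pose w := `|r| * (6 * ((`|K| + `|K'|) * `|c|)).
  have -> : N = 1 + w by [].
  have -> : `|r| * (6 * (z * (`|K| + `|K'|) * `|c|)) = z * w by rewrite /w; ring.
  lra.
by rewrite [e]splitr mulrDl; exact: norm_close h1 h6.
Unshelve. all: by end_near. Qed.

End Asymptotics.

(** * Charts *)

Section Charts.
Variables (R : realType) (M : topologicalType).
Implicit Types c : chart R M.

Lemma near_cdom c p : cdom c p -> \forall q \near p, cdom c q.
Proof. by move=> cp; apply: open_nbhs_nbhs; split=> //; exact: cdom_open. Qed.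

Lemma near_cimg c x : cimg c x -> \forall y \near x, cimg c y.
Proof. by move=> cx; apply: open_nbhs_nbhs; split=> //; exact: cimg_open. Qed.

Lemma chart_continuous c p : cdom c p -> {for p, continuous (cmap c)}.
Proof.
move=> cp; have := @cmap_continuous _ _ c; rewrite continuous_open_subspace.
  by apply; rewrite inE.
exact: cdom_open.
Qed.

Lemma chart_inv_continuous c x : cimg c x -> {for x, continuous (cinv c)}.
Proof.
move=> cx; have := @cinv_continuous _ _ c; rewrite continuous_open_subspace.
  by apply; rewrite inE.
exact: cimg_open.
Qed.

Lemma chart_inj c p q : cdom c p -> cdom c q -> cmap c p = cmap c q -> p = q.
Proof. by move=> cp cq pq; rewrite -(cmapK cp) -(cmapK cq) pq. Qed.

Lemma overlap_open c c' : open (overlap c c').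
Proof.
rewrite openE => _ [p [cp c'p] <-].
have cx : cimg c (cmap c p) by exists p.
have ic := chart_inv_continuous cx.
have : \forall y \near cmap c p, cdom c' (cinv c y).
  apply: ic; rewrite cmapK//.
  exact: near_cdom.
have : \forall y \near cmap c p, cimg c y.
  exact: near_cimg.
by apply: filterS2 => _ [q cq <-]; rewrite cmapK// => c'q; exists q.
Qed.

Lemma transitionE c c' p : cdom c p -> transition c c' (cmap c p) = cmap c' p.
Proof. by move=> cp; rewrite /transition /= cmapK. Qed.

End Charts.

(** * Transport of an area element by a volume preserving flow *)

Section Transport.
Variables (R : realType) (M : manifold3 R) (m : volume M) (X : vfield M).
Hypothesis conservativeX : conservative_C1 m X.
Variable Phi : R -> M -> M.
Hypothesis flowPhi : is_flow X Phi.

Local Notation cm i := (cmap (mchart i) : M -> 'rV[R]_3).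
Local Notation X_ i := (vrep X i).
Local Notation rho i := (vdens m i).

Lemma vfield_C1 i : Ck 1 (cimg (mchart i)) (X_ i).
Proof. exact: conservativeX.1. Qed.

Lemma vfield_near i x : cimg (mchart i) x ->
  strict_diff (X_ i) x (mulmxr (jacobian (X_ i) x)) /\
  forall v, 'D_v (X_ i) x = v *m jacobian (X_ i) x.
Proof. by move=> ix; apply: Ck1_jacobian (vfield_C1 i) ix; exact: cimg_open. Qed.

Lemma density_C1 i : Ck 1 (cimg (mchart i)) (rho i : _ -> R^o).
Proof. exact: vdens_smooth. Qed.

(** Expanding the divergence by the product rule gives the form needed in
    Liouville's formula. *)
Lemma divergence_free i x : cimg (mchart i) x ->
  rho i x * \tr (jacobian (X_ i) x) +
  \sum_(k < 3) X_ i x 0 k * 'D_(delta_mx 0 k : 'rV[R]_3) (rho i : _ -> R^o) x = 0.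
Proof.
move=> ix; have := conservativeX.2 i x ix; rewrite /divergence.
move/eqP; rewrite mulf_eq0 invr_eq0 gt_eqF ?vdens_gt0//= => /eqP div0; rewrite -[RHS]div0.
have Uo := @cimg_open _ _ (mchart i).
have dX k : is_derive x (delta_mx 0 k : 'rV[R]_3) (fun y => X_ i y 0 k : R^o)
    (jacobian (X_ i) x k k).
  have dX : derivable (X_ i) x (delta_mx 0 k).
    exact: (nbhs_singleton (Ck1_near _ Uo (vfield_C1 i) ix).1).
  apply: is_derive_eq; first exact: (is_derive_coord 0 k (derivableP dX)).
  by rewrite (vfield_near ix).2 -rowE mxE.
rewrite /mxtrace mulr_sumr -big_split/=; apply: eq_bigr => k _.
have dr : derivable (rho i : _ -> R^o) x (delta_mx 0 k).
  exact: (nbhs_singleton (Ck1_near _ Uo (density_C1 i) ix).1).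
have -> : (fun y => rho i y * X_ i y 0 k : R^o) =
  (rho i : _ -> R) * (fun y => X_ i y 0 k) by exact/funext.
have [dX1 dX2] := dX k.
by rewrite deriveM// dX2.
Qed.

Lemma flow0 p : Phi 0 p = p. Proof. by case: flowPhi. Qed.

Lemma flowD s t p : Phi (s + t) p = Phi s (Phi t p).
Proof. by case: flowPhi. Qed.

Lemma flowK t : cancel (Phi t) (Phi (- t)).
Proof. by move=> p; rewrite -flowD addNr flow0. Qed.

Lemma flow_continuous t p : {for (t, p), continuous (fun tp : R * M => Phi tp.1 tp.2)}.
Proof. by case: flowPhi => _ _ cPhi _; exact: cPhi. Qed.

Lemma flow_is_derive i t p : cdom (mchart i) (Phi t p) ->
  is_derive t 1 (fun s : R => cm i (Phi s p)) (X_ i (cm i (Phi t p))).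
Proof. by case: flowPhi => _ _ _; exact. Qed.

Lemma flow_family_cvg (T : topologicalType) (c : T -> M) t z :
  {for z, continuous c} ->
  (fun su : R * T => Phi su.1 (c su.2)) @ filter_prod (nbhs t) (nbhs z)
    --> Phi t (c z).
Proof.
move=> cc.
move=> P /(@flow_continuous t (c z)) [[A B] /= [tA cB] AB].
exists (A, c @^-1` B); first by split => //=; exact: cc.
by move=> [s u] /= [As Bu]; exact: (AB (s, c u)).
Qed.

Lemma flow_family_near (T : topologicalType) (c : T -> M) t z i d :
  {for z, continuous c} -> cdom (mchart i) (Phi t (c z)) -> 0 < d ->
  \forall s \near t & u \near z, cdom (mchart i) (Phi s (c u)) /\
    `|cm i (Phi s (c u)) - cm i (Phi t (c z))| < d.
Proof.
move=> cc ip d0.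
have : \forall q \near Phi t (c z), cdom (mchart i) q /\
    `|cm i q - cm i (Phi t (c z))| < d.
  have yd : \forall y \near cm i (Phi t (c z)), `|y - cm i (Phi t (c z))| < d.
    exact: near_dist_lt.
  have /= := chart_continuous ip yd.
  by apply: filterS2 (near_cdom ip).
by move=> /(flow_family_cvg cc).
Qed.

End Transport.

Section ChartChange.
Variables (R : realType) (M : manifold3 R) (m : volume M) (X : vfield M).
Variable Phi : R -> M -> M.
Hypothesis flowPhi : is_flow X Phi.
Variables c1 c2 : R -> M.
Hypotheses (c1_continuous : {for 0, continuous c1})
           (c2_continuous : {for 0, continuous c2}) (c12 : c2 0 = c1 0).

Local Notation cm i := (cmap (mchart i) : M -> 'rV[R]_3).
Local Notation X_ i := (vrep X i).
Local Notation rho i := (vdens m i).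

Definition separation i t (c : R -> M) u : 'rV[R]_3 :=
  cm i (Phi t (c u)) - cm i (Phi t (c 0)).

(** The volume swept by the flow through a small parallelogram between orbits,
    to leading order. The difference quotients of the flow are bounded, but need not
    converge as the parameter tends to [0]. *)
Definition transported i t k :=
  [/\ linearly_bounded (separation i t c1),
      linearly_bounded (separation i t c2) &
      area_rate (fun u => rho i (cm i (Phi t (c1 0))) *
        triple (separation i t c1 u) (separation i t c2 u)
               (X_ i (cm i (Phi t (c1 0))))) k].

Lemma transition_near i j p :
  cdom (mchart i) p -> cdom (mchart j) p ->
  let h := transition (mchart i) (mchart j) in
  [/\ overlap (mchart i) (mchart j) (cm i p),
      strict_diff h (cm i p) (mulmxr (jacobian h (cm i p))) &
      forall v, 'D_v h (cm i p) = v *m jacobian h (cm i p)].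
Proof.
move=> ip jp h.
have o : overlap (mchart i) (mchart j) (cm i p) by exists p.
have [hD hE] := Ck1_jacobian (@overlap_open _ _ _ _) (@msmooth _ M i j 1%N) o.
by split.
Qed.

Lemma separation_transition i j t (c : R -> M) :
  {for 0, continuous c} ->
  cdom (mchart i) (Phi t (c 0)) -> cdom (mchart j) (Phi t (c 0)) ->
  linearly_bounded (separation i t c) ->
  sublinear (fun u : R => separation j t c u - separation i t c u *m
    jacobian (transition (mchart i) (mchart j)) (cm i (Phi t (c 0)))).
Proof.
move=> cc ip jp [K sK] e e0.
have [_ hD _] := transition_near ip jp.
have K0 : 0 < 1 + `|K| by rewrite ltr_pwDl.
have [|d d0 dP] := hD (e / (1 + `|K|)); first by rewrite divr_gt0.
have [/= U [U1 U2] UP] := flow_family_near flowPhi cc ip d0.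
have [/= U' [U'1 U'2] U'P] := flow_family_near flowPhi cc jp d0.
near=> u.
have [iu du] : cdom (mchart i) (Phi t (c u)) /\
    `|cm i (Phi t (c u)) - cm i (Phi t (c 0))| < d.
  by apply: (UP (t, u)); split=> /=; [exact: nbhs_singleton|near: u].
have [ju _] : cdom (mchart j) (Phi t (c u)) /\
    `|cm j (Phi t (c u)) - cm j (Phi t (c 0))| < d.
  by apply: (U'P (t, u)); split=> /=; [exact: nbhs_singleton|near: u].
have := dP (cm i (Phi t (c 0))) (cm i (Phi t (c u))).
rewrite subrr normr0 => /(_ d0 du); rewrite !transitionE//= => /le_trans; apply.
have su : `|separation i t c u| <= K * `|u| by near: u.
rewrite -mulrA ler_wpM2l ?(ltW e0)// ler_pdivrMl// (le_trans su)//.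
by rewrite ler_wpM2r// (le_trans (ler_norm _))// lerDr.
Unshelve. all: by end_near. Qed.

Lemma linearly_bounded_mulmx (a : R -> 'rV[R]_3) (N : 'M[R]_3) :
  linearly_bounded a -> linearly_bounded (fun u : R => a u *m N).
Proof.
move=> [K aK]; have [C C0 CP] := mulmx_bounded N.
exists (C * K); move: aK; apply: filterS => u au.
by rewrite (le_trans (CP _))// -mulrA ler_wpM2l// ltW.
Qed.

Lemma area_rate_ext (w w' : R -> R) k :
  (forall u, `|w u| = `|w' u|) -> area_rate w k -> area_rate w' k.
Proof. by move=> ww' wk e /wk; apply: filterS => u; rewrite ww'. Qed.

(** The Jacobian of the transition multiplies the triple product by its
    determinant, which the change of density cancels. *)
Lemma transported_chart i j t k : cdom (mchart i) (Phi t (c1 0)) ->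
  cdom (mchart j) (Phi t (c1 0)) -> transported i t k -> transported j t k.
Proof.
move=> ip jp [b1 b2 rate].
have [ov _ hE] := transition_near ip jp.
have n1 := separation_transition c1_continuous ip jp b1.
have := @separation_transition i j t c2 c2_continuous.
rewrite !c12 => /(_ ip jp b2) n2.
move: n1 n2 hE; set N := jacobian _ _ => n1 n2 hE.
have B1 := linearly_bounded_mulmx N b1.
have B2 := linearly_bounded_mulmx N b2.
split; [exact: sublinear_bounded n1|exact: sublinear_bounded n2|].
apply: area_rate_perturb n1 n2 _ => //.
move: rate; apply: area_rate_ext => u.
have := vrep_compat X ov; rewrite transitionE// hE => ->.
have := vdens_compat m ov; rewrite transitionE// => ->.
by rewrite triple_mulmx !normrM normr_id; ring.
Qed.

End ChartChange.

Section SeparationGrowth.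
Variables (R : realType) (M : manifold3 R) (m : volume M) (X : vfield M).
Hypothesis conservativeX : conservative_C1 m X.
Variable Phi : R -> M -> M.
Hypothesis flowPhi : is_flow X Phi.

Local Notation cm i := (cmap (mchart i) : M -> 'rV[R]_3).
Local Notation X_ i := (vrep X i).
Local Notation rho i := (vdens m i).

Lemma field_bounds i x : cimg (mchart i) x ->
  exists d L B : R, [/\ 0 < d, 0 < L, 0 < B &
    forall y y', `|y - x| < d -> `|y' - x| < d ->
    [/\ cimg (mchart i) y, `|X_ i y' - X_ i y| <= L * `|y' - y|,
        `|rho i y| <= B & `|X_ i y| <= B]].
Proof.
move=> ix; have [XJ _] := vfield_near conservativeX ix.
have [C C0 CP] := mulmx_bounded (jacobian (X_ i) x).
have [d d0 dL] := strict_diff_lipschitz CP XJ.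
have rho_near : \forall y \near x, `|rho i x - rho i y| < 1.
  have [+ _] := density_C1 m i; move=> /(_ x ix) /cvgrPdist_lt; exact.
have X_near : \forall y \near x, `|X_ i x - X_ i y| < 1.
  have [+ _] := vfield_C1 conservativeX i; move=> /(_ x ix) /cvgrPdist_lt; exact.
have : \forall y \near x, cimg (mchart i) y /\
    (`|rho i x - rho i y| < 1 /\ `|X_ i x - X_ i y| < 1).
  by apply: filterI; [exact: near_cimg|exact: filterI].
move=> /nbhs_ballP[r /= r0 rP].
exists (Num.min d r), (C + 1), (1 + `|rho i x| + `|X_ i x|).
split.
- by rewrite lt_min d0.
- exact: addr_gt0.
- by rewrite -addrA ltr_pwDl// addr_ge0.
move=> y y'; rewrite !lt_min => /andP[yd yr] /andP[y'd _].
have [|iy [ry Xy]] := rP y; first by rewrite -ball_normE /= distrC.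
split=> //; first exact: dL.
- have := ler_normB (rho i x) (rho i x - rho i y); rewrite subKr => /le_trans.
  apply; apply: (@le_trans _ _ (`|rho i x| + 1)); first by rewrite lerD2l ltW.
  by rewrite [_ + 1]addrC lerDl.
- have := ler_normB (X_ i x) (X_ i x - X_ i y); rewrite subKr => /le_trans.
  apply; apply: (@le_trans _ _ (`|X_ i x| + 1)); first by rewrite lerD2l ltW.
  by rewrite [_ + 1]addrC lerD2r lerDl.
Qed.

Lemma separation_is_derive i s c u :
  cdom (mchart i) (Phi s (c 0)) -> cdom (mchart i) (Phi s (c u)) ->
  is_derive s 1 (fun s => separation Phi i s c u)
    (X_ i (cm i (Phi s (c u))) - X_ i (cm i (Phi s (c 0)))).
Proof.
move=> i0 iu.
by apply: is_deriveB; exact: flow_is_derive.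
Qed.

(** Liouville: up to the linearization error of the field, the weighted volume
    of the parallelepiped spanned by two separations and the field is
    stationary, because the divergence vanishes. *)
Lemma area_is_derive i s (y1 y2 : R -> 'rV[R]_3) (E1 E2 : 'rV[R]_3) p :
  cdom (mchart i) (Phi s p) ->
  is_derive s 1 y1 E1 -> is_derive s 1 y2 E2 ->
  let x := cm i (Phi s p) in let J := jacobian (X_ i) x in
  is_derive s 1 (fun r => rho i (cm i (Phi r p)) *
      triple (y1 r) (y2 r) (X_ i (cm i (Phi r p))) : R^o)
    (rho i x * (triple (E1 - y1 s *m J) (y2 s) (X_ i x) +
                triple (y1 s) (E2 - y2 s *m J) (X_ i x))).
Proof.
move=> ip dy1 dy2 x J.
have ix : cimg (mchart i) x by exists (Phi s p).
have dx := flow_is_derive flowPhi ip; rewrite -/x in dx.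
have [XJ _] := vfield_near conservativeX ix.
have [C C0 CP] := mulmx_bounded J.
have dX : is_derive s 1 (fun r => X_ i (cm i (Phi r p))) (X_ i x *m J).
  apply: (is_derive_strict_comp (L := mulmxr J) _ _ C0 CP XJ dx).
    by move=> v w; exact: mulmxBl.
  by move=> k v /=; rewrite scalemxAl.
pose D k := 'D_(delta_mx 0 k : 'rV[R]_3) (rho i : _ -> R^o) x.
have drho : is_derive s 1 (fun r => rho i (cm i (Phi r p)) : R^o)
    (\sum_(k < 3) X_ i x 0 k * D k).
  have rhoD := Ck1_strict_diff_rV (@mean_value_inequality_real R)
    (@cimg_open _ _ (mchart i)) (density_C1 m i) ix.
  apply: (is_derive_strict_comp (C := 1 + \sum_k `|D k|) _ _ _ _ rhoD dx).
  - move=> v w; rewrite -sumrB; apply: eq_bigr => k _.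
    by rewrite !mxE scalerBl.
  - by move=> k v; rewrite scaler_sumr; apply: eq_bigr => j _; rewrite mxE scalerA.
  - by rewrite ltr_pwDl// sumr_ge0.
  - move=> v; rewrite mulrDl mul1r ler_wpDl//.
    rewrite (le_trans (ler_norm_sum _ _ _))// mulr_suml ler_sum// => k _.
    by rewrite normrZ mulrC ler_wpM2l// rV_norm_coord.
have dT := is_derive_triple dy1 dy2 dX.
have div0 := divergence_free conservativeX ix.
rewrite -/J in div0.
have tr := triple_trace J (y1 s) (y2 s) (X_ i x).
pose A (r : R) : R := rho i (cm i (Phi r p)).
pose T (r : R) : R := triple (y1 r) (y2 r) (X_ i (cm i (Phi r p))).
have dA : is_derive s 1 A _ := drho.
have {}dT : is_derive s 1 T _ := dT.
have dAT := is_deriveM dA dT.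
apply: (@is_derive_eq _ _ _ (A * T) _ _ _ _ dAT).
rewrite /A /T /GRing.scale/= -/x !tripleBl !tripleBm.
move: tr div0; set T0 := triple (y1 s) (y2 s) (X_ i x).
set S := \sum_(k < 3) _; set t1 := triple (y1 s *m J) _ _.
set t2 := triple (y1 s) (y2 s *m J) _; set t3 := triple (y1 s) _ (_ *m J).
set e1 := triple E1 _ _; set e2 := triple _ E2 _.
move=> tr div0.
have -> : t3 = \tr J * T0 - t1 - t2 by rewrite -tr; ring.
transitivity (rho i x * (e1 - t1 + (e2 - t2)) + (rho i x * \tr J + S) * T0).
  ring.
by rewrite div0 mul0r addr0.
Qed.

End SeparationGrowth.

Section TimeWindow.
Variables (R : realType) (M : manifold3 R) (m : volume M) (X : vfield M).
Hypothesis conservativeX : conservative_C1 m X.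
Variable Phi : R -> M -> M.
Hypothesis flowPhi : is_flow X Phi.

Local Notation cm i := (cmap (mchart i) : M -> 'rV[R]_3).
Local Notation X_ i := (vrep X i).
Local Notation rho i := (vdens m i).

(** In a short time window every separation stays comparable to its value at
    any instant of the window. *)
Lemma separation_window i t0 (c : R -> M) : {for 0, continuous c} ->
  cdom (mchart i) (Phi t0 (c 0)) ->
  exists2 d : R, 0 < d &
    [/\ forall s u, `|s - t0| < d -> `|u| < d -> cdom (mchart i) (Phi s (c u)),
        exists B, 0 < B /\ forall s, `|s - t0| < d ->
          `|rho i (cm i (Phi s (c 0)))| <= B /\ `|X_ i (cm i (Phi s (c 0)))| <= B &
        forall t t' s u, `|t - t0| < d -> `|t' - t0| < d -> `|u| < d ->
          Num.min t t' <= s <= Num.max t t' ->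
          `|separation Phi i s c u| <= 2 * `|separation Phi i t c u|].
Proof.
move=> cc ip; set p := c 0 in ip *.
have ix : cimg (mchart i) (cm i (Phi t0 p)) by exists (Phi t0 p).
have [d [L [B [d0 L0 B0 dP]]]] := field_bounds conservativeX ix.
have [r r0 rP] := near_prod_dist (flow_family_near flowPhi cc ip d0).
have r1 s u : `|s - t0| < r -> `|u| < r -> cdom (mchart i) (Phi s (c u)) /\
    `|cm i (Phi s (c u)) - cm i (Phi t0 p)| < d.
  by move=> sr ur; apply: rP => //; rewrite subr0.
have r00 : `|0 : R| < r by rewrite normr0.
exists (Num.min r (4 * L)^-1); first by rewrite lt_min r0 invr_gt0 mulr_gt0.
split.
- by move=> s u; rewrite !lt_min => /andP[sr _] /andP[ur _]; have [] := r1 s u sr ur.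
- exists B; split=> // s; rewrite lt_min => /andP[sr _].
  have [_ sd] := r1 s 0 sr r00.
  by have [_ _ ? ?] := dP _ _ sd sd.
move=> t t' s u; rewrite !lt_min => /andP[tr tL] /andP[t'r t'L] /andP[ur _].
have wr q := between_near tr t'r (q := q).
apply: (@short_gronwall _ _ (fun q => separation Phi i q c u)
  (fun q => X_ i (cm i (Phi q (c u))) - X_ i (cm i (Phi q p))) t t' L).
- exact: ltW.
- have : `|t' - t| <= 2 * (4 * L)^-1.
    rewrite -(subrKA t0) (le_trans (ler_normD _ _))// (distrC t0).
    by rewrite mulr_natl mulr2n lerD// ltW.
  move/(ler_wpM2l (ltW L0))/le_trans; apply.
  rewrite invfM mulrCA mulrA [2 * _]mulrC; set z := L^-1.
  have : L * z = 1 by rewrite mulfV// gt_eqF.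
  lra.
- move=> q /wr qr; apply: separation_is_derive => //; first by case: (r1 q 0 qr r00).
  by case: (r1 q u qr ur).
- move=> q /wr qr; have [_ q0] := r1 q 0 qr r00; have [_ qu] := r1 q u qr ur.
  by have [_ + _ _] := dP _ _ q0 qu.
Qed.

Lemma orbit_compact i t t' p :
  (forall s, Num.min t t' <= s <= Num.max t t' -> cdom (mchart i) (Phi s p)) ->
  compact ((fun s => cm i (Phi s p)) @` `[Num.min t t', Num.max t t']).
Proof.
move=> ip; apply: continuous_compact; last exact: segment_compact.
apply: derivable_within_continuous => s; rewrite in_itv /= => /ip sp.
by have [] := flow_is_derive flowPhi sp.
Qed.

End TimeWindow.

Section ShortTransport.
Variables (R : realType) (M : manifold3 R) (m : volume M) (X : vfield M).
Hypothesis conservativeX : conservative_C1 m X.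
Variable Phi : R -> M -> M.
Hypothesis flowPhi : is_flow X Phi.
Variables c1 c2 : R -> M.
Hypotheses (c1_continuous : {for 0, continuous c1})
           (c2_continuous : {for 0, continuous c2}) (c12 : c2 0 = c1 0).

Local Notation cm i := (cmap (mchart i) : M -> 'rV[R]_3).
Local Notation X_ i := (vrep X i).
Local Notation rho i := (vdens m i).

(** The previous derivative, integrated: when [b] is proportional to the
    parameter, [eta] can be taken arbitrarily small by uniform linearization, and
    the variation is negligible against the square of the parameter. *)
Lemma area_variation i t t' (u B b eta : R) :
  0 <= B -> 0 <= b -> 0 <= eta ->
  let x s := cm i (Phi s (c1 0)) in
  let y1 s := separation Phi i s c1 u in let y2 s := separation Phi i s c2 u in
  let S s := rho i (x s) * triple (y1 s) (y2 s) (X_ i (x s)) in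
  (forall s, Num.min t t' <= s <= Num.max t t' ->
    [/\ cdom (mchart i) (Phi s (c1 0)), cdom (mchart i) (Phi s (c1 u)) &
        cdom (mchart i) (Phi s (c2 u))]) ->
  (forall s, Num.min t t' <= s <= Num.max t t' ->
    [/\ `|rho i (x s)| <= B, `|X_ i (x s)| <= B, `|y1 s| <= b & `|y2 s| <= b]) ->
  (forall s y, Num.min t t' <= s <= Num.max t t' -> `|y - x s| <= b ->
    `|X_ i y - X_ i (x s) - (y - x s) *m jacobian (X_ i) (x s)| <= eta * b) ->
  `|S t' - S t| <= B * (6 * (eta * b * b * B) * 2) * `|t' - t|.
Proof.
move=> B0 b0 eta0 x y1 y2 S dom bnd lin.
pose J s := jacobian (X_ i) (x s).
pose E1 s := X_ i (cm i (Phi s (c1 u))) - X_ i (x s).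
pose E2 s := X_ i (cm i (Phi s (c2 u))) - X_ i (x s).
pose S' s := rho i (x s) * (triple (E1 s - y1 s *m J s) (y2 s) (X_ i (x s)) +
                triple (y1 s) (E2 s - y2 s *m J s) (X_ i (x s))).
apply: (@mean_value_inequality_real R S S').
- by rewrite !mulr_ge0.
- move=> s st; have [d0 d1 d2] := dom s st.
  apply: area_is_derive => //; first exact: separation_is_derive.
  rewrite /E2 /x -c12; apply: separation_is_derive => //.
  by rewrite c12.
move=> s st; have [br bX b1 b2] := bnd s st.
have e1 : `|E1 s - y1 s *m J s| <= eta * b by exact: lin.
have e2 : `|E2 s - y2 s *m J s| <= eta * b.
  rewrite /y2 /separation c12; apply: lin => //.
  by move: b2; rewrite /y2 /separation c12.
have t1 := triple_le (E1 s - y1 s *m J s) (y2 s) (X_ i (x s)).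
have t2 := triple_le (y1 s) (E2 s - y2 s *m J s) (X_ i (x s)).
have v1 : `|E1 s - y1 s *m J s| * `|y2 s| * `|X_ i (x s)| <= eta * b * b * B.
  apply: ler_pM => //.
  exact: ler_pM.
have v2 : `|y1 s| * `|E2 s - y2 s *m J s| * `|X_ i (x s)| <= eta * b * b * B.
  apply: ler_pM => //.
  by rewrite mulrC; exact: ler_pM.
rewrite /S' normrM; apply: ler_pM => //.
apply: le_trans (ler_normD _ _) _.
have w1 := le_trans t1 (ler_wpM2l (ler0n R 6) v1).
have w2 := le_trans t2 (ler_wpM2l (ler0n R 6) v2).
by apply: le_trans (lerD w1 w2) _; rewrite mulr_natr mulr2n.
Qed.

Lemma separation_bounded_window (t t' d : R) (K0 K : R) i c :
  0 < d -> `|K0| <= K ->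
  (forall s u, `|u| < d -> Num.min t t' <= s <= Num.max t t' ->
    `|separation Phi i s c u| <= 2 * `|separation Phi i t c u|) ->
  (\forall u \near (0 : R), `|separation Phi i t c u| <= K0 * `|u|) ->
  \forall u \near (0 : R), forall s, Num.min t t' <= s <= Num.max t t' ->
    `|separation Phi i s c u| <= 2 * K * `|u|.
Proof.
move=> d0 KK win; apply: filterS2 (near0_lt d0) => u ud bu s st.
apply: le_trans (win s u ud st) _; rewrite -mulrA ler_wpM2l//.
apply: le_trans bu _; apply: ler_wpM2r => //.
exact: le_trans (ler_norm _) KK.
Qed.

Lemma transported_local i t0 : cdom (mchart i) (Phi t0 (c1 0)) ->
  exists2 d : R, 0 < d & forall t t' k, `|t - t0| < d -> `|t' - t0| < d ->
    cdom (mchart i) (Phi t (c1 0)) /\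
    (transported m X Phi c1 c2 i t k -> transported m X Phi c1 c2 i t' k).
Proof.
move=> ip.
have [d1 d10 [dom1 [B [B0 BP]] win1]] :=
  separation_window conservativeX flowPhi c1_continuous ip.
have := @separation_window R M m X conservativeX Phi flowPhi i t0 c2 c2_continuous.
rewrite c12 => /(_ ip)[d2 d20 [dom2 _ win2]].
exists (Num.min d1 d2); first by rewrite lt_min d10.
move=> t t' k; rewrite !lt_min => /andP[td1 td2] /andP[t'd1 t'd2].
split; first by apply: dom1; rewrite ?normr0.
have mem_t' : Num.min t t' <= t' <= Num.max t t' by rewrite ge_min le_max lexx !orbT.
have wd1 q := between_near td1 t'd1 (q := q).
have wd2 q := between_near td2 t'd2 (q := q).
move=> [[K1 b1] [K2 b2] rate].
pose K := 1 + `|K1| + `|K2|.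
have K0 : 0 < K by rewrite /K -addrA ltr_pwDl// addr_ge0.
have KK1 : `|K1| <= K by rewrite /K addrAC lerDr addr_ge0.
have KK2 : `|K2| <= K by rewrite /K lerDr addr_ge0.
have bK1 := separation_bounded_window d10 KK1
  (fun s u ud st => win1 t t' s u td1 t'd1 ud st) b1.
have bK2 := separation_bounded_window d20 KK2
  (fun s u ud st => win2 t t' s u td2 t'd2 ud st) b2.
split.
- by exists (2 * K); move: bK1; apply: filterS => u; apply.
- by exists (2 * K); move: bK2; apply: filterS => u; apply.
move=> e e0.
pose N := 1 + B * (6 * (2 * K * (2 * K) * B) * 2) * `|t' - t|.
have N0 : 0 < N.
  rewrite ltr_pwDl//; apply: mulr_ge0 => //.
  by repeat (apply: mulr_ge0 => //); exact: ltW.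
have e2 : 0 < e / 2 by rewrite divr_gt0.
have eN : 0 < e / 2 / N by rewrite divr_gt0.
pose KK := (fun s => cm i (Phi s (c1 0))) @` `[Num.min t t', Num.max t t'].
have domK s : Num.min t t' <= s <= Num.max t t' -> cdom (mchart i) (Phi s (c1 0)).
  by move=> /wd1 sd; apply: dom1; rewrite ?normr0.
have KU : KK `<=` cimg (mchart i).
  by move=> _ [s + <-]; rewrite /= in_itv /= => /domK sp; exists (Phi s (c1 0)).
have [d d0 dP] := Ck1_uniform (@cimg_open _ _ (mchart i)) (vfield_C1 conservativeX i)
  (orbit_compact flowPhi domK) KU eN.
have near_d : \forall u \near (0 : R), 2 * K * `|u| < d.
  have Kd : 0 < (2 * K)^-1 * d by rewrite mulr_gt0// invr_gt0 mulr_gt0.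
  apply: filterS (near0_lt Kd) => u.
  by rewrite [X in _ < X]mulrC ltr_pdivlMr ?mulr_gt0// mulrC.
near=> u.
have ud1 : `|u| < d1 by near: u; exact: near0_lt.
have ud2 : `|u| < d2 by near: u; exact: near0_lt.
have u1 : forall s, Num.min t t' <= s <= Num.max t t' ->
    `|separation Phi i s c1 u| <= 2 * K * `|u| by near: u.
have u2 : forall s, Num.min t t' <= s <= Num.max t t' ->
    `|separation Phi i s c2 u| <= 2 * K * `|u| by near: u.
have rt : `| `|rho i (cm i (Phi t (c1 0))) *
        triple (separation Phi i t c1 u) (separation Phi i t c2 u)
               (X_ i (cm i (Phi t (c1 0))))| - k * u ^+ 2| <= e / 2 * u ^+ 2.
  by near: u; exact: rate.
have ud : 2 * K * `|u| < d by near: u.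
have b0 : 0 <= 2 * K * `|u| by rewrite !mulr_ge0// ltW.
have St := area_variation (i := i) (t := t) (t' := t') (u := u) (ltW B0) b0 (ltW eN).
have {}St : `|rho i (cm i (Phi t' (c1 0))) *
        triple (separation Phi i t' c1 u) (separation Phi i t' c2 u)
               (X_ i (cm i (Phi t' (c1 0)))) -
     rho i (cm i (Phi t (c1 0))) *
        triple (separation Phi i t c1 u) (separation Phi i t c2 u)
               (X_ i (cm i (Phi t (c1 0))))| <= e / 2 * u ^+ 2.
  apply: le_trans (St _ _ _) _.
  - move=> s st; split; first exact: domK.
      by apply: dom1 => //; exact: wd1.
    by apply: dom2 => //; exact: wd2.
  - by move=> s st; have [? ?] := BP s (wd1 s st); split=> //; [exact: u1|exact: u2].
  - move=> s y st yb.
    have Kx : KK (cm i (Phi s (c1 0))) by exists s => //=; rewrite in_itv.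
    have yd : `|y - cm i (Phi s (c1 0))| < d by exact: le_lt_trans yb ud.
    apply: le_trans (dP _ _ Kx yd) _; apply: ler_wpM2l => //; exact: ltW.
  - have -> : e / 2 * u ^+ 2 = e / 2 / N * u ^+ 2 * N by field; rewrite gt_eqF.
    rewrite -(real_normK (num_real u)).
    move: (e / 2 / N) (ltW eN) => a a0.
    have : 0 <= a * `|u| ^+ 2 by rewrite mulr_ge0 ?sqr_ge0.
    rewrite /N; move: `|u| `|t' - t| => v w; clearbody K; lra.
by rewrite [e]splitr mulrDl; exact: norm_close rt St.
Unshelve. all: by end_near. Qed.

End ShortTransport.

Section LongTransport.
Variables (R : realType) (M : manifold3 R) (m : volume M) (X : vfield M).
Hypothesis conservativeX : conservative_C1 m X.
Variable Phi : R -> M -> M.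
Hypothesis flowPhi : is_flow X Phi.
Variables c1 c2 : R -> M.
Hypotheses (c1_continuous : {for 0, continuous c1})
           (c2_continuous : {for 0, continuous c2}) (c12 : c2 0 = c1 0).

(** The times at which the area rate is [k] form an open and closed set, and the
    line is connected. *)
Lemma transported_orbit i j t k :
  cdom (mchart i) (c1 0) -> cdom (mchart j) (Phi t (c1 0)) ->
  transported m X Phi c1 c2 i 0 k -> transported m X Phi c1 c2 j t k.
Proof.
move=> i0 jt tr0.
pose A := [set s : R | forall j, cdom (mchart j) (Phi s (c1 0)) ->
  transported m X Phi c1 c2 j s k].
have chart_change := @transported_chart _ _ m _ _ flowPhi _ _ c1_continuous c2_continuous c12.
have loc s : exists2 d : R, 0 < d & forall r r', `|r - s| < d -> `|r' - s| < d ->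
    A r -> A r'.
  have [l ls] := mcover (Phi s (c1 0)).
  have [d d0 dP] := transported_local conservativeX flowPhi c1_continuous
    c2_continuous c12 ls.
  exists d => // r r' rs r's Ar j' j'r'.
  have [lr tr] := dP r r' k rs r's; have [lr' _] := dP r' r k r's rs.
  by apply: (chart_change l) => //; apply: tr; exact: Ar.
have Aopen : open A.
  rewrite openE => s As; have [d d0 dP] := loc s.
  apply/nbhs_ballP; exists d => //= r; rewrite -ball_normE /= distrC => rs.
  by apply: (dP s r) => //; rewrite subrr normr0.
have Aclosed : closed A.
  move=> s As; have [d d0 dP] := loc s.
  have [r [Ar]] := As _ (nbhsx_ballx s d d0).
  rewrite -ball_normE /= distrC => rs.
  by apply: (dP r s) => //; rewrite subrr normr0.
have A0 : A 0.
  move=> l; rewrite (flow0 flowPhi) => l0.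
  by apply: (chart_change i) => //; rewrite (flow0 flowPhi).
have : connected [set: R] by apply/connected_intervalP => x y.
move=> /(_ A)/(_ _ _ _) AT.
have {}AT : A = setT.
  by apply: AT; [exists 0|exists A => //; rewrite setTI|exists A => //; rewrite setTI].
have : A t by rewrite AT.
exact.
Qed.

End LongTransport.

(** * Inverse function theorem *)

Section InverseFunction.
Variables (R : realType) (n : nat) (f : 'rV[R]_n -> 'rV[R]_n) (a : 'rV[R]_n)
  (N : 'M[R]_n).
Hypotheses (Nunit : N \in unitmx) (fN : strict_diff f a (mulmxr N)).

Lemma strict_diff_inverse_lipschitz : exists C d : R, [/\ 0 < C, 0 < d &
  forall v v', `|v - a| < d -> `|v' - a| < d -> `|v' - v| <= C * `|f v' - f v|].
Proof.
have [C C0 CP] := mulmx_bounded (invmx N).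
have [|d d0 dP] := fN (_ : 0 < (2 * C)^-1); first by rewrite invr_gt0 mulr_gt0.
exists (2 * C), d; split=> // [|v v' va v'a]; first by rewrite mulr_gt0.
have h := dP v v' va v'a.
have h1 : `|v' - v| <= C * `|(v' - v) *m N|.
  by apply: le_trans _ (CP _); rewrite mulmxK.
have h2 : `|(v' - v) *m N| <= `|f v' - f v| + (2 * C)^-1 * `|v' - v|.
  have -> : (v' - v) *m N = f v' - f v - (f v' - f v - (v' - v) *m N).
    by rewrite subKr.
  by apply: le_trans (ler_normB _ _) _; rewrite lerD2l.
have h3 := le_trans h1 (ler_wpM2l (ltW C0) h2).
move: h3; rewrite mulrDr mulrA.
have -> : C * (2 * C)^-1 = 2^-1 by field; rewrite gt_eqF.
move: `|v' - v| `|f v' - f v| => p q; lra.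
Qed.

(** Newton's map contracts a small ball into itself; the point of the ball that
    it moves least is fixed, since its image is moved at most half as much. *)
Lemma strict_diff_open d : 0 < d ->
  exists2 eta : R, 0 < eta & forall y, `|y - f a| < eta ->
    exists2 v, `|v - a| < d & f v = y.
Proof.
move=> d0; have [C C0 CP] := mulmx_bounded (invmx N).
have [|d1 d10 dP] := fN (_ : 0 < (2 * C)^-1); first by rewrite invr_gt0 mulr_gt0.
pose r := Num.min d d1 / 2.
have m0 : 0 < Num.min d d1 by rewrite lt_min d0.
have r0 : 0 < r by rewrite divr_gt0.
have rm : r < Num.min d d1 by rewrite /r; lra.
have [rd rd1] : r < d /\ r < d1 by move: rm; rewrite lt_min => /andP.
exists (r / 2 / C) => [|y ya]; first by rewrite !divr_gt0.
pose T v := v - (f v - y) *m invmx N.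
pose B := [set v : 'rV[R]_n | `|v - a| <= r].
have Tcontr v w : B v -> B w -> `|T v - T w| <= 2^-1 * `|v - w|.
  move=> Bv Bw.
  have -> : T v - T w = - ((f v - f w - (v - w) *m N) *m invmx N).
    have PQ : (f v - y) *m invmx N - (f w - y) *m invmx N = (f v - f w) *m invmx N.
      by rewrite -mulmxBl opprB subrKA.
    have -> : (f v - f w - (v - w) *m N) *m invmx N =
        (f v - f w) *m invmx N - (v - w) by rewrite mulmxBl mulmxK.
    rewrite /T !opprB -PQ opprB addrACA [RHS]addrACA.
    by rewrite [- w - _]addrC.
  rewrite normrN; apply: le_trans (CP _) _.
  have h := dP w v (le_lt_trans Bw rd1) (le_lt_trans Bv rd1).
  apply: le_trans (ler_wpM2l (ltW C0) h) _.
  rewrite mulrA (_ : C * (2 * C)^-1 = 2^-1)//.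
  by field; rewrite gt_eqF.
have Ba : B a by rewrite /B /= subrr normr0 ltW.
have Ta : `|T a - a| <= r / 2.
  rewrite /T addrAC subrr sub0r normrN; apply: le_trans (CP _) _.
  by rewrite -ler_pdivlMl// mulrC distrC ltW.
have TB v : B v -> B (T v).
  move=> Bv; rewrite /B /= -(subrKA (T a)); apply: le_trans (ler_normD _ _) _.
  apply: le_trans (lerD (Tcontr _ _ Bv Ba) Ta) _.
  have : `|v - a| <= r by [].
  move: `|v - a| => p; lra.
have cB : compact B.
  apply: bounded_closed_compact.
    exists (`|a| + r); split; first exact: num_real.
    move=> x xar v Bv; apply: le_trans (ltW xar).
    by rewrite -[v](subrK a) addrC; apply: le_trans (ler_normD _ _) _; rewrite lerD2l.
  rewrite (_ : B = closed_ball a r); first exact: closed_ball_closed.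
  by rewrite closed_ballE//; apply/seteqP; split=> v; rewrite /B /closed_ball_ /= distrC.
have cT : {within B, continuous (fun v => `|T v - v|)}.
  apply/subspace_continuousP => v Bv; apply/cvgrPdist_le => e e0.
  have e4 : 0 < e / 4 by rewrite divr_gt0.
  apply: filterS (near_dist_lt v e4) => w wv Bw.
  apply: le_trans (ler_dist_dist _ _) _.
  have -> : T v - v - (T w - w) = T v - T w - (v - w).
    by rewrite !opprB addrACA [RHS]addrACA; congr (_ + _); exact: addrC.
  apply: le_trans (ler_normB _ _) _.
  have := Tcontr v w Bv Bw; move: wv; rewrite distrC.
  move: `|T v - T w| `|v - w| => p q; lra.
have [v Bv vmin] := EVT_min_rV (ex_intro _ a Ba) cB cT.
have BTv : B (T v) by apply: TB; rewrite inE in Bv.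
rewrite inE in Bv.
have := vmin (T v); rewrite inE => /(_ BTv) le1.
have le2 := Tcontr _ _ BTv Bv.
have /eqP : `|T v - v| = 0.
  apply/eqP; rewrite eq_le normr_ge0 andbT.
  move: le1 le2; move: `|T v - v| `|T (T v) - T v| => p q; lra.
rewrite normr_eq0 /T addrAC subrr sub0r oppr_eq0 => /eqP fvy.
exists v; first exact: le_lt_trans Bv rd.
by apply/eqP; rewrite -subr_eq0 -[f v - y](mulmxKV Nunit) fvy mul0mx.
Qed.

End InverseFunction.

(** * Flow box coordinates at a cross section *)

Section FlowBox.
Variable R : realType.
Local Notation x0 := (ord0 : 'I_3).
Local Notation x1 := (lift ord0 ord0 : 'I_3).
Local Notation x2 := (lift ord0 (lift ord0 ord0) : 'I_3).

Definition vec3 (a b c : R) : 'rV[R]_3 := \row_k nth 0 [:: a; b; c] k.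

Lemma vec3E a b c :
  [/\ vec3 a b c 0 x0 = a, vec3 a b c 0 x1 = b & vec3 a b c 0 x2 = c].
Proof. by rewrite /vec3 !mxE. Qed.

Lemma vec3_eta (v : 'rV[R]_3) : v = vec3 (v 0 x0) (v 0 x1) (v 0 x2).
Proof.
have [e0 e1 e2] := vec3E (v 0 x0) (v 0 x1) (v 0 x2).
by apply/rowP => k; elim/ord3_ind: k.
Qed.

Lemma vec3_inj a b c a' b' c' : vec3 a b c = vec3 a' b' c' ->
  [/\ a = a', b = b' & c = c'].
Proof.
have [e0 e1 e2] := vec3E a b c; have [e0' e1' e2'] := vec3E a' b' c'.
by move=> E; split; [rewrite -e0 E|rewrite -e1 E|rewrite -e2 E].
Qed.

(** A vector of flow box coordinates is a point of the plane followed by a time. *)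
Definition vec_point (v : 'rV[R]_3) : R^o * R^o := (v 0 x0, v 0 x1).
Definition vec_time (v : 'rV[R]_3) : R := v 0 x2.

Lemma point_norm (w : R^o * R^o) : [/\ `|w.1| <= `|w| & `|w.2| <= `|w|].
Proof. by rewrite prod_normE !le_max !lexx orbT. Qed.

Lemma point_norm_lt (w : R^o * R^o) d : (`|w| < d) = (`|w.1| < d) && (`|w.2| < d).
Proof. by rewrite prod_normE gt_max. Qed.

Lemma vec_point_norm v v' : `|vec_point v' - vec_point v| <= `|v' - v|.
Proof.
rewrite prod_normE ge_max; apply/andP; split => /=.
  by have := rV_norm_coord (v' - v) x0; rewrite !mxE.
by have := rV_norm_coord (v' - v) x1; rewrite !mxE.
Qed.

Lemma vec_time_norm v v' : `|vec_time v' - vec_time v| <= `|v' - v|.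
Proof. by have := rV_norm_coord (v' - v) x2; rewrite !mxE. Qed.

Lemma vec3_norm a b c d :
  `|vec3 a b c| < d = [&& `|a| < d, `|b| < d & `|c| < d].
Proof.
have [e0 e1 e2] := vec3E a b c.
have h0 := rV_norm_coord (vec3 a b c) x0; rewrite e0 in h0.
have h1 := rV_norm_coord (vec3 a b c) x1; rewrite e1 in h1.
have h2 := rV_norm_coord (vec3 a b c) x2; rewrite e2 in h2.
apply/idP/idP => [h|/and3P[a0 b0 c0]].
  by rewrite (le_lt_trans h0 h) (le_lt_trans h1 h) (le_lt_trans h2 h).
apply: (@le_lt_trans _ _ (Num.max `|a| (Num.max `|b| `|c|))).
  apply: rV_norm_le; first by rewrite le_max normr_ge0.
  by elim/ord3_ind; rewrite ?e0 ?e1 ?e2 !le_max lexx ?orbT.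
by rewrite !gt_max a0 b0.
Qed.

Lemma mulmx_col_mx3 (v a b c : 'rV[R]_3) :
  v *m (col_mx (col_mx a b) c : 'M[R]_3) = v 0 x0 *: a + v 0 x1 *: b + v 0 x2 *: c.
Proof.
have row_eq (N : 'M[R]_3) (i j : 'I_3) : val i = val j -> row i N = row j N.
  by move=> /val_inj ->.
rewrite mulmx_sum_row sum3E; congr (_ *: _ + _ *: _ + _ *: _).
- rewrite (row_eq _ _ (lshift 1 (lshift 1 (ord0 : 'I_1))))//.
  by rewrite (@rowKu _ 2 1 3 _ (col_mx a b) c) (@rowKu _ 1 1 3 _ a b) row_id.
- rewrite (row_eq _ _ (lshift 1 (rshift 1 (ord0 : 'I_1))))//.
  by rewrite (@rowKu _ 2 1 3 _ (col_mx a b) c) (@rowKd _ 1 1 3 _ a b) row_id.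
- rewrite (row_eq _ _ (rshift 2 (ord0 : 'I_1)))//.
  by rewrite (@rowKd _ 2 1 3 _ (col_mx a b) c) row_id.
Qed.

Variables (M : manifold3 R) (m : volume M) (X : vfield M).
Hypothesis conservativeX : conservative_C1 m X.
Variable Phi : R -> M -> M.
Hypothesis flowPhi : is_flow X Phi.
Variable s : R^o * R^o -> M.
Hypothesis sectionS : cross_section X s.

Local Notation cm i := (cmap (mchart i) : M -> 'rV[R]_3).
Local Notation X_ i := (vrep X i).
Local Notation d1 j w := ('D_((1, 0) : R^o * R^o) (cmap (mchart j) \o s) w).
Local Notation d2 j w := ('D_((0, 1) : R^o * R^o) (cmap (mchart j) \o s) w).

Lemma section_continuous w : square w -> {for w, continuous s}.
Proof. by case: sectionS => _ [V [_ sV cV _]] _ /sV; exact: cV. Qed.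

Lemma section_domain j w : square w -> cdom (mchart j) (s w) ->
  exists U, [/\ open U, U w & Ck 1 U (cm j \o s)].
Proof.
case: sectionS => _ [V [Vo sV cV kV]] _ sw jw.
exists (V `&` s @^-1` cdom (mchart j)); split; last exact: kV; last first.
  by split => //; exact: sV.
rewrite openE => z [Vz jz]; apply: filterI; first exact: open_nbhs_nbhs.
by apply: (cV z Vz); exact: near_cdom.
Qed.

Lemma sum2E (W : zmodType) (F : nat -> W) : \sum_(k < 2) F k = F 0%N + F 1%N.
Proof. by rewrite !big_ord_recl big_ord0 addr0. Qed.

Lemma section_strict_diff j w : square w -> cdom (mchart j) (s w) ->
  strict_diff (cm j \o s) w (fun z => z.1 *: d1 j w + z.2 *: d2 j w).
Proof.
move=> sw jw; have [U [Uo Uw kU]] := section_domain sw jw.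
pose e (k : nat) : R^o * R^o := if k == 0%N then (1, 0) else (0, 1).
pose c (k : nat) (z : R^o * R^o) : R := if k == 0%N then z.1 else z.2.
have := @strict_diff_of_partials R _ _ (cm j \o s) w e c 2%N
  (@mean_value_inequality_rV R 3).
rewrite (_ : (fun z => \sum_(k < 2) _) =
  (fun z => z.1 *: d1 j w + z.2 *: d2 j w)); last first.
  apply/funext => z.
  exact: (sum2E (fun k => c k z *: 'D_(e k) (cm j \o s) w)).
apply.
- move=> z; rewrite (sum2E (fun k => c k z *: e k)) /c /e /=.
  case: z => a b; congr pair; rewrite /GRing.scale/=.
    by rewrite scaler0 addr0 [_ *: 1]mulr1.
  by rewrite scaler0 add0r [_ *: 1]mulr1.
- by move=> k z; have [? ?] := point_norm z; rewrite /c; case: ifP.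
- by move=> k _; exact: (Ck1_near _ Uo kU Uw).1.
- by move=> k _; exact: (Ck1_near _ Uo kU Uw).2.
Qed.

Definition section_frame j w : 'M[R]_3 :=
  col_mx (col_mx (d1 j w) (d2 j w)) (X_ j (cm j (s w))).

Lemma section_frame_unit j w : square w -> cdom (mchart j) (s w) ->
  section_frame j w \in unitmx.
Proof.
move=> sw jw; have [_ _ rf] := sectionS.
by have := rf j w sw jw; rewrite (@row_free_unit _ 3).
Qed.

Definition flow_box j (v : 'rV[R]_3) : 'rV[R]_3 :=
  cm j (Phi (vec_time v) (s (vec_point v))).

Definition box_center (w : R^o * R^o) : 'rV[R]_3 := vec3 w.1 w.2 0.

Lemma box_centerE w : vec_point (box_center w) = w /\ vec_time (box_center w) = 0.
Proof.
rewrite /vec_point /vec_time /box_center.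
by have [-> -> ->] := vec3E w.1 w.2 0; case: w.
Qed.

Lemma flow_box_center j w : flow_box j (box_center w) = cm j (s w).
Proof.
by rewrite /flow_box; have [-> ->] := box_centerE w; rewrite (flow0 flowPhi).
Qed.

End FlowBox.

Section FlowBoxDifferential.
Variable R : realType.
Variables (M : manifold3 R) (m : volume M) (X : vfield M).
Hypothesis conservativeX : conservative_C1 m X.
Variable Phi : R -> M -> M.
Hypothesis flowPhi : is_flow X Phi.
Variable s : R^o * R^o -> M.
Hypothesis sectionS : cross_section X s.

Local Notation cm i := (cmap (mchart i) : M -> 'rV[R]_3).
Local Notation X_ i := (vrep X i).
Local Notation d1 j w := ('D_((1, 0) : R^o * R^o) (cmap (mchart j) \o s) w).
Local Notation d2 j w := ('D_((0, 1) : R^o * R^o) (cmap (mchart j) \o s) w).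

(** The two time estimates behind the differential of the flow box: an orbit
    leaves in the direction of the field, and the separation of two orbits hardly
    changes, by the drift form of Gronwall's inequality. *)
Lemma flow_box_time j w : square w -> cdom (mchart j) (s w) ->
  exists2 L : R, 0 < L & forall e : R, 0 < e -> exists2 d : R, 0 < d &
    (forall r z, `|r| < d -> `|z - w| < d -> cdom (mchart j) (Phi r (s z))) /\
    (forall r r' z z', `|r| < d -> `|r'| < d -> `|z - w| < d -> `|z' - w| < d ->
     `|cm j (Phi r' (s z)) - cm j (Phi r (s z)) - (r' - r) *: X_ j (cm j (s w))|
        <= e * `|r' - r| /\
     `|(cm j (Phi r (s z')) - cm j (Phi r (s z))) - (cm j (s z') - cm j (s z))|
        <= 2 * L * `|r| * `|cm j (s z') - cm j (s z)|).
Proof.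
move=> sw jw.
have jx : cimg (mchart j) (cm j (s w)) by exists (s w).
have [d [L [B [d0 L0 B0 dP]]]] := field_bounds conservativeX jx.
exists L => // e e0.
have Phi0 : Phi 0 (s w) = s w by rewrite (flow0 flowPhi).
have j0 : cdom (mchart j) (Phi 0 (s w)) by rewrite Phi0.
have mn0 : 0 < Num.min d (e / L) by rewrite lt_min d0 divr_gt0.
have [r0 r00 r0P] := near_prod_dist
  (flow_family_near flowPhi (section_continuous sectionS sw) j0 mn0).
rewrite Phi0 in r0P.
have bnd r z : `|r| < r0 -> `|z - w| < r0 -> cdom (mchart j) (Phi r (s z)) /\
    `|cm j (Phi r (s z)) - cm j (s w)| < Num.min d (e / L).
  by move=> rr zr; apply: r0P => //; rewrite subr0.
exists (Num.min r0 (2 * L)^-1); first by rewrite lt_min r00 invr_gt0 mulr_gt0.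
split.
  by move=> r z; rewrite !lt_min => /andP[rr _] /andP[zr _]; have [] := bnd r z rr zr.
move=> r r' z z'; rewrite !lt_min => /andP[rr rL] /andP[r'r _] /andP[zr _] /andP[z'r _].
have flow_d (q : R) y : `|q| < r0 -> `|y - w| < r0 ->
    is_derive q 1 (fun q => cm j (Phi q (s y))) (X_ j (cm j (Phi q (s y)))).
  by move=> qr yr; apply: flow_is_derive => //; have [] := bnd q y qr yr.
have btw (q q' p : R) : `|q| < r0 -> `|q'| < r0 ->
    Num.min q q' <= p <= Num.max q q' -> `|p| < r0.
  by have := @between_near R q q' p 0 r0; rewrite !subr0.
have xx : `|cm j (s w) - cm j (s w)| < d by rewrite subrr normr0.
split.
  pose h (q : R) := cm j (Phi q (s z)) - q *: X_ j (cm j (s w)).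
  have -> : cm j (Phi r' (s z)) - cm j (Phi r (s z)) -
      (r' - r) *: X_ j (cm j (s w)) = h r' - h r.
    by rewrite /h scalerBl !opprB addrACA [RHS]addrACA; congr (_ + _); exact: addrC.
  apply: (@mean_value_inequality_rV R 3 h
    (fun q => X_ j (cm j (Phi q (s z))) - X_ j (cm j (s w)))) => //.
  - exact: ltW.
  - move=> q /(btw _ _ _ rr r'r) qr; apply: is_deriveB; first exact: flow_d.
    exact: is_derive_scale.
  - move=> q /(btw _ _ _ rr r'r) qr; have [_] := bnd q z qr zr.
    rewrite lt_min => /andP[yd yL].
    have [_ h1 _ _] := dP _ _ xx yd.
    by apply: le_trans h1 _; rewrite -ler_pdivlMl// mulrC ltW.
pose y (q : R) := cm j (Phi q (s z')) - cm j (Phi q (s z)).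
have := @short_gronwall_drift R 3 y
  (fun q => X_ j (cm j (Phi q (s z'))) - X_ j (cm j (Phi q (s z)))) 0 r L.
have r000 : `|0 : R| < r0 by rewrite normr0.
rewrite /y !(flow0 flowPhi) subr0; apply.
- exact: ltW.
- have := ler_wpM2l (ltW L0) (ltW rL).
  move/le_trans; apply; rewrite invfM mulrCA mulfV ?gt_eqF// mulr1; lra.
- by move=> q /(btw _ _ _ r000 rr) qr; apply: is_deriveB; exact: flow_d.
- move=> q /(btw _ _ _ r000 rr) qr.
  have [_] := bnd q z qr zr; rewrite lt_min => /andP[zd _].
  have [_] := bnd q z' qr z'r; rewrite lt_min => /andP[z'd _].
  by have [_ + _ _] := dP _ _ zd z'd.
Qed.

(** An increment of the flow box splits into a motion in time, the change of a
    separation between time [0] and time [r], and a separation inside the section;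
    each is compared with the frame separately. *)
Lemma flow_box_strict_diff j w : square w -> cdom (mchart j) (s w) ->
  strict_diff (flow_box Phi s j) (box_center w) (mulmxr (section_frame X s j w)).
Proof.
move=> sw jw e e0.
have [L L0 LP] := flow_box_time sw jw.
have sD := section_strict_diff sectionS sw jw.
pose C := `|d1 j w| + `|d2 j w|.
have CP (z : R^o * R^o) : `|z.1 *: d1 j w + z.2 *: d2 j w| <= C * `|z|.
  have [z1 z2] := point_norm z.
  apply: le_trans (ler_normD _ _) _; rewrite /C mulrDl; apply: lerD.
    by rewrite normrZ mulrC; exact: ler_wpM2l.
  by rewrite normrZ mulrC; exact: ler_wpM2l.
have C0 : 0 < C + 1 by rewrite ltr_wpDl// addr_ge0.
have e3 : 0 < e / 3 by rewrite divr_gt0.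
have [da da0 daP] := strict_diff_lipschitz CP sD.
have [db db0 dbP] := sD (e / 3) e3.
have [dc dc0 [_ dcP]] := LP (e / 3) e3.
have lc0 : 0 < e / 3 / (2 * L * (C + 1)) by rewrite divr_gt0// !mulr_gt0.
exists (Num.min (Num.min da db) (Num.min dc (e / 3 / (2 * L * (C + 1))))).
  by rewrite !lt_min da0 db0 dc0.
have [cp ct] := box_centerE w.
move=> v v'; rewrite !lt_min -andbA => /and4P[va vb vc vd].
rewrite -andbA => /and4P[v'a v'b v'c v'd].
have P1 u d : `|u - box_center w| < d -> `|vec_point u - w| < d.
  have := vec_point_norm (box_center w) u; rewrite cp => h ud.
  exact: le_lt_trans h ud.
have P2 u d : `|u - box_center w| < d -> `|vec_time u| < d.
  have := vec_time_norm (box_center w) u; rewrite ct subr0 => h ud.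
  exact: le_lt_trans h ud.
set z := vec_point v; set z' := vec_point v'.
set r := vec_time v; set r' := vec_time v'.
have zz : `|z' - z| <= `|v' - v| by exact: vec_point_norm.
have rr : `|r' - r| <= `|v' - v| by exact: vec_time_norm.
have [h1 _] := dcP r r' z' z (P2 _ _ vc) (P2 _ _ v'c) (P1 _ _ v'c) (P1 _ _ vc).
have [_ h2] := dcP r r' z z' (P2 _ _ vc) (P2 _ _ v'c) (P1 _ _ vc) (P1 _ _ v'c).
have h3 := daP z z' (P1 _ _ va) (P1 _ _ v'a).
have h4 := dbP z z' (P1 _ _ vb) (P1 _ _ v'b).
have frameE : (v' - v) *m section_frame X s j w = (r' - r) *: X_ j (cm j (s w)) +
    ((z' - z).1 *: d1 j w + (z' - z).2 *: d2 j w).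
  by rewrite /section_frame mulmx_col_mx3 addrC !mxE.
rewrite /= frameE.
have -> : flow_box Phi s j v' - flow_box Phi s j v -
    ((r' - r) *: X_ j (cm j (s w)) + ((z' - z).1 *: d1 j w + (z' - z).2 *: d2 j w)) =
  (cm j (Phi r' (s z')) - cm j (Phi r (s z')) - (r' - r) *: X_ j (cm j (s w))) +
  (((cm j (Phi r (s z')) - cm j (Phi r (s z))) - (cm j (s z') - cm j (s z))) +
   (cm j (s z') - cm j (s z) - ((z' - z).1 *: d1 j w + (z' - z).2 *: d2 j w))).
  by rewrite subrKA addrACA -opprD subrKA.
have k1 := le_trans h1 (ler_wpM2l (ltW e3) rr).
have k3 := le_trans h4 (ler_wpM2l (ltW e3) zz).
have k2 : `|(cm j (Phi r (s z')) - cm j (Phi r (s z))) - (cm j (s z') - cm j (s z))|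
    <= e / 3 * `|v' - v|.
  apply: le_trans h2 _.
  have h3' := le_trans h3 (ler_wpM2l (ltW C0) zz).
  have L2r : 0 <= 2 * L * `|r| by rewrite mulr_ge0// mulr_ge0// ltW.
  apply: le_trans (ler_wpM2l L2r h3') _.
  rewrite mulrA; apply: ler_wpM2r => //.
  have hr := ltW (P2 _ _ vd); rewrite ler_pdivlMr ?mulr_gt0// in hr.
  apply: le_trans hr; rewrite -/r.
  by move: `|r| (C + 1) => p q; rewrite (_ : 2 * L * p * q = p * (2 * L * q))//; ring.
apply: le_trans (ler_normD _ _) _.
apply: le_trans (lerD k1 (le_trans (ler_normD _ _) (lerD k2 k3))) _.
move: `|v' - v| (normr_ge0 (v' - v)) => p p0; lra.
Qed.

End FlowBoxDifferential.

(** * Continuity of the return map *)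

Section ReturnMap.
Variable R : realType.
Variables (M : manifold3 R) (m : volume M) (X : vfield M).
Hypothesis conservativeX : conservative_C1 m X.
Variable Phi : R -> M -> M.
Hypothesis flowPhi : is_flow X Phi.
Variable s : R^o * R^o -> M.
Hypothesis sectionS : cross_section X s.

Local Notation cm i := (cmap (mchart i) : M -> 'rV[R]_3).
Local Notation S := (s @` @square R).

Lemma square_compact : compact (@square R).
Proof.
have -> : @square R = `[-1, 1]%classic `*` `[-1, 1]%classic.
  by apply/seteqP; split=> -[a b]; rewrite /square /= !in_itv.
by apply: compact_setX; exact: segment_compact.
Qed.

Lemma section_inj w w' : square w -> square w' -> s w = s w' -> w = w'.
Proof. by case: sectionS => inj _ _ sw sw'; apply: inj; rewrite inE. Qed.

Lemma section_image_closed (K : set (R^o * R^o)) :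
  compact K -> K `<=` @square R -> closed (s @` K).
Proof.
move=> cK sK; apply: compact_closed; first exact: mhausdorff.
apply: continuous_compact => //; apply: continuous_in_subspaceT => w.
by rewrite inE => /sK /(section_continuous sectionS).
Qed.

(** By compactness of the square its parametrization is a homeomorphism onto the
    section. *)
Lemma section_inverse_near w d : square w -> 0 < d ->
  \forall q \near s w, forall z, square z -> s z = q -> `|z - w| < d.
Proof.
move=> sw d0.
pose K := @square R `&` [set z | d <= `|z - w|].
have cK : compact K.
  apply: compact_closedI; first exact: square_compact.
  rewrite (_ : mkset _ = ~` ball w d); first exact/open_closedC/ball_open.
  by apply/seteqP; split=> z; rewrite -ball_normE /= distrC leNgt => /negP.
have : \forall q \near s w, ~ (s @` K) q.
  apply: open_nbhs_nbhs; split.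
    by apply: closed_openC; apply: section_image_closed => // z [].
  move=> [z [sz zw] szw]; move: zw.
  by rewrite (section_inj sz sw szw) /= subrr normr0 leNgt d0.
apply: filterS => q nK z sz zq; rewrite ltNge; apply/negP => zw.
by apply: nK; exists z.
Qed.

(** By transversality the flow box coordinates are injective near a point of the
    section, and the section is the slice at time zero. *)
Lemma section_local_uniqueness w : square w ->
  \forall r \near (0 : R) & z \near w, square z -> forall z', square z' ->
    Phi r (s z) = s z' -> r = 0 /\ z' = z.
Proof.
move=> sw; have [j jw] := mcover (s w).
have sD := flow_box_strict_diff conservativeX flowPhi sectionS sw jw.
have unitN := section_frame_unit sectionS sw jw.
have [C [d [C0 d0 low]]] := strict_diff_inverse_lipschitz unitN sD.
have cs := section_continuous sectionS sw.
have inv_near := flow_family_cvg flowPhi cs (t := 0).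
rewrite (flow0 flowPhi) in inv_near.
have [U1 [/= U11 U12] U1P] := inv_near _ (section_inverse_near sw d0).
exists (U1.1 `&` [set r | `|r| < d], U1.2 `&` [set z | `|z - w| < d]).
  split; apply: filterI => //; first exact: near0_lt.
  exact: (@near_dist_lt R (R^o * R^o)%type w d d0).
move=> [r z] /= [[U1r rd] [U1z zd]] sz z' sz' rz.
have z'd : `|z' - w| < d by apply: (U1P (r, z)).
have low' := low (vec3 z.1 z.2 r) (vec3 z'.1 z'.2 0).
have vecB (a b c a' b' c' : R) : vec3 a b c - vec3 a' b' c' =
    vec3 (a - a') (b - b') (c - c').
  have [e0 e1 e2] := vec3E a b c; have [e0' e1' e2'] := vec3E a' b' c'.
  by rewrite [LHS]vec3_eta !mxE; congr vec3.
have {}low' : `|vec3 z'.1 z'.2 0 - vec3 z.1 z.2 r| <= 0.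
  have := low' _ _.
  have -> : flow_box Phi s j (vec3 z'.1 z'.2 0) = flow_box Phi s j (vec3 z.1 z.2 r).
    rewrite /flow_box /vec_point /vec_time.
    have [-> -> ->] := vec3E z'.1 z'.2 0; have [-> -> ->] := vec3E z.1 z.2 r.
    by rewrite (flow0 flowPhi); move: rz; case: (z) => ? ?; case: (z') => ? ? /= ->.
  rewrite subrr normr0 mulr0; apply.
    rewrite /box_center vecB vec3_norm subr0 rd andbT.
    by move: zd; rewrite point_norm_lt.
  rewrite /box_center vecB vec3_norm subr0 normr0 d0 andbT.
  by move: z'd; rewrite point_norm_lt.
move: low'; rewrite normr_le0 subr_eq0 => /eqP /vec3_inj[].
by case: (z) => ? ?; case: (z') => ? ? /= -> -> ->.
Qed.

Lemma square_near (w : R^o * R^o) : `|w.1| < 1 -> `|w.2| < 1 ->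
  exists2 d : R, 0 < d & forall z, `|z - w| < d -> square z.
Proof.
move=> w1 w2; exists (Num.min (1 - `|w.1|) (1 - `|w.2|)).
  by rewrite lt_min !subr_gt0 w1.
move=> z; rewrite lt_min => /andP[zd1 zd2]; have [p1 p2] := point_norm (z - w).
have h (a b : R) : `|a - b| < 1 - `|b| -> -1 <= a <= 1.
  move=> ab; rewrite -ler_norml -[a](subrK b).
  by apply: le_trans (ler_normD _ _) _; rewrite -lerBrDr ltW.
split; apply: h; first exact: le_lt_trans p1 zd1.
exact: le_lt_trans p2 zd2.
Qed.

Variables (f : R -> R) (g : R -> R -> R).
Hypothesis returnF : forall z, square z -> z.1 != 0 ->
  square (lorenz_map f g z) /\ first_return Phi S (s z) (s (lorenz_map f g z)).

(** Intermediate times are excluded because the section is closed, times close to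
    zero because of local uniqueness; compactness makes this uniform. *)
Lemma no_early_return z tau d : square z -> 0 < d ->
  (forall r, 0 < r < tau -> ~ S (Phi r (s z))) ->
  \forall z' \near z, square z' -> forall r, 0 < r <= tau - d -> ~ S (Phi r (s z')).
Proof.
move=> sz d0 early.
have cs := section_continuous sectionS sz.
have : \forall z' \near z, `[0, tau - d]%classic `<=`
    [set r | square z' -> 0 < r -> ~ S (Phi r (s z'))].
  have /compact_near_coveringP cov : compact `[0, tau - d].
    exact: segment_compact.
  apply: (cov _ (nbhs z) (fun z' r => square z' -> 0 < r -> ~ S (Phi r (s z')))).
  move=> r; rewrite /= in_itv /= => /andP[r0 rtau].
  have [->|rn0] := eqVneq r 0.
    move: (section_local_uniqueness sz); apply: filterS => -[r' z'] /= loc sz' r'0.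
    move=> [z'' sz'' E]; have [r'E _] := loc sz' z'' sz'' (esym E).
    by rewrite r'E ltxx in r'0.
  have nS : \forall q \near Phi r (s z), ~ S q.
    apply: open_nbhs_nbhs; split.
      by apply: closed_openC; apply: section_image_closed => //; exact: square_compact.
    by apply: early; rewrite lt_neqAle eq_sym rn0 r0 /=; lra.
  have : \forall r' \near r & z' \near z, ~ S (Phi r' (s z')).
    exact: (flow_family_cvg flowPhi cs nS).
  by apply: filterS => -[r' z'] /= ? _ _.
apply: filterS => z' H sz' r /andP[r0 rt]; apply: H => //=.
by rewrite in_itv /= (ltW r0).
Qed.

(** Since the flow box is open, an orbit near that of [z] crosses the section near
    the image of [z] at a time close to [tau]; it cannot have returned earlier, so
    this crossing is the first return. The image must be an interior point: at the
    boundary the nearby crossing could miss the square. *)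
Lemma return_continuous z j tau d :
  square z -> z.1 != 0 -> `|z.1| < 1 -> `|z.2| < 1 ->
  `|(lorenz_map f g z).1| < 1 -> `|(lorenz_map f g z).2| < 1 ->
  0 < tau -> Phi tau (s z) = s (lorenz_map f g z) ->
  (forall r, 0 < r < tau -> ~ S (Phi r (s z))) ->
  cdom (mchart j) (s (lorenz_map f g z)) -> 0 < d ->
  \forall z' \near z, exists v, [/\ `|v - box_center (lorenz_map f g z)| < d,
    vec_point v = lorenz_map f g z' &
    flow_box Phi s j v = cm j (Phi tau (s z'))].
Proof.
move=> sz z0 z1 z2 Fz1 Fz2 tau0 tauz early jFz d0.
set w := lorenz_map f g z in Fz1 Fz2 tauz jFz *.
have sw : square w by case: (returnF sz z0).
have cs := section_continuous sectionS sz.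
have sD := flow_box_strict_diff conservativeX flowPhi sectionS sw jFz.
have unitN := section_frame_unit sectionS sw jFz.
have [dq dq0 dqP] := square_near Fz1 Fz2.
have [dl dl0 dlP] := near_prod_dist (section_local_uniqueness sw).
have jw0 : cdom (mchart j) (Phi 0 (s w)) by rewrite (flow0 flowPhi).
have [dj dj0 djP] := near_prod_dist
  (flow_family_near flowPhi (section_continuous sectionS sw) jw0 ltr01).
have d20 : 0 < dl / 2 by rewrite divr_gt0.
pose d1 := Num.min (Num.min d dq) (Num.min (Num.min dj tau) (dl / 2)).
have d10 : 0 < d1 by rewrite !lt_min d0 dq0 dj0 tau0.
have [eta eta0 etaP] := strict_diff_open unitN sD d10.
rewrite (flow_box_center flowPhi) in etaP.
have [ds ds0 dsP] := square_near z1 z2.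
have jtau : cdom (mchart j) (Phi tau (s z)) by rewrite tauz.
have near_j : \forall z' \near z, cdom (mchart j) (Phi tau (s z')) /\
    `|cm j (Phi tau (s z')) - cm j (s w)| < eta.
  have [d' d'0 d'P] := near_prod_dist (flow_family_near flowPhi cs jtau eta0).
  apply: filterS (near_dist_lt z d'0) => z' z'z; rewrite -tauz.
  by apply: d'P => //; rewrite subrr normr0.
have near_s : \forall z' \near z, square z'.
  by apply: filterS (near_dist_lt z ds0) => z' /dsP.
have near_0 : \forall z' \near z, z'.1 != 0.
  have z10 : 0 < `|z.1| by rewrite normr_gt0.
  apply: filterS (near_dist_lt z z10) => z'.
  rewrite point_norm_lt => /andP[/= z'z _]; apply/eqP => z'0.
  by move: z'z; rewrite z'0 sub0r normrN ltxx.
have near_e := no_early_return sz d20 early.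
near=> z'.
have sz' : square z' by near: z'.
have z'0 : z'.1 != 0 by near: z'.
have [jz' z'eta] : cdom (mchart j) (Phi tau (s z')) /\
    `|cm j (Phi tau (s z')) - cm j (s w)| < eta by near: z'.
have early' : square z' -> forall r, 0 < r <= tau - dl / 2 -> ~ S (Phi r (s z')).
  by near: z'.
have [v vd1 vE] := etaP _ z'eta.
move: vd1; rewrite !lt_min -!andbA => /and5P[vd vq vj vtau vl].
have [cp ct] := box_centerE w.
have P1 e : `|v - box_center w| < e -> `|vec_point v - w| < e.
  have := vec_point_norm (box_center w) v; rewrite cp => h ud.
  exact: le_lt_trans h ud.
have P2 e : `|v - box_center w| < e -> `|vec_time v| < e.
  have := vec_time_norm (box_center w) v; rewrite ct subr0 => h ud.
  exact: le_lt_trans h ud.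
exists v; split=> //.
set w1 := vec_point v in P1 *; set t := vec_time v in P2 *.
have sw1 : square w1 by apply: dqP; exact: P1.
have [jv _] : cdom (mchart j) (Phi t (s w1)) /\
    `|cm j (Phi t (s w1)) - cm j (Phi 0 (s w))| < 1.
  by apply: djP; [rewrite subr0; exact: P2|exact: P1].
have hit : Phi t (s w1) = Phi tau (s z') by exact: (chart_inj jv jz').
have hit' : Phi (tau - t) (s z') = s w1.
  by rewrite addrC (flowD flowPhi) -hit (flowK flowPhi).
have [sF [tau' tau'0 [tau'E _ first]]] := returnF sz' z'0.
have tpos : 0 < tau - t.
  by rewrite subr_gt0; apply: le_lt_trans (ler_norm _) (P2 _ vtau).
have le1 : tau' <= tau - t.
  rewrite leNgt; apply/negP => lt1; apply: (first (tau - t)); first by rewrite tpos.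
  by exists w1.
have gt1 : tau - dl / 2 < tau'.
  rewrite ltNge; apply/negP => le2; apply: (early' sz' tau'); first by rewrite tau'0.
  by rewrite tau'E; exists (lorenz_map f g z').
(* The first return and the crossing are visits of one orbit at nearby times, so
   local uniqueness identifies them. *)
have tdl := P2 _ vl.
have [|||_ ->//] := dlP (tau' - (tau - t)) w1 _ _ sw1 (lorenz_map f g z') sF.
- rewrite subr0; move: tdl; rewrite !ltr_norml => /andP[? ?]; apply/andP; split; lra.
- apply: lt_trans (P1 _ vl) _; lra.
- by rewrite -hit' -(flowD flowPhi) subrK.
Unshelve. all: by end_near. Qed.

End ReturnMap.

(** * Invariance of the flux density *)

Section FluxDensity.
Variable R : realType.
Variables (M : manifold3 R) (m : volume M) (X : vfield M).
Hypothesis conservativeX : conservative_C1 m X.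
Variable Phi : R -> M -> M.
Hypothesis flowPhi : is_flow X Phi.
Variable s : R^o * R^o -> M.
Hypothesis sectionS : cross_section X s.

Local Notation cm i := (cmap (mchart i) : M -> 'rV[R]_3).
Local Notation X_ i := (vrep X i).
Local Notation rho i := (vdens m i).
Local Notation d1 j w := ('D_((1, 0) : R^o * R^o) (cmap (mchart j) \o s) w).
Local Notation d2 j w := ('D_((0, 1) : R^o * R^o) (cmap (mchart j) \o s) w).
Local Notation S := (s @` @square R).
Local Notation x0 := (ord0 : 'I_3).
Local Notation x1 := (lift ord0 ord0 : 'I_3).
Local Notation x2 := (lift ord0 (lift ord0 ord0) : 'I_3).

(** The density on the square of the flux of [X] through the section. *)
Definition chart_flux j w : R :=
  rho j (cm j (s w)) * `|triple (d1 j w) (d2 j w) (X_ j (cm j (s w)))|.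

Definition shift1 (z : R^o * R^o) (u : R) : R^o * R^o := (z.1 + u, z.2).
Definition shift2 (z : R^o * R^o) (u : R) : R^o * R^o := (z.1, z.2 + u).

Lemma shift1B z u : shift1 z u - z = (u, 0) :> R^o * R^o.
Proof. by case: z => a b; rewrite /shift1; congr pair => /=; rewrite ?subrr// addrAC subrr add0r. Qed.

Lemma shift2B z u : shift2 z u - z = (0, u) :> R^o * R^o.
Proof. by case: z => a b; rewrite /shift2; congr pair => /=; rewrite ?subrr// addrAC subrr add0r. Qed.

Lemma shift1_norm z u : `|shift1 z u - z| = `|u|.
Proof. by rewrite shift1B prod_normE /= normr0; apply/max_idPl. Qed.

Lemma shift2_norm z u : `|shift2 z u - z| = `|u|.
Proof. by rewrite shift2B prod_normE /= normr0; apply/max_idPr. Qed.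

Lemma shift10 z : shift1 z 0 = z.
Proof. by case: z => a b; rewrite /shift1 /= addr0. Qed.

Lemma shift20 z : shift2 z 0 = z.
Proof. by case: z => a b; rewrite /shift2 /= addr0. Qed.

Lemma near_curve (p : R -> R^o * R^o) z (P : set (R^o * R^o)) :
  (forall u, `|p u - z| = `|u|) -> (\forall w \near z, P w) ->
  \forall u \near (0 : R), P (p u).
Proof.
move=> pz /nbhs_ballP[d /= d0 dP]; apply: filterS (near0_lt d0) => u ud.
by apply: dP; rewrite -ball_normE /= distrC pz.
Qed.

Lemma section_curve_continuous (p : R -> R^o * R^o) z : square z -> p 0 = z ->
  (forall u, `|p u - z| = `|u|) -> {for 0, continuous (s \o p)}.
Proof.
move=> sz p0 pz A; rewrite /= p0 => /(section_continuous sectionS sz).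
exact: near_curve.
Qed.

Lemma initial_transported j z : square z -> cdom (mchart j) (s z) ->
  transported m X Phi (s \o shift1 z) (s \o shift2 z) j 0 (chart_flux j z).
Proof.
move=> sz jz; have sD := section_strict_diff sectionS sz jz.
have lin (v : 'rV[R]_3) : linearly_bounded (fun u : R => u *: v).
  by exists `|v|; apply: filterE => u; rewrite normrZ mulrC.
have n1 : sublinear (fun u : R =>
    separation Phi j 0 (s \o shift1 z) u - u *: d1 j z).
  move=> e e0; have [d d0 dP] := sD e e0.
  apply: filterS (near0_lt d0) => u ud.
  have := dP z (shift1 z u); rewrite subrr normr0 shift1_norm => /(_ d0 ud).
  by rewrite shift1B /= scale0r addr0 /separation /= !(flow0 flowPhi) shift10.
have n2 : sublinear (fun u : R =>
    separation Phi j 0 (s \o shift2 z) u - u *: d2 j z).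
  move=> e e0; have [d d0 dP] := sD e e0.
  apply: filterS (near0_lt d0) => u ud.
  have := dP z (shift2 z u); rewrite subrr normr0 shift2_norm => /(_ d0 ud).
  by rewrite shift2B /= scale0r add0r /separation /= !(flow0 flowPhi) shift20.
split; [exact: sublinear_bounded n1|exact: sublinear_bounded n2|].
apply: area_rate_perturb n1 n2 _ => //.
move=> e e0; apply: filterE => u.
rewrite (flow0 flowPhi) /= shift10.
have -> : triple (u *: d1 j z) (u *: d2 j z) (X_ j (cm j (s z))) =
    u ^+ 2 * triple (d1 j z) (d2 j z) (X_ j (cm j (s z))).
  exact: tripleZZ.
have jx : cimg (mchart j) (cm j (s z)) by exists (s z).
rewrite /chart_flux normrM (gtr0_norm (vdens_gt0 m jx)).
rewrite normrM (ger0_norm (sqr_ge0 u)) mulrA mulrAC subrr normr0.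
by rewrite mulr_ge0 ?sqr_ge0// ltW.
Qed.

(** Both sides are the area rate, at time zero, of the same two curves. *)
Lemma chart_flux_eq i j z : square z -> cdom (mchart i) (s z) ->
  cdom (mchart j) (s z) -> chart_flux i z = chart_flux j z.
Proof.
move=> sz iz jz.
have c1 := section_curve_continuous sz (shift10 z) (shift1_norm z).
have c2 := section_curve_continuous sz (shift20 z) (shift2_norm z).
have [_ _ ri] := initial_transported sz iz.
have : transported m X Phi (s \o shift1 z) (s \o shift2 z) j 0 (chart_flux i z).
  apply: (transported_chart flowPhi c1 c2 _ (i := i)).
  - by rewrite /= shift10 shift20.
  - by rewrite (flow0 flowPhi) /= shift10.
  - by rewrite (flow0 flowPhi) /= shift10.
  - exact: initial_transported.
move=> [_ _ rj]; have [_ _ rj'] := initial_transported sz jz.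
exact: area_rate_unique rj rj'.
Qed.

Variables (f : R -> R) (g : R -> R -> R).
Hypothesis returnF : forall z, square z -> z.1 != 0 ->
  square (lorenz_map f g z) /\ first_return Phi S (s z) (s (lorenz_map f g z)).

(** A separation transported up to the return time differs from the increment of
    the return map, to first order, by a multiple of the field only: the return
    times differ. In flow box coordinates this is the third coordinate. *)
Lemma return_coordinates z j tau (p : R -> R^o * R^o) :
  square z -> z.1 != 0 -> `|z.1| < 1 -> `|z.2| < 1 ->
  `|(lorenz_map f g z).1| < 1 -> `|(lorenz_map f g z).2| < 1 ->
  0 < tau -> Phi tau (s z) = s (lorenz_map f g z) ->
  (forall r, 0 < r < tau -> ~ S (Phi r (s z))) ->
  cdom (mchart j) (s (lorenz_map f g z)) ->
  p 0 = z -> (forall u, `|p u - z| = `|u|) ->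
  linearly_bounded (separation Phi j tau (s \o p)) ->
  forall e : R, 0 < e -> \forall u \near (0 : R),
    let y := separation Phi j tau (s \o p) u *m
             invmx (section_frame X s j (lorenz_map f g z)) in
    `|y 0 x0 - (f (p u).1 - f z.1)| <= e * `|u| /\
    `|y 0 x1 - (g (p u).1 (p u).2 - g z.1 z.2)| <= e * `|u|.
Proof.
move=> sz z0 z1 z2 Fz1 Fz2 tau0 tauz early jFz p0 pz [K yK] e e0.
set w := lorenz_map f g z in Fz1 Fz2 tauz jFz *.
have sw : square w by case: (returnF sz z0).
have sD := flow_box_strict_diff conservativeX flowPhi sectionS sw jFz.
have unitN := section_frame_unit sectionS sw jFz.
have [C [dl [C0 dl0 low]]] := strict_diff_inverse_lipschitz unitN sD.
have [C' C'0 C'P] := mulmx_bounded (invmx (section_frame X s j w)).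
have K0 : 0 < 1 + `|K| by rewrite ltr_pwDl.
pose D := C' * (C * (1 + `|K|)).
have D0 : 0 < D by rewrite !mulr_gt0.
have [|dd dd0 ddP] := sD (e / D); first by rewrite divr_gt0.
pose d := Num.min dl dd.
have d0 : 0 < d by rewrite lt_min dl0.
have cont := return_continuous conservativeX flowPhi sectionS returnF sz z0 z1 z2
  Fz1 Fz2 tau0 tauz early jFz d0.
have := near_curve pz cont; move: yK; apply: filterS2 => u yu [v [vd vp vE]].
move: vd; rewrite lt_min => /andP[vl vd] /=.
have yE : separation Phi j tau (s \o p) u =
    flow_box Phi s j v - flow_box Phi s j (box_center w).
  by rewrite (flow_box_center flowPhi) vE /separation /= p0 tauz.
have c0 e' : 0 < e' -> `|box_center w - box_center w| < e'.
  by rewrite subrr normr0.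
have h1 : `|v - box_center w| <= C * ((1 + `|K|) * `|u|).
  have := low _ _ (c0 _ dl0) vl; rewrite -yE => /le_trans; apply.
  rewrite ler_wpM2l ?(ltW C0)//; apply: le_trans yu _; apply: ler_wpM2r => //.
  by apply: le_trans (ler_norm _) _; rewrite lerDr.
have h2 := ddP _ _ (c0 _ dd0) vd; rewrite -yE in h2.
set y := separation _ _ _ _ _ in h2 yE yu *.
set N := section_frame X s j w in unitN C'P h2 *.
have h3 : `|y *m invmx N - (v - box_center w)| <= e * `|u|.
  have -> : y *m invmx N - (v - box_center w) =
      (y - (v - box_center w) *m N) *m invmx N by rewrite (mulmxBl y) mulmxK.
  apply: le_trans (C'P _) _.
  have h4 := ler_wpM2l (ltW C'0) (le_trans h2 (ler_wpM2l (ltW (divr_gt0 e0 D0)) h1)).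
  apply: le_trans h4 _; rewrite le_eqVlt; apply/orP; left; apply/eqP.
  by rewrite /D; field; rewrite ?gt_eqF.
have [e0' e1' _] := vec3E w.1 w.2 0.
have [v0 v1] : v 0 x0 = (lorenz_map f g (p u)).1 /\ v 0 x1 = (lorenz_map f g (p u)).2.
  by rewrite -vp.
move: h3; set Y := y *m invmx N => h3.
split; apply: le_trans h3.
  by have := rV_norm_coord (Y - (v - box_center w)) x0; rewrite !mxE v0.
by have := rV_norm_coord (Y - (v - box_center w)) x1; rewrite !mxE v1.
Qed.

End FluxDensity.

Section FluxIdentity.
Variable R : realType.
Variables (M : manifold3 R) (m : volume M) (X : vfield M).
Hypothesis conservativeX : conservative_C1 m X.
Variable Phi : R -> M -> M.
Hypothesis flowPhi : is_flow X Phi.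
Variable s : R^o * R^o -> M.
Hypothesis sectionS : cross_section X s.

Local Notation cm i := (cmap (mchart i) : M -> 'rV[R]_3).
Local Notation X_ i := (vrep X i).
Local Notation rho i := (vdens m i).
Local Notation d1 j w := ('D_((1, 0) : R^o * R^o) (cmap (mchart j) \o s) w).
Local Notation d2 j w := ('D_((0, 1) : R^o * R^o) (cmap (mchart j) \o s) w).
Local Notation S := (s @` @square R).
Local Notation x0 := (ord0 : 'I_3).
Local Notation x1 := (lift ord0 ord0 : 'I_3).
Local Notation x2 := (lift ord0 (lift ord0 ord0) : 'I_3).

Variables (f : R -> R) (g : R -> R -> R).
Hypothesis returnF : forall z, square z -> z.1 != 0 ->
  square (lorenz_map f g z) /\ first_return Phi S (s z) (s (lorenz_map f g z)).

Lemma sublinear_vec3 (a b c a' b' c' : R -> R) :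
  sublinear (fun u => a u - a' u : R^o) -> sublinear (fun u => b u - b' u : R^o) ->
  sublinear (fun u => c u - c' u : R^o) ->
  sublinear (fun u => vec3 (a u) (b u) (c u) - vec3 (a' u) (b' u) (c' u)).
Proof.
move=> ha hb hc e e0; near=> u.
have h1 : `|a u - a' u| <= e * `|u| by near: u; exact: ha.
have h2 : `|b u - b' u| <= e * `|u| by near: u; exact: hb.
have h3 : `|c u - c' u| <= e * `|u| by near: u; exact: hc.
apply: rV_norm_le; first by rewrite mulr_ge0// ltW.
have [p0 p1 p2] := vec3E (a u) (b u) (c u).
have [q0 q1 q2] := vec3E (a' u) (b' u) (c' u).
have BE (v v' : 'rV[R]_3) k : (v - v') 0 k = v 0 k - v' 0 k by rewrite !mxE.
by apply: ord3_ind; rewrite BE ?p0 ?p1 ?p2 ?q0 ?q1 ?q2.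
Unshelve. all: by end_near. Qed.

Lemma triple_frame (N : 'M[R]_3) (a b c v1 v2 : 'rV[R]_3) :
  N = col_mx (col_mx a b) c -> N \in unitmx ->
  triple v1 v2 c = \det N * triple (v1 *m invmx N) (v2 *m invmx N) (vec3 0 0 1).
Proof.
move=> NE Nu; rewrite -triple_mulmx !mulmxKV//.
have [e0 e1 e2] := @vec3E R 0 0 1.
have -> : vec3 0 0 1 *m N = c; last by [].
by rewrite NE mulmx_col_mx3 e0 e1 e2 !scale0r !add0r scale1r.
Qed.

Lemma triple_vec3 (a b p q r : R) :
  triple (vec3 a p q) (vec3 0 b r) (vec3 0 0 1) = a * b.
Proof.
have [? ? ?] := vec3E a p q; have [? ? ?] := vec3E 0 b r.
have [? ? ?] := @vec3E R 0 0 1.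
rewrite /triple; do !match goal with H : _ = _ |- _ => rewrite H; clear H end.
ring.
Qed.

(** Both sides are the area rate of the separations in the two coordinate
    directions, on the right at time zero and on the left at the return time. There
    the field is the third basis vector, so differences of return times drop out of
    the determinant; what remains is the matrix of increments of the return map,
    triangular because its first component depends on the first coordinate only. *)
Lemma flux_invariant i j z a l :
  square z -> z.1 != 0 -> `|z.1| < 1 -> `|z.2| < 1 ->
  `|(lorenz_map f g z).1| < 1 -> `|(lorenz_map f g z).2| < 1 ->
  cdom (mchart i) (s z) -> cdom (mchart j) (s (lorenz_map f g z)) ->
  is_derive z.1 1 f a -> is_derive z.2 1 (g z.1) l ->
  `|a| * `|l| * chart_flux m X s j (lorenz_map f g z) = chart_flux m X s i z.
Proof.
move=> sz z0 z1 z2 Fz1 Fz2 iz jFz da dl.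
have [sFz [tau tau0 [tauE _ first]]] := returnF sz z0.
have c1 := section_curve_continuous sectionS sz (shift10 z) (shift1_norm z).
have c2 := section_curve_continuous sectionS sz (shift20 z) (shift2_norm z).
have c12 : (s \o shift2 z) 0 = (s \o shift1 z) 0 by rewrite /= shift10 shift20.
have [b1 b2 rate] : transported m X Phi (s \o shift1 z) (s \o shift2 z) j tau
    (chart_flux m X s i z).
  apply: (transported_orbit conservativeX flowPhi c1 c2 c12 (i := i)).
  - by rewrite /= shift10.
  - by rewrite /= shift10 tauE.
  - exact: initial_transported.
have tauz : Phi tau (s z) = s (lorenz_map f g z) by [].
have k1 := return_coordinates conservativeX flowPhi sectionS returnF sz z0 z1 z2 Fz1
  Fz2 tau0 tauz first jFz (shift10 z) (shift1_norm z) b1.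
have k2 := return_coordinates conservativeX flowPhi sectionS returnF sz z0 z1 z2 Fz1
  Fz2 tau0 tauz first jFz (shift20 z) (shift2_norm z) b2.
set w := lorenz_map f g z in Fz1 Fz2 jFz tauE sFz tauz k1 k2 *.
set N := section_frame X s j w in k1 k2.
have Nu : N \in unitmx by exact: section_frame_unit.
rewrite /= shift10 tauz in rate.
set y1 := separation Phi j tau (s \o shift1 z) in b1 rate k1.
set y2 := separation Phi j tau (s \o shift2 z) in b2 rate k2.
have df : sublinear (fun u => f (z.1 + u) - f z.1 - u * a : R^o).
  move=> e e0; have /is_derive_incrementP/(_ e e0)[d d0 dP] := da.
  by apply: filterS (near0_lt d0) => u /dP; rewrite [u + z.1]addrC.
have dg : sublinear (fun u => g z.1 (z.2 + u) - g z.1 z.2 - u * l : R^o).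
  move=> e e0; have /is_derive_incrementP/(_ e e0)[d d0 dP] := dl.
  by apply: filterS (near0_lt d0) => u /dP; rewrite [u + z.2]addrC.
have sub_trans (p q r : R -> R) : sublinear (fun u => p u - q u : R^o) ->
    sublinear (fun u => q u - r u : R^o) -> sublinear (fun u => p u - r u : R^o).
  move=> pq qr e e0; have e2 : 0 < e / 2 by rewrite divr_gt0.
  apply: filterS2 (pq _ e2) (qr _ e2) => u h1 h2.
  rewrite -(subrKA (q u)); apply: le_trans (ler_normD _ _) _.
  by rewrite [e]splitr mulrDl; exact: lerD.
have sub0 (p : R -> R) : sublinear (fun u => p u - p u : R^o).
  by move=> e e0; apply: filterE => u; rewrite subrr normr0 mulr_ge0// ltW.
have sub_sym (p q : R -> R) : sublinear (fun u => p u - q u : R^o) ->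
    sublinear (fun u => q u - p u : R^o).
  by move=> pq e e0; apply: filterS (pq e e0) => u; rewrite distrC.
pose Y1 u := y1 u *m invmx N; pose Y2 u := y2 u *m invmx N.
have Y10 : sublinear (fun u => Y1 u 0 x0 - u * a : R^o).
  apply: (sub_trans _ (fun u => f (z.1 + u) - f z.1)); last exact: df.
  by move=> e e0; apply: filterS (k1 e e0) => u [].
have Y20 : sublinear (fun u => Y2 u 0 x0 - 0 : R^o).
  by move=> e e0; apply: filterS (k2 e e0) => u [/=]; rewrite subrr.
have Y21 : sublinear (fun u => Y2 u 0 x1 - u * l : R^o).
  apply: (sub_trans _ (fun u => g z.1 (z.2 + u) - g z.1 z.2)); last exact: dg.
  by move=> e e0; apply: filterS (k2 e e0) => u [].
(* Up to a sublinear error the increments may be replaced by a triangular matrix. *)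
have n1 : sublinear (fun u : R => vec3 (u * a) (Y1 u 0 x1) (Y1 u 0 x2) - Y1 u).
  have := sublinear_vec3 (sub_sym _ _ Y10) (sub0 (fun u => Y1 u 0 x1))
    (sub0 (fun u => Y1 u 0 x2)).
  by move=> H e e0; apply: filterS (H e e0) => u; rewrite -vec3_eta.
have n2 : sublinear (fun u : R => vec3 0 (u * l) (Y2 u 0 x2) - Y2 u).
  have := sublinear_vec3 (sub_sym _ (fun=> 0) Y20) (sub_sym _ _ Y21)
    (sub0 (fun u => Y2 u 0 x2)).
  by move=> H e e0; apply: filterS (H e e0) => u; rewrite -vec3_eta.
have B1 := linearly_bounded_mulmx (invmx N) b1.
have B2 := linearly_bounded_mulmx (invmx N) b2.
have rate' : area_rate (fun u => rho j (cm j (s w)) * \det N *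
    triple (y1 u *m invmx N) (y2 u *m invmx N) (vec3 0 0 1)) (chart_flux m X s i z).
  apply: area_rate_ext rate => u; congr `|_|.
  rewrite -mulrA; congr (_ * _).
  exact: (@triple_frame N (d1 j w) (d2 j w) _ _ _ (erefl _) Nu).
have := area_rate_perturb B1 B2 n1 n2 rate'.
move=> rate2.
apply: area_rate_unique rate2.
move=> e e0; apply: filterE => u.
rewrite triple_vec3.
have -> : chart_flux m X s j w = rho j (cm j (s w)) * `|\det N|.
  by rewrite /chart_flux triple_col_mx.
have jw : cimg (mchart j) (cm j (s w)) by exists (s w).
have -> : `|rho j (cm j (s w)) * \det N * (u * a * (u * l))| =
    `|a| * `|l| * (rho j (cm j (s w)) * `|\det N|) * u ^+ 2.
  rewrite !normrM (gtr0_norm (vdens_gt0 m jw)) -(real_normK (num_real u)).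
  by move: `|\det N| `|u| `|a| `|l| (rho j _) => *; ring.
by rewrite subrr normr0 mulr_ge0 ?sqr_ge0// ltW.
Qed.

End FluxIdentity.

(** * One-dimensional tools *)

Section OneDimensional.
Variable R : realType.
Implicit Types (f h : R -> R).

Lemma within_incrementP (D : set R) f (x l : R) :
  has_derivative_within D f x l -> forall e : R, 0 < e -> exists2 d : R, 0 < d &
    forall z, D z -> `|z - x| < d -> `|f z - f x - l * (z - x)| <= e * `|z - x|.
Proof.
move=> /cvgrPdist_le fl e e0.
have /nbhs_ballP[d /= d0 dP] := fl e e0.
exists d => // z Dz zx; have [->|zx0] := eqVneq z x.
  by rewrite !subrr mulr0 subr0 normr0 mulr0.
have := dP z; rewrite -ball_normE /= distrC => /(_ zx zx0 Dz).
have zx1 : z - x != 0 by rewrite subr_eq0.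
rewrite -(ler_pM2r (_ : 0 < `|z - x|)) ?normr_gt0// -normrM mulrBl distrC.
by rewrite mulrAC mulVf// mul1r.
Qed.

Lemma within_is_derive (D : set R) f (x l : R) :
  nbhs x D -> has_derivative_within D f x l -> is_derive x 1 f l.
Proof.
move=> /nbhs_ballP[r /= r0 rD] /within_incrementP fl.
apply/is_derive_incrementP => e e0; have [d d0 dP] := fl e e0.
exists (Num.min r d); first by rewrite lt_min r0.
move=> u; rewrite lt_min => /andP[ur ud].
have := dP (u + x); rewrite addrK => /(_ _ ud).
rewrite [l * u]mulrC; apply; apply: rD.
by rewrite -ball_normE /= opprD addrCA subrr addr0 normrN.
Qed.

Lemma within_derivative_continuous (D : set R) f x l : D x ->
  has_derivative_within D f x l -> f @ within D (nbhs x) --> f x.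
Proof.
move=> Dx /within_incrementP fl; apply/cvgrPdist_le => e e0.
have [d d0 dP] := fl 1 ltr01.
have K0 : 0 < 1 + `|l| by rewrite ltr_pwDl.
have eK : 0 < e / (1 + `|l|) by rewrite divr_gt0.
have dn : \forall z \near x, `|z - x| < d by exact: near_dist_lt.
have en : \forall z \near x, `|z - x| < e / (1 + `|l|) by exact: near_dist_lt.
apply: filterS2 dn en => z zd ze Dz.
rewrite distrC -[f z - f x](subrK (l * (z - x))).
apply: le_trans (ler_normD _ _) _.
apply: le_trans (lerD (dP z Dz zd) (lexx _)) _.
by rewrite normrM -mulrDl mulrC -ler_pdivlMr// ltW.
Qed.

Lemma increasing_derive_ge0 f (a b y l : R) : a < y < b ->
  (forall u v, a < u < b -> a < v < b -> u < v -> f u < f v) ->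
  is_derive y 1 f l -> 0 <= l.
Proof.
move=> /andP[ay yb] mono /is_derive_incrementP dl.
rewrite leNgt; apply/negP => l0.
have [|d d0 dP] := dl (- l / 2); first by rewrite divr_gt0// oppr_gt0.
pose u := Num.min d (b - y) / 2.
have m0 : 0 < Num.min d (b - y) by rewrite lt_min d0 subr_gt0.
have u0 : 0 < u by rewrite divr_gt0.
have : u < Num.min d (b - y) by rewrite /u; lra.
rewrite lt_min => /andP[ud ub].
have := dP u; rewrite (gtr0_norm u0) => /(_ ud).
rewrite ler_norml /GRing.scale/= => /andP[_ h].
have := mono y (u + y); rewrite ay yb /= => /(_ isT _ _) h2.
have {h2} : f y < f (u + y) by apply: h2; lra.
have : u * l < 0 by rewrite pmulr_rlt0.
move: h; rewrite mulrC; lra.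
Qed.

(** The exceptional points will be the ends of the images of the two branches. *)
Lemma derive_gt0_lt_off_finite h (E : seq R) (a b : R) : a < b ->
  {within `[a, b], continuous h} ->
  (forall x, a < x < b -> x \notin E -> exists2 l, 0 < l & is_derive x 1 h l) ->
  h a < h b.
Proof.
elim: E a b => [|e E IH] a b ab ch dh.
  have dE x : x \in `]a, b[ -> is_derive x 1 h ('D_1 h x) /\ 0 < 'D_1 h x.
    rewrite in_itv /= => /dh/(_ isT)[l l0 hl].
    by have [dhl ->] := hl; split => //; apply: DeriveDef.
  have [c cab hE] := MVT ab (fun x xab => (dE x xab).1) ch.
  rewrite -subr_gt0 hE mulr_gt0 ?subr_gt0//.
  by have [] := dE c cab.
have [/andP[ae eb]|eab] := boolP (a < e < b); last first.
  apply: IH => // x xab xE; apply: dh => //; rewrite inE negb_or xE andbT.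
  by apply: contra eab => /eqP <-.
apply: (@lt_trans _ _ (h e)); apply: IH => //.
- by apply: continuous_subspaceW ch => x /=; rewrite !in_itv/= => /andP[-> xe]; rewrite (le_trans xe)// ltW.
- move=> x /andP[ax xe] xE; apply: dh; first by rewrite ax (lt_trans xe).
  by rewrite inE negb_or xE andbT lt_eqF.
- by apply: continuous_subspaceW ch => x /=; rewrite !in_itv/= => /andP[ex ->]; rewrite (le_trans _ ex)// ltW.
- move=> x /andP[ex xb] xE; apply: dh; first by rewrite xb (lt_trans ae).
  by rewrite inE negb_or xE andbT gt_eqF.
Qed.

Lemma antiderivative h : continuous h ->
  exists H : R -> R, forall x : R, -2 < x < 2 -> is_derive x 1 H (h x).
Proof.
move=> ch.
exists (fun x => \int[lebesgue_measure]_(t in [set` `[-2, x]]) h t) => x /andP[x2 x2'].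
have ih : lebesgue_measure.-integrable `[-2, 2] (EFin \o h).
  apply: continuous_compact_integrable; first exact: segment_compact.
  exact: continuous_subspaceT.
have [dH HE] := @continuous_FTC1_closed R h (-2) x 2 x2' ih x2 (ch x).
apply: DeriveDef; first exact: dH.
by rewrite -derive1E; exact: HE.
Qed.

(** Expansion makes the inverse Lipschitz, so that its extension by constants
    beyond the image is continuous. *)
Lemma expanding_inverse f (a b : R) : a <= b -> {within `[a, b], continuous f} ->
  (forall x y, a <= x -> x <= y -> y <= b -> y - x <= f y - f x) ->
  exists psi : R -> R, [/\ forall u, a <= psi u <= b,
    forall u, u <= f a -> psi u = a, forall u, f b <= u -> psi u = b,
    forall u, f a <= u <= f b -> f (psi u) = u &
    forall u v, `|psi u - psi v| <= `|u - v|].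
Proof.
move=> ab cf ex.
have fab : f a <= f b.
  by have := ex a b (lexx _) ab (lexx _); move: ab; lra.
pose cl u := Num.max (f a) (Num.min (f b) u).
have clP u : f a <= cl u <= f b by rewrite le_max lexx ge_max fab ge_min lexx.
have ivt u : exists x, a <= x <= b /\ f x = cl u.
  have [|x xab fx] := IVT (v := cl u) ab cf.
    by rewrite (min_idPl fab) (max_idPr fab).
  by exists x; rewrite in_itv/= in xab.
have [psi psiP] := choice ivt.
have lip u v : `|psi u - psi v| <= `|cl u - cl v|.
  have [pu <-] := psiP u; have [pv <-] := psiP v.
  wlog uv : u v pu pv / psi u <= psi v => [H|].
    case: (leP (psi u) (psi v)) => [|/ltW] uv; first exact: H.
    by rewrite distrC [leRHS]distrC; exact: H.
  have := ex (psi u) (psi v); move: pu pv => /andP[-> _] /andP[_ ->].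
  move=> /(_ isT uv isT) h; rewrite distrC [leRHS]distrC.
  by rewrite ger0_norm ?subr_ge0// (le_trans h)// ler_norm.
have clE u : f a <= u <= f b -> cl u = u.
  by move=> /andP[au ub]; rewrite /cl (min_idPr ub) (max_idPr au).
have psi_inj x u : a <= x <= b -> f x = cl u -> psi u = x.
  move=> /andP[ax xb] fx; have [/andP[au ub] fu] := psiP u.
  case: (leP x (psi u)) => [|/ltW] xu.
    by have := ex x (psi u) ax xu ub; rewrite fu fx; lra.
  by have := ex (psi u) x au xu xb; rewrite fu fx; lra.
exists psi; split.
- by move=> u; have [] := psiP u.
- move=> u ua; apply: psi_inj; first by rewrite lexx.
  by rewrite /cl (min_idPr (le_trans ua fab)) (max_idPl ua).
- move=> u bu; apply: psi_inj; first by rewrite lexx ab.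
  by rewrite /cl (min_idPl bu) (max_idPr fab).
- by move=> u /clE {2}<-; have [] := psiP u.
- move=> u v; apply: le_trans (lip u v) _.
  have uv := ler_norm (u - v); have vu := ler_norm (v - u).
  rewrite (distrC v u) in vu; rewrite /cl ler_norml.
  case: (leP (f b) u) => ?; case: (leP (f b) v) => ?; rewrite ?(max_idPr fab);
    try (case: (leP (f a) u) => ?); try (case: (leP (f a) v) => ?);
    apply/andP; split; lra.
Qed.

End OneDimensional.

(** * Area preserving skew products over a Lorenz map *)

Section FiberMass.
Variable R : realType.

Lemma is_derive_continuous (h : R -> R) (x l : R) : is_derive x 1 h l -> {for x, continuous h}.
Proof. by move=> [/derivable1_diffP dh _]; exact: differentiable_continuous. Qed.

Lemma sign_of_derivative (gx l : R -> R) :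
  {within `[-1, 1], continuous gx} ->
  {in `[-1, 1] &, injective gx} ->
  (forall y : R, -1 < y < 1 -> is_derive y 1 gx (l y)) ->
  exists2 e : R, e * e = 1 &
    (0 < e * (gx 1 - gx (-1))) /\ forall y : R, -1 < y < 1 -> `|l y| = e * l y.
Proof.
move=> cg ig dg.
have sub (y : R) : -1 < y < 1 -> y \in `[-1, 1].
  by rewrite in_itv /= => /andP[? ?]; rewrite !ltW.
have m1 : -1 \in `[-1 : R, 1] by rewrite in_itv /= lexx; lra.
have p1 : 1 \in `[-1 : R, 1] by rewrite in_itv /= lexx; lra.
have m1p1 : -1 < 1 :> R by lra.
have [inc|dec] := itv_continuous_inj_mono cg ig.
  exists 1; first by rewrite mul1r.
  split; first by rewrite mul1r subr_gt0; apply: inc.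
  move=> y y1; rewrite mul1r ger0_norm//.
  apply: (increasing_derive_ge0 y1 _ (dg y y1)) => u v u1 v1 uv.
  by apply: inc => //; exact: sub.
exists (-1); first by rewrite mulrNN mul1r.
split; first by rewrite mulN1r opprB subr_gt0; apply: dec.
move=> y y1; rewrite mulN1r -normrN ger0_norm//.
apply: (@increasing_derive_ge0 _ (fun v => - gx v) (-1) 1 y) => // [u v u1 v1 uv|].
  by rewrite ltrN2; apply: dec => //; exact: sub.
have := dg y y1; exact: is_deriveN.
Qed.

(** Invariance of the density, integrated over the fibre by the change of variable
    [gx], whose derivative has a constant sign because [gx] is injective. The image
    is shorter than the fibre because of the contraction. *)
Lemma fiber_mass (gx l A A' rho rho' : R -> R) (mu a : R) :
  mu < 1 -> 0 < a ->
  (forall y : R, -1 <= y <= 1 ->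
     has_derivative_within `[-1, 1]%classic gx y (l y) /\ `|l y| <= mu) ->
  (forall y : R, -1 <= y <= 1 -> -1 <= gx y <= 1) ->
  {in `[-1, 1] &, injective gx} ->
  (forall y : R, -2 < y < 2 -> is_derive y 1 A (rho y)) ->
  (forall y : R, -2 < y < 2 -> is_derive y 1 A' (rho' y)) ->
  (forall y : R, -1 < y < 1 -> a * `|l y| * rho' (gx y) = rho y) ->
  exists b c : R, [/\ -1 <= b, b < c, c <= 1, c - b < 2 &
    (forall y', b <= y' <= c -> exists2 y, -1 <= y <= 1 & gx y = y') /\
    A' c - A' b = (A 1 - A (-1)) / a].
Proof.
move=> mu1 a0 dgw gI ig dA dA' inv.
have dg (y : R) : -1 < y < 1 -> is_derive y 1 gx (l y).
  move=> y1; have [|h _] := dgw y; first by move/andP: y1 => [? ?]; rewrite !ltW.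
  apply: within_is_derive h; rewrite nbhsE; exists `]-1, 1[%classic.
    by split; [exact: itv_open|rewrite /= in_itv].
  by move=> u; rewrite /= !in_itv /= => /andP[? ?]; rewrite !ltW.
have m1p1 : -1 < 1 :> R by lra.
have cg : {within `[-1, 1], continuous gx}.
  apply/subspace_continuousP => y; rewrite /= in_itv /= => y1.
  by apply: (within_derivative_continuous _ (dgw y y1).1); rewrite /= in_itv.
have [e e1 [e0 eE]] := sign_of_derivative cg ig dg.
have gm : -1 <= gx (-1) <= 1 by apply: gI; rewrite lexx; lra.
have gp : -1 <= gx 1 <= 1 by apply: gI; rewrite lexx; lra.
pose k (y : R) := a * A' (gx y) - e * A y.
have dk (y : R) : y \in `]-1, 1[ -> is_derive y 1 k 0.
  rewrite in_itv /= => y1.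
  have y1' : -1 <= y <= 1 by move/andP: y1 => [? ?]; rewrite !ltW.
  have gy := gI y y1'.
  have d1 : is_derive y 1 (A' \o gx) (rho' (gx y) * l y).
    apply: is_derive1_comp; last exact: dg.
    by apply: dA'; move/andP: gy => [? ?]; apply/andP; split; lra.
  have d2 : is_derive y 1 A (rho y).
    by apply: dA; move/andP: y1 => [? ?]; apply/andP; split; lra.
  have d3 : is_derive y 1 (a *: (A' \o gx) - e *: A)
      (a *: (rho' (gx y) * l y) - e *: rho y) by exact: is_deriveB.
  apply: (@is_derive_eq _ _ _ k _ _ _ _ d3).
  rewrite /GRing.scale /= -(inv y y1) (eE y y1).
  transitivity ((1 - e * e) * (a * l y * rho' (gx y))); first by ring.
  by rewrite e1 subrr mul0r.
have ck : {within `[-1, 1], continuous k}.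
  apply/subspace_continuousP => y; rewrite /= in_itv /= => y1.
  have gy := gI y y1.
  have cA' : {for gx y, continuous A'}.
    apply: is_derive_continuous; apply: dA'.
    by move/andP: gy => [? ?]; apply/andP; split; lra.
  have cA : {for y, continuous A}.
    apply: is_derive_continuous; apply: dA.
    by move/andP: y1 => [? ?]; apply/andP; split; lra.
  have /subspace_continuousP/(_ y) := cg; rewrite /= in_itv /= => /(_ y1) cgy.
  apply: cvgB; apply: cvgMr.
    exact: (cvg_comp _ _ cgy cA').
  by apply: cvg_trans cA; apply: cvg_app; exact: cvg_within.
have [c _] := MVT m1p1 dk ck.
rewrite mul0r => /eqP; rewrite subr_eq0 => /eqP kE.
have lip : `|gx 1 - gx (-1)| < 2.
  have dg' (y : R) : y \in `]-1, 1[ -> is_derive y 1 gx (l y).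
    by rewrite in_itv /=; exact: dg.
  have [c' + ->] := MVT m1p1 dg' cg.
  rewrite in_itv /= => /andP[c'1 c'2].
  have [|_ lc] := dgw c'; first by rewrite !ltW.
  rewrite normrM (_ : 1 - -1 = 2); last by lra.
  rewrite (ger0_norm (_ : 0 <= 2))//; lra.
have ivt (y' : R) : Num.min (gx (-1)) (gx 1) <= y' <= Num.max (gx (-1)) (gx 1) ->
    exists2 y, -1 <= y <= 1 & gx y = y'.
  by move=> h; have [y] := IVT (ltW m1p1) cg h; rewrite in_itv /=; exists y.
have {}kE : a * (A' (gx 1) - A' (gx (-1))) = e * (A 1 - A (-1)).
  by move: kE; rewrite /k; lra.
have [e1'|e1'] : e = 1 \/ e = -1.
  have : (e - 1) * (e + 1) = 0 by rewrite mulrDr mulr1 mulrBl e1; ring.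
  by move/eqP; rewrite mulf_eq0 subr_eq0 addr_eq0 => /orP[]/eqP ->; [left|right].
- rewrite e1' mul1r subr_gt0 in e0.
  exists (gx (-1)), (gx 1); move/andP: gm => [-> _]; move/andP: gp => [_ ->].
  split=> //; first exact: le_lt_trans (ler_norm _) lip.
  split; first by rewrite (min_idPl (ltW e0)) (max_idPr (ltW e0)) in ivt.
  have -> : A 1 - A (-1) = a * (A' (gx 1) - A' (gx (-1))).
    by rewrite kE e1' mul1r.
  field; exact: lt0r_neq0.
- rewrite e1' mulN1r opprB subr_gt0 in e0.
  exists (gx 1), (gx (-1)); move/andP: gm => [_ ->]; move/andP: gp => [-> _].
  split=> //; first by rewrite distrC in lip; exact: le_lt_trans (ler_norm _) lip.
  split; first by rewrite (min_idPr (ltW e0)) (max_idPl (ltW e0)) in ivt.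
  have -> : A 1 - A (-1) = a * (A' (gx (-1)) - A' (gx 1)).
    by move: kE; rewrite e1'; lra.
  field; exact: lt0r_neq0.
Qed.

End FiberMass.

Section BranchMass.
Variable R : realType.

Lemma mass_continuous (rho A : R -> R -> R) :
  continuous (fun z : R * R => rho z.1 z.2) ->
  (forall x y : R, -2 < y < 2 -> is_derive y 1 (A x) (rho x y)) ->
  continuous (fun x => A x 1 - A x (-1)).
Proof.
move=> crho dA x; apply/cvgrPdist_le => e e0.
have e4 : 0 < e / 4 by rewrite divr_gt0.
have cK := @segment_compact R (-1) 1.
have /compact_near_coveringP cov := cK.
have : \forall x' \near x, `[-1, 1]%classic `<=`
    [set y | `|rho x' y - rho x y| <= e / 2].
  apply: (cov _ (nbhs x) (fun x' y => `|rho x' y - rho x y| <= e / 2)) => y _.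
  have := crho (x, y); move=> /cvgrPdist_lt/(_ _ e4) /= h.
  have [d d0 dP] := near_prod_dist (P := fun x' y' => `|rho x y - rho x' y'| < e / 4) h.
  exists ([set y' | `|y' - y| < d], [set x' | `|x' - x| < d]).
    by split; exact: (@near_dist_lt R R^o).
  move=> [y' x'] /= [y'd x'd].
  have h1 := dP x' y' x'd y'd.
  have h2 := dP x y' _ y'd; rewrite subrr normr0 in h2.
  rewrite -(subrKA (rho x y)) (le_trans (ler_normD _ _))//.
  by have := h2 d0; rewrite distrC in h1; lra.
apply: filterS => x' x'P.
have := @mean_value_inequality_real R (fun y => A x y - A x' y)
  (fun y => rho x y - rho x' y) (-1) 1 (e / 2).
have m11 : -1 <= 1 :> R by lra.
rewrite (min_idPl m11) (max_idPr m11) => h.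
have -> : A x 1 - A x (-1) - (A x' 1 - A x' (-1)) =
   A x 1 - A x' 1 - (A x (-1) - A x' (-1)) by ring.
apply: le_trans (h _ _ _) _.
- by rewrite divr_ge0// ltW.
- move=> y /andP[y1 y2]; apply: is_deriveB; apply: dA; apply/andP; split; lra.
- by move=> y y1; rewrite distrC; apply: x'P => /=; rewrite in_itv.
- by rewrite (_ : 1 - -1 = 2) ?ger0_norm//; lra.
Qed.

Lemma antiderivative_lt (A rho : R -> R) (b c : R) :
  (forall y : R, -2 < y < 2 -> is_derive y 1 A (rho y)) -> (forall y, 0 < rho y) ->
  -1 <= b -> b < c -> c <= 1 -> A b < A c.
Proof.
move=> dA rho0 b1 bc c1.
apply: (derive_gt0_lt_off_finite (E := [::]) bc).
  apply: derivable_within_continuous => y; rewrite in_itv /= => /andP[by_ yc].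
  have [] := dA y; first by apply/andP; split; lra.
  by [].
move=> y /andP[by_ yc] _; exists (rho y) => //.
by apply: dA; apply/andP; split; lra.
Qed.

(** Here [A u] is an antiderivative of the density on the fibre over [u], so that
    [q] is the mass of the image in that fibre of the fibre over a point of [I]. The
    bound on the length is all that remains of the contraction. *)
Definition covered_mass (f : R -> R) (g A : R -> R -> R) (I : interval R) (u q : R) :=
  exists x b c : R, [/\ x \in I, f x = u &
    [/\ -1 <= b, b < c, c <= 1, c - b < 2 &
    (forall y', b <= y' <= c -> exists2 y, -1 <= y <= 1 & g x y = y') /\
    q = A u c - A u b]].

(** [Q u] is the mass to the left of the fibre over the preimage of [u]. Since the
    branch is expanding it is continuous even at the ends of the image, where it
    becomes constant, and its derivative is the mass of the image of that fibre. *)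
Lemma branch_mass (fh f' : R -> R) (g A : R -> R -> R) (r Rm : R -> R) (a b : R) :
  a < b -> -1 <= a -> b <= 1 ->
  {within `[a, b], continuous fh} ->
  (forall x : R, a < x < b -> is_derive x 1 fh (f' x) /\ 1 <= f' x) ->
  (forall x : R, -2 < x < 2 -> is_derive x 1 Rm (r x)) ->
  (forall x, a < x < b -> covered_mass fh g A `]a, b[ (fh x) (r x / f' x)) ->
  exists Q : R -> R, [/\ continuous Q,
    forall u : R, u <= fh a -> Q u = Rm a,
    forall u : R, fh b <= u -> Q u = Rm b &
    forall u : R, u != fh a -> u != fh b -> exists2 q, is_derive u 1 Q q &
      q = 0 \/ covered_mass fh g A `]a, b[ u q].
Proof.
move=> ab a1 b1 cf df dRm cov.
have ex x y : a <= x -> x <= y -> y <= b -> y - x <= fh y - fh x.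
  move=> ax xy yb.
  have [->|xy'] := eqVneq x y; first by rewrite !subrr.
  have {}xy' : x < y by rewrite lt_neqAle xy'.
  have dxy (z : R) : z \in `]x, y[ -> is_derive z 1 fh (f' z) /\ 1 <= f' z.
    rewrite in_itv /= => /andP[xz zy].
    by apply: df; apply/andP; split; lra.
  have cxy : {within `[x, y], continuous fh}.
    apply: continuous_subspaceW cf => z /=; rewrite !in_itv /= => /andP[? ?].
    by apply/andP; split; lra.
  have [c cI ->] := MVT xy' (fun z zI => (dxy z zI).1) cxy.
  by rewrite ler_peMl ?subr_ge0//; exact: (dxy c cI).2.
have [psi [psiI psia psib psiK psiL]] := expanding_inverse (ltW ab) cf ex.
have Rc x : a <= x <= b -> {for x, continuous Rm}.
  move=> /andP[ax xb]; apply: (@is_derive_continuous _ _ _ (r x)).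
  by apply: dRm; apply/andP; split; lra.
have psic : continuous psi.
  move=> u; apply/cvgrPdist_le => e e0.
  apply: filterS (@near_dist_lt R R^o u _ e0) => v uv.
  by apply: le_trans (psiL u v) _; rewrite distrC ltW.
exists (Rm \o psi); split.
- by move=> u; apply: continuous_comp; [exact: psic|exact: Rc].
- by move=> u /psia /= ->.
- by move=> u /psib /= ->.
move=> u ua ub.
case: (ltgtP u (fh a)) ua => // [ua|ua] _.
  exists 0; last by left.
  apply: (@near_eq_is_derive _ _ _ (cst (Rm a))).
  have : \forall v \near u, v < fh a by exact: lt_nbhsl.
  by apply: filterS => v va; rewrite /= psia// ltW.
case: (ltgtP u (fh b)) ub => // [ub|ub] _; last first.
  exists 0; last by left.
  apply: (@near_eq_is_derive _ _ _ (cst (Rm b))).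
  have : \forall v \near u, fh b < v by exact: lt_nbhsr.
  by apply: filterS => v va; rewrite /= psib// ltW.
have fu : fh (psi u) = u by apply: psiK; rewrite !ltW.
set x := psi u in fu.
have xab : a < x < b.
  have /andP[ax xb] := psiI u.
  rewrite !lt_neqAle ax xb !andbT; apply/andP; split; apply/eqP => E.
    by move: ua; rewrite -fu -E ltxx.
  by move: ub; rewrite -fu -/x E ltxx.
have near_x : \forall y \near x, a < y < b.
  have : \forall y \near x, y \in `]a, b[.
    by apply: near_in_itvoo; rewrite in_itv.
  by apply: filterS => y; rewrite in_itv.
exists (r x / f' x); last by right; rewrite -fu; exact: cov.
apply: is_derive1_comp.
  by apply: (dRm x); move/andP: xab => [? ?]; apply/andP; split; lra.
have [dfx f'1] := df x xab.
rewrite -fu; apply: is_derive_inverse dfx _; last by rewrite gt_eqF// (lt_le_trans ltr01).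
  apply: filterS near_x => y /andP[ay yb].
  have /andP[ap pb] := psiI (fh y).
  have fy : fh (psi (fh y)) = fh y.
    have := ex a y (lexx _) (ltW ay) (ltW yb); have := ex y b (ltW ay) (ltW yb) (lexx _).
    by move=> h1 h2; apply: psiK; apply/andP; split; lra.
  case: (leP (psi (fh y)) y) => [|/ltW] h.
    by have := ex _ _ ap h (ltW yb); rewrite fy; lra.
  by have := ex _ _ (ltW ay) h pb; rewrite fy; lra.
apply: filterS near_x => y /df[dfy _]; exact: is_derive_continuous dfy.
Qed.

End BranchMass.

Section NoAreaPreservingMap.
Variable R : realType.

Lemma strict_interior (gx : R -> R) :
  {within `[-1, 1], continuous gx} -> {in `[-1, 1] &, injective gx} ->
  (forall y : R, -1 <= y <= 1 -> -1 <= gx y <= 1) ->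
  forall y : R, -1 < y < 1 -> -1 < gx y < 1.
Proof.
move=> cg ig gI y /andP[y1 y2].
have m1 : -1 \in `[-1 : R, 1] by rewrite in_itv /= lexx; lra.
have p1 : 1 \in `[-1 : R, 1] by rewrite in_itv /= lexx; lra.
have yI : y \in `[-1, 1] by rewrite in_itv /= !ltW.
have /andP[gm gm'] : -1 <= gx (-1) <= 1 by apply: gI; rewrite lexx; lra.
have /andP[gp gp'] : -1 <= gx 1 <= 1 by apply: gI; rewrite lexx; lra.
have [inc|dec] := itv_continuous_inj_mono cg ig.
  by rewrite (le_lt_trans gm (inc _ _ m1 yI y1)) (lt_le_trans (inc _ _ yI p1 y2) gp').
by rewrite (le_lt_trans gp (dec _ _ p1 yI y2)) (lt_le_trans (dec _ _ yI m1 y1) gm').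
Qed.

Lemma punctured_near (x : R) : -1 < x < 1 -> x != 0 -> nbhs x (@punctured R).
Proof.
move=> x1 x0.
have h1 : \forall y \near x, y \in `]-1, 1[ by apply: near_in_itvoo; rewrite in_itv.
have x0' : 0 < `|x| by rewrite normr_gt0.
have h2 := @near_dist_lt R R^o x _ x0'.
apply: filterS2 h1 h2 => y; rewrite in_itv /= => /andP[y1 y2] yx.
split; first by rewrite !ltW.
by apply/eqP => y0; move: yx; rewrite y0 sub0r normrN ltxx.
Qed.

(** A single image leaves a gap because it is shorter than the fibre. *)
Lemma covered_mass_lt (f : R -> R) (g A : R -> R -> R) (I : interval R) (u q : R) :
  (forall b d, -1 <= b -> b < d -> d <= 1 -> A u b < A u d) ->
  covered_mass f g A I u q -> q < A u 1 - A u (-1).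
Proof.
move=> Alt [x [b [d [_ _ [b1 bd d1 db [_ ->]]]]]].
have Ale v w : -1 <= v -> v <= w -> w <= 1 -> A u v <= A u w.
  move=> v1 vw w1; have [->//|vw'] := eqVneq v w.
  by apply: ltW; apply: Alt => //; rewrite lt_neqAle vw'.
have h1 := Ale (-1) b (lexx _) b1 (le_trans (ltW bd) d1).
have h2 := Ale d 1 (le_trans b1 (ltW bd)) d1 (lexx _).
have [b'1|b'1] := ltP (-1) b.
  by have := Alt _ _ (lexx _) b'1 (le_trans (ltW bd) d1); lra.
have d'1 : d < 1 by lra.
by have := Alt _ _ (le_trans b1 (ltW bd)) d'1 (lexx _); lra.
Qed.

(** Two disjoint closed intervals leave a gap in the fibre, by connectedness. *)
Lemma covered_mass_two (f : R -> R) (g A : R -> R -> R) (I I' : interval R) (u q q' : R) :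
  (forall b d, -1 <= b -> b < d -> d <= 1 -> A u b < A u d) ->
  (forall x x' y y', x \in I -> x' \in I' -> -1 <= y <= 1 -> -1 <= y' <= 1 ->
    f x = f x' -> g x y = g x' y' -> False) ->
  covered_mass f g A I u q -> covered_mass f g A I' u q' ->
  q + q' < A u 1 - A u (-1).
Proof.
move=> Alt inj [x [b [d [xI fx [b1 bd d1 _ [cov ->]]]]]].
move=> [x' [b' [d' [xI' fx' [b1' bd' d1' _ [cov' ->]]]]]].
have Ale v w : -1 <= v -> v <= w -> w <= 1 -> A u v <= A u w.
  move=> v1 vw w1; have [->//|vw'] := eqVneq v w.
  by apply: ltW; apply: Alt => //; rewrite lt_neqAle vw'.
have disj y : b <= y <= d -> b' <= y <= d' -> False.
  move=> /cov[y1 y1I gy1] /cov'[y2 y2I gy2].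
  by apply: (inj x x' y1 y2) => //; [rewrite fx fx'|rewrite gy1 gy2].
have [lt_db'|le_b'd] := ltP d b'.
  have h1 := Ale (-1) b (lexx _) b1 (le_trans (ltW bd) d1).
  have h2 := Alt d b' (le_trans b1 (ltW bd)) lt_db' (le_trans (ltW bd') d1').
  have h3 := Ale d' 1 (le_trans b1' (ltW bd')) d1' (lexx _).
  by clear -h1 h2 h3; lra.
have d'b : d' < b.
  rewrite ltNge; apply/negP => le_bd'; have [bb'|/ltW b'b] := leP b b'.
    by apply: (disj b'); rewrite ?bb' ?le_b'd ?lexx ?(ltW bd').
  by apply: (disj b); rewrite ?b'b ?le_bd' ?lexx ?(ltW bd).
have h1 := Ale (-1) b' (lexx _) b1' (le_trans (ltW bd') d1').
have h2 := Alt d' b (le_trans b1' (ltW bd')) d'b (le_trans (ltW bd) d1).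
have h3 := Ale d 1 (le_trans b1 (ltW bd)) d1 (lexx _).
by clear -h1 h2 h3; lra.
Qed.

(** Over almost every point [u] of the base, the mass of the fibre exceeds the
    masses of the images lying in it, of which there are at most two. Integrated
    over the base, the left side is the total mass and the right side, by invariance
    of the density, is the total mass again. The integration is replaced by the
    monotonicity of the difference [h] of antiderivatives. *)
Theorem no_area_preserving_lorenz_map (rho : R -> R -> R) (f : R -> R) (g : R -> R -> R) :
  (forall x y, 0 < rho x y) -> continuous (fun z : R * R => rho z.1 z.2) ->
  lorenz_one_dim f -> fiber_contracting g ->
  (forall x y, @punctured R x -> -1 <= y <= 1 -> -1 <= g x y <= 1) ->
  (forall x x' y y', @punctured R x -> @punctured R x' -> -1 <= y <= 1 ->
    -1 <= y' <= 1 -> f x = f x' -> g x y = g x' y' -> x = x' /\ y = y') ->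
  (forall x y a l : R, -1 < x < 1 -> x != 0 -> -1 < y < 1 -> -1 < f x < 1 ->
    -1 < g x y < 1 -> is_derive x 1 f a -> is_derive y 1 (g x) l ->
    `|a| * `|l| * rho (f x) (g x y) = rho x y) ->
  False.
Proof.
move=> rho0 crho [fI [f' [[df _] [c c2 cf']]] [fm [fp [fmP fpP fm0 fp0]]]] [mu mu1 dg].
move=> gI inj inv.
have c1 : 1 <= c.
  apply: le_trans (ltW c2); have := @ler_wsqrtr R 1 2; rewrite sqrtr1; apply; lra.
have [A dA] : exists A : R -> R -> R, forall x y : R, -2 < y < 2 ->
    is_derive y 1 (A x) (rho x y).
  have /choice[A AP] : forall x, exists A : R -> R, forall y : R, -2 < y < 2 ->
      is_derive y 1 A (rho x y).
    move=> x; apply: antiderivative => y.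
    have h := crho (x, y); move=> P /h[[U V] /= [Ux Vy] UV].
    by apply: filterS Vy => y' Vy'; apply: (UV (x, y')); split=> //=; exact: nbhs_singleton.
  by exists A.
pose r x := A x 1 - A x (-1).
have rc : continuous r by exact: mass_continuous dA.
have [Rm dRm] := antiderivative rc.
have Alt u b d : -1 <= b -> b < d -> d <= 1 -> A u b < A u d.
  exact: (antiderivative_lt (dA u) (rho0 u)).
have [l lP] : exists l : R * R -> R, forall z : R * R, @punctured R z.1 -> -1 <= z.2 <= 1 ->
    has_derivative_within `[-1, 1]%classic (g z.1) z.2 (l z) /\ `|l z| <= mu.
  have /choice[l lP] : forall z : R * R, exists l : R,
      @punctured R z.1 -> -1 <= z.2 <= 1 ->
      has_derivative_within `[-1, 1]%classic (g z.1) z.2 l /\ `|l| <= mu.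
    move=> z.
    have [zP|] := pselect (@punctured R z.1 /\ -1 <= z.2 <= 1); last first.
      by move=> nz; exists 0 => ? ?; case: nz.
    by have [l ? ?] := dg _ _ zP.1 zP.2; exists l.
  by exists l.
have dfx (x : R) : -1 < x < 1 -> x != 0 -> is_derive x 1 f (f' x) /\ 1 <= f' x.
  move=> x1 x0; have px := punctured_near x1 x0; split.
    exact: (within_is_derive px (df x (nbhs_singleton px))).
  exact: (le_trans c1 (cf' x (nbhs_singleton px))).
have fiber (x : R) : -1 < x < 1 -> x != 0 -> -1 < f x < 1 ->
    exists b d : R, [/\ -1 <= b, b < d, d <= 1, d - b < 2 &
    (forall y', b <= y' <= d -> exists2 y, -1 <= y <= 1 & g x y = y') /\
    r x / f' x = A (f x) d - A (f x) b].
  move=> x1 x0 fx1; have px : @punctured R x := nbhs_singleton (punctured_near x1 x0).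
  have [dx f1] := dfx x x1 x0.
  have f0 : 0 < f' x by exact: lt_le_trans ltr01 f1.
  have ig : {in `[-1, 1] &, injective (g x)}.
    move=> y y'; rewrite !in_itv /= => y1 y'1 gy.
    by have [] := inj x x y y' px px y1 y'1 erefl gy.
  have cg : {within `[-1, 1], continuous (g x)}.
    apply/subspace_continuousP => y; rewrite /= in_itv /= => y1.
    by apply: (within_derivative_continuous _ (lP (x, y) px y1).1); rewrite /= in_itv.
  have [|b [d [? ? ? ? [? E]]]] := @fiber_mass R (g x) (fun y => l (x, y)) (A x) (A (f x))
    (rho x) (rho (f x)) mu (f' x) mu1 f0 (fun y y1 => lP (x, y) px y1)
    (fun y => gI x y px) ig (dA x) (dA (f x)).
    move=> y y1; rewrite -(gtr0_norm f0); apply: inv => //.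
      exact: (strict_interior cg ig (fun y => gI x y px)).
    apply: within_is_derive (lP (x, y) px _).1; last by move/andP: y1 => [? ?]; rewrite !ltW.
    rewrite nbhsE; exists `]-1, 1[%classic.
      by split; [exact: itv_open|rewrite /= in_itv].
    by move=> u; rewrite /= !in_itv /= => /andP[? ?]; rewrite !ltW.
  by exists b, d; split.
have branch (a b : R) (fh : R -> R) : a < b -> -1 <= a -> b <= 1 ->
    (forall x, a < x < b -> x != 0) -> {within `[a, b], continuous fh} ->
    (forall x, a < x < b -> fh x = f x) -> -1 <= fh a -> fh b <= 1 ->
    exists Q : R -> R, [/\ continuous Q,
    forall u, u <= fh a -> Q u = Rm a,
    forall u, fh b <= u -> Q u = Rm b &
    forall u, u != fh a -> u != fh b -> exists2 q, is_derive u 1 Q q &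
      q = 0 \/ covered_mass f g A `]a, b[ u q].
  move=> ab a1 b1 n0 cfh fhE fha fhb.
  have I1 (x : R) : a < x < b -> -1 < x < 1.
    by move=> /andP[? ?]; apply/andP; split; lra.
  have dfh (x : R) : a < x < b -> is_derive x 1 fh (f' x) /\ 1 <= f' x.
    move=> xab; have [dx f1] := dfx x (I1 x xab) (n0 x xab); split=> //.
    apply: near_eq_is_derive dx.
    have : \forall y \near x, y \in `]a, b[ by apply: near_in_itvoo; rewrite in_itv.
    by apply: filterS => y; rewrite in_itv /= => /fhE ->.
  have mono (x y : R) : a <= x -> x < y -> y <= b -> fh x < fh y.
    move=> ax xy yb; apply: (derive_gt0_lt_off_finite (E := [::]) xy).
      apply: continuous_subspaceW cfh => z /=; rewrite !in_itv /= => /andP[? ?].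
      by apply/andP; split; lra.
    move=> z /andP[xz zy] _; have [|dz f1] := dfh z; first by apply/andP; split; lra.
    by exists (f' z) => //; exact: lt_le_trans ltr01 f1.
  have cov (x : R) : a < x < b -> covered_mass fh g A `]a, b[ (fh x) (r x / f' x).
    move=> xab; have [ax xb] := andP xab.
    have fx1 : -1 < f x < 1.
      rewrite -(fhE x xab) (le_lt_trans fha (mono _ _ (lexx _) ax (ltW xb))).
      by rewrite (lt_le_trans (mono _ _ (ltW ax) xb (lexx _)) fhb).
    have [b' [d' H]] := fiber x (I1 x xab) (n0 x xab) fx1.
    by exists x, b', d'; split; rewrite ?in_itv// fhE.
  have [Q [cQ Qa Qb dQ]] := branch_mass ab a1 b1 cfh dfh dRm cov.
  exists Q; split => // u ua ub.
  have [q dq [q0|[x [b' [d' [xI fx H]]]]]] := dQ u ua ub.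
    by exists q => //; left.
  have xab : a < x < b by rewrite in_itv in xI.
  by exists q => //; right; exists x, b', d'; split=> //; rewrite -(fhE x xab).
(* Completed at [0] by its one-sided limit, each branch is continuous on a closed
   interval. *)
pose f1 (x : R) := if x < 0 then f x else fm.
pose f2 (x : R) := if 0 < x then f x else fp.
have f10 : f1 0 = fm by rewrite /f1 ltxx.
have f20 : f2 0 = fp by rewrite /f2 ltxx.
have m0 : -1 < 0 :> R by lra.
have p0 : 0 < 1 :> R by lra.
have f1E (x : R) : x < 0 -> f1 x = f x by rewrite /f1 => ->.
have f2E (x : R) : 0 < x -> f2 x = f x by rewrite /f2 => ->.
have pm1 : @punctured R (-1) by split; [rewrite lexx; lra|rewrite lt_eqF].
have pp1 : @punctured R 1 by split; [rewrite lexx; lra|rewrite gt_eqF].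
have fc (x : R) : -1 < x < 1 -> x != 0 -> {for x, continuous f}.
  by move=> x1 x0; have [dx _] := dfx x x1 x0; exact: is_derive_continuous dx.
have near_lt0 (x : R) : x < 0 -> \forall y \near x, f y = f1 y.
  by move=> x0; apply: filterS (lt_nbhsl x0) => y /f1E.
have near_gt0 (x : R) : 0 < x -> \forall y \near x, f y = f2 y.
  by move=> x0; apply: filterS (lt_nbhsr x0) => y /f2E.
have cf1 : {within `[-1, 0], continuous f1}.
  apply/(continuous_within_itvP _ m0); split.
  - move=> x; rewrite in_itv /= => /andP[x1 x0].
    rewrite /continuous_at f1E//; apply: cvg_trans (fc x _ _); last 2 first.
      by rewrite x1 (lt_trans x0).
      by rewrite lt_eqF.
    by apply: near_eq_cvg; apply: filterS (near_lt0 x x0) => y ->.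
  - rewrite f1E//.
    have h := within_derivative_continuous pm1 (df _ pm1).
    move=> P /h hP; apply: filterS2 (hP : nbhs (-1 : R) _) (lt_nbhsl m0).
    move=> y yP y0 /= y1; rewrite /= f1E//; apply: yP; split.
      by rewrite (ltW y1) (le_trans (ltW y0)) ?ler01.
    by rewrite lt_eqF.
  - rewrite f10; apply: cvg_trans fmP; apply: near_eq_cvg.
    by apply: filterS (nbhs_left_lt (0 : R)) => y /f1E ->.
have cf2 : {within `[0, 1], continuous f2}.
  apply/(continuous_within_itvP _ p0); split.
  - move=> x; rewrite in_itv /= => /andP[x0 x1].
    rewrite /continuous_at f2E//; apply: cvg_trans (fc x _ _); last 2 first.
      by rewrite x1 (lt_trans _ x0).
      by rewrite gt_eqF.
    by apply: near_eq_cvg; apply: filterS (near_gt0 x x0) => y ->.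
  - rewrite f20; apply: cvg_trans fpP; apply: near_eq_cvg.
    by apply: filterS (nbhs_right_gt (0 : R)) => y /f2E ->.
  - rewrite f2E//.
    have h := within_derivative_continuous pp1 (df _ pp1).
    move=> P /h hP; apply: filterS2 (hP : nbhs (1 : R) _) (lt_nbhsr p0).
    move=> y yP y0 /= y1; rewrite /= f2E//; apply: yP; split.
      by rewrite (ltW y1) andbT (le_trans _ (ltW y0)) ?lerN10.
    by rewrite gt_eqF.
have fm1 : fm <= 1.
  apply: (cvgr_to_le fmP).
  apply: filterS2 (nbhs_left_gt m0) (nbhs_left_lt (0 : R)) => x x1 x0.
  have /andP[//] : -1 <= f x <= 1.
  by apply: fI; split; [rewrite (ltW x1) (le_trans (ltW x0))|rewrite lt_eqF].
have fp1 : -1 <= fp.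
  apply: (cvgr_to_ge fpP).
  apply: filterS2 (nbhs_right_lt p0) (nbhs_right_gt (0 : R)) => x x1 x0.
  have /andP[//] : -1 <= f x <= 1.
  by apply: fI; split; [rewrite (ltW x1) andbT (le_trans _ (ltW x0))|rewrite gt_eqF].
have [||||Q1 [cQ1 Q1a Q1b dQ1]] := branch (-1) 0 f1 m0 (lexx _) (ltW p0) _ cf1.
- by move=> x /andP[_ x0]; rewrite lt_eqF.
- by move=> x /andP[_ x0]; exact: f1E.
- by rewrite f1E//; have /andP[] := fI _ pm1.
- by rewrite f10.
have [||||Q2 [cQ2 Q2a Q2b dQ2]] := branch 0 1 f2 p0 (ltW m0) (lexx _) _ cf2.
- by move=> x /andP[x0 _]; rewrite gt_eqF.
- by move=> x /andP[x0 _]; exact: f2E.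
- by rewrite f20.
- by rewrite f2E//; have /andP[] := fI _ pp1.
have m1p1 : -1 < 1 :> R by lra.
pose h u := Rm u - Q1 u - Q2 u.
have ch : {within `[-1, 1], continuous h}.
  have cRm : {within `[-1, 1], continuous Rm}.
    apply: derivable_within_continuous => y; rewrite in_itv /= => /andP[y1 y2].
    by have [] := dRm y; first by apply/andP; split; lra.
  move=> x; apply: cvgB; last exact: continuous_subspaceT.
  by apply: cvgB; [exact: cRm|exact: continuous_subspaceT].
have : h (-1) < h 1.
  apply: (derive_gt0_lt_off_finite (E := [:: f1 (-1); f1 0; f2 0; f2 1]) m1p1 ch).
  move=> u /andP[u1 u2]; rewrite !inE !negb_or => /and4P[e1 e2 e3 e4].
  have [q1 dq1 q1P] := dQ1 u e1 e2; have [q2 dq2 q2P] := dQ2 u e3 e4.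
  exists (r u - q1 - q2); last first.
    have du : is_derive u 1 Rm (r u) by apply: dRm; apply/andP; split; lra.
    exact: (is_deriveB (is_deriveB du dq1) dq2).
  rewrite /r; case: q1P => [->|m1]; case: q2P => [->|m2].
  - by rewrite !subr0 subr_gt0; apply: Alt.
  - by rewrite subr0 subr_gt0; exact: (covered_mass_lt (Alt u) m2).
  - by rewrite subr0 subr_gt0; exact: (covered_mass_lt (Alt u) m1).
  rewrite -addrA -opprD subr_gt0; apply: (covered_mass_two (Alt u) _ m1 m2).
  move=> x x' y y'; rewrite !in_itv /= => /andP[x1 x0] /andP[x'0 x'1].
  move=> y1 y'1 fxx' gyy'.
  have [||xE _] := inj x x' y y' _ _ y1 y'1 fxx' gyy'.
  - by split; [rewrite (ltW x1) (le_trans (ltW x0))|rewrite lt_eqF].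
  - by split; [rewrite (ltW x'1) andbT (le_trans _ (ltW x'0))|rewrite gt_eqF].
  by have := lt_trans x0 x'0; rewrite xE ltxx.
(* The two masses add up to the total mass, so [h] takes the value [- Rm 0] at both
   ends: at [-1] because [Q2] starts from [Rm 0], at [1] because [Q1] ends there. *)
have fI1 : -1 <= f1 (-1) by rewrite f1E//; have /andP[] := fI _ pm1.
have fI2 : f2 1 <= 1 by rewrite f2E//; have /andP[] := fI _ pp1.
rewrite /h Q1a// Q2a ?f20// Q1b ?f10// Q2b//; lra.
Qed.

End NoAreaPreservingMap.

(** * Absence of geometric Lorenz sets *)

Section SectionFlux.
Variable R : realType.
Variables (M : manifold3 R) (m : volume M) (X : vfield M).
Hypothesis conservativeX : conservative_C1 m X.
Variable Phi : R -> M -> M.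
Hypothesis flowPhi : is_flow X Phi.
Variable s : R^o * R^o -> M.
Hypothesis sectionS : cross_section X s.

Local Notation cm i := (cmap (mchart i) : M -> 'rV[R]_3).
Local Notation X_ i := (vrep X i).
Local Notation rho i := (vdens m i).
Local Notation d1 j w := ('D_((1, 0) : R^o * R^o) (cmap (mchart j) \o s) w).
Local Notation d2 j w := ('D_((0, 1) : R^o * R^o) (cmap (mchart j) \o s) w).
Local Notation S := (s @` @square R).

Lemma triple_cvg (T : Type) (F : set_system T) (FF : Filter F) (a b c : T -> 'rV[R]_3)
    (la lb lc : 'rV[R]_3) :
  a @ F --> la -> b @ F --> lb -> c @ F --> lc ->
  (fun t => triple (a t) (b t) (c t)) @ F --> triple la lb lc.
Proof.
move=> ha hb hc.
have co (v : T -> 'rV[R]_3) (l : 'rV[R]_3) k : v @ F --> l -> (fun t => v t 0 k) @ F --> l 0 k.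
  move=> vl; exact: (@cvg_comp _ _ _ v (fun N : 'rV[R]_3 => N 0 k) F (nbhs l)
    (nbhs (l 0 k)) vl (@coord_continuous _ _ _ 0 k l)).
pose A k := co a la k ha; pose B k := co b lb k hb; pose C k := co c lc k hc.
exact: (cvgD (cvgB (cvgM (A _) (cvgB (cvgM (B _) (C _)) (cvgM (B _) (C _))))
  (cvgM (A _) (cvgB (cvgM (B _) (C _)) (cvgM (B _) (C _)))))
  (cvgM (A _) (cvgB (cvgM (B _) (C _)) (cvgM (B _) (C _))))).
Qed.

Lemma chart_flux_continuous j w : square w -> cdom (mchart j) (s w) ->
  {for w, continuous (chart_flux m X s j)}.
Proof.
move=> sw jw.
have [U [Uo Uw kU]] := section_domain sectionS sw jw.
have jx : cimg (mchart j) (cm j (s w)) by exists (s w).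
have cs : (cm j \o s) @ w --> cm j (s w).
  exact: (cvg_comp _ _ (section_continuous sectionS sw) (chart_continuous jw)).
have crho : (fun z => rho j (cm j (s z))) @ w --> rho j (cm j (s w)).
  apply: (cvg_comp _ _ cs); have [+ _] := density_C1 m j.
  by move=> /(_ _ jx).
have cX : (fun z => X_ j (cm j (s z))) @ w --> X_ j (cm j (s w)).
  apply: (cvg_comp _ _ cs); have [+ _] := vfield_C1 conservativeX j.
  by move=> /(_ _ jx).
apply: cvgM; first exact: crho.
apply: cvg_norm; apply: triple_cvg => //.
- exact: (Ck1_near _ Uo kU Uw).2.
- exact: (Ck1_near _ Uo kU Uw).2.
Qed.

Lemma chart_flux_gt0 j w : square w -> cdom (mchart j) (s w) ->
  0 < chart_flux m X s j w.
Proof.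
move=> sw jw; have [_ _ rf] := sectionS.
apply: mulr_gt0; first by apply: vdens_gt0; exists (s w).
by rewrite normr_gt0 -triple_row_free; exact: rf.
Qed.

(** By [chart_flux_eq] the choice of the chart is immaterial. *)
Definition section_flux (z : R^o * R^o) : R :=
  chart_flux m X s (projT1 (cid (mcover (s z)))) z.

Lemma section_fluxE j z : square z -> cdom (mchart j) (s z) ->
  section_flux z = chart_flux m X s j z.
Proof.
move=> sz jz; rewrite /section_flux; case: cid => i iz /=.
exact: (chart_flux_eq m flowPhi sectionS).
Qed.

(** Freezing the coordinates outside the square extends the flux density to a
    continuous positive function on the plane. *)
Definition clamp (x : R) : R := Num.max (-1) (Num.min 1 x).

Lemma clamp_square x y : square (clamp x, clamp y).
Proof.
have h a : -1 <= clamp a <= 1.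
  by rewrite le_max lexx ge_max ge_min lexx andbT /=; lra.
by split; exact: h.
Qed.

Lemma clamp_id x : -1 <= x <= 1 -> clamp x = x.
Proof. by move=> /andP[x1 x2]; rewrite /clamp (min_idPr x2) (max_idPr x1). Qed.

Lemma clamp_continuous : continuous clamp.
Proof.
move=> x; apply: (@continuous_max R R (cst (-1)) (fun x => Num.min 1 x)).
  exact: cvg_cst.
by apply: (@continuous_min R R (cst 1) id); [exact: cvg_cst|exact: cvg_id].
Qed.

Lemma section_flux_continuous :
  continuous (fun z : R * R => section_flux (clamp z.1, clamp z.2)).
Proof.
move=> z; pose w : R^o * R^o := (clamp z.1, clamp z.2).
have sw : square w by exact: clamp_square.
have [j jw] := mcover (s w).
have cc : (fun z : R * R => (clamp z.1, clamp z.2) : R^o * R^o) @ z --> w.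
  move=> P [[A B] /= [Az Bz] AB].
  exists (clamp @^-1` A, clamp @^-1` B); first by split; exact: clamp_continuous.
  by move=> [x y] /= [Ax By]; exact: (AB (clamp x, clamp y)).
rewrite /continuous_at -/w (section_fluxE sw jw).
have h : (fun z : R * R => chart_flux m X s j (clamp z.1, clamp z.2)) @ z -->
    chart_flux m X s j w.
  exact: (cvg_comp _ _ cc (chart_flux_continuous sw jw)).
apply: cvg_trans h; apply: near_eq_cvg.
have : \forall z' \near z, cdom (mchart j) (s (clamp z'.1, clamp z'.2)).
  by apply: (cvg_comp _ _ cc (section_continuous sectionS sw)); exact: near_cdom.
by apply: filterS => z' jz'; rewrite (section_fluxE _ jz')//; exact: clamp_square.
Qed.

Variables (f : R -> R) (g : R -> R -> R).
Hypothesis returnF : forall z, square z -> z.1 != 0 ->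
  square (lorenz_map f g z) /\ first_return Phi S (s z) (s (lorenz_map f g z)).

(** Two orbits entering the section at the same point coincide in the past, so
    the later of the two starting points would be an earlier return. *)
Lemma return_injective z z' : square z -> z.1 != 0 -> square z' -> z'.1 != 0 ->
  lorenz_map f g z = lorenz_map f g z' -> z = z'.
Proof.
have key z1 z2 t1 t2 : square z1 -> square z2 -> 0 < t1 -> 0 < t2 -> t1 <= t2 ->
    Phi t1 (s z1) = Phi t2 (s z2) ->
    (forall r, 0 < r < t2 -> ~ S (Phi r (s z2))) -> z1 = z2.
  move=> sz1 sz2 t1p t2p t12 E first.
  have E' : s z1 = Phi (t2 - t1) (s z2).
    by rewrite addrC (flowD flowPhi) -E (flowK flowPhi).
  have [tE|tn] := eqVneq t1 t2.
    apply: (section_inj sectionS) => //.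
    by rewrite E' tE subrr (flow0 flowPhi).
  exfalso; apply: (first (t2 - t1)); last by exists z1.
  by rewrite subr_gt0 lt_neqAle tn t12 /= ltrBlDr ltrDl.
move=> sz z0 sz' z'0 FE.
have [sF [t t0 [tE _ first]]] := returnF sz z0.
have [sF' [t' t'0 [t'E _ first']]] := returnF sz' z'0.
have E : Phi t (s z) = Phi t' (s z') by rewrite tE t'E FE.
case: (leP t t') => [|/ltW] tt'; first exact: (key _ _ t t').
by symmetry; exact: (key _ _ t' t).
Qed.

End SectionFlux.

Theorem corollary4p1 (R : realType) (M : manifold3 R)
    (compactM : compact [set: M]) (connectedM : connected [set: M])
    (m : volume M) (X : vfield M) (conservativeX : conservative_C1 m X)
    (Phi : R -> M -> M) (flowPhi : is_flow X Phi) :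
  ~ exists L : set M, geometrical_lorenz_set X Phi L.
Proof.
move=> [L [_ _ [U [_ [q [_ _ _ [s [f [g [[[sectionS _] _ returnF lf lg] _]]]]]]]]]].
pose rho (x y : R) := section_flux m X s (clamp x, clamp y).
have punctured_square (x y : R) : @punctured R x -> -1 <= y <= 1 ->
    square ((x, y) : R^o * R^o) /\ ((x, y) : R^o * R^o).1 != 0.
  by move=> [x1 x0] y1.
apply: (@no_area_preserving_lorenz_map R rho f g _ _ lf lg).
- move=> x y; rewrite /rho; have sw := clamp_square x y.
  have [j jw] := mcover (s (clamp x, clamp y)).
  by rewrite (section_fluxE m flowPhi sectionS sw jw); exact: chart_flux_gt0.
- exact: (section_flux_continuous conservativeX flowPhi sectionS).
- move=> x y px y1; have [sz z0] := punctured_square x y px y1.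
  by have [[_]] := returnF _ sz z0.
- move=> x x' y y' px px' y1 y'1 fE gE.
  have [sz z0] := punctured_square x y px y1.
  have [sz' z'0] := punctured_square x' y' px' y'1.
  have := return_injective flowPhi sectionS returnF sz z0 sz' z'0.
  by rewrite /lorenz_map /= fE gE => /(_ erefl)[-> ->].
- move=> x y a l x1 x0 y1 fx1 gy1 da dl.
  have nI (v : R) : -1 < v < 1 -> `|v| < 1 /\ -1 <= v <= 1.
    by move=> v1; rewrite ltr_norml v1; move/andP: v1 => [? ?]; rewrite !ltW.
  have [x1n x1'] := nI x x1; have [y1n y1'] := nI y y1.
  have [fx1n fx1'] := nI _ fx1; have [gy1n gy1'] := nI _ gy1.
  have px : @punctured R x by [].
  have [sz z0] := punctured_square x y px y1'.
  have [sF _] := returnF _ sz z0.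
  have [i iz] := mcover (s (x, y)).
  have [j jF] := mcover (s (lorenz_map f g (x, y))).
  rewrite /rho !clamp_id// (section_fluxE m flowPhi sectionS sz iz).
  rewrite -/(lorenz_map f g (x, y)) (section_fluxE m flowPhi sectionS sF jF).
  exact: (flux_invariant conservativeX flowPhi sectionS returnF).
Qed.
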